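(* Let $T:\Sigma\to\Sigma$ be a topologically mixing two-sided subshift of finite type. Suppose $\mathcal{A}_l,\mathcal{A}\in\mathcal{W}$ with $\mathcal{A}_l\to\mathcal{A}$, and $t_l,t\in\mathbb{R}_+=(0,\infty)$ with $t_l\to t$. Let $\alpha_{t_l}=P'_{\Phi_{\mathcal{A}_l}}(t_l)$ and $\alpha_t=P'_{\Phi_{\mathcal{A}}}(t)$. Then $$\lim_{l\to\infty}h_{top}(E_{\mathcal{A}_l}(\alpha_{t_l}))=h_{top}(E_{\mathcal{A}}(\alpha_t)).$$ Moreover, $$h_{top}(E_{\mathcal{A}}(\alpha_t))\to h_{top}(E_{\mathcal{A}}(\beta(\mathcal{A})))\quad\text{when } t\to\infty.$$
   Context: Subshift: for a $0$-$1$ matrix $Q$, $\Sigma=\{(x_i)_{i\in\mathbb{Z}}: Q_{x_i,x_{i+1}}=1\ \forall i\}$ with left shift $T$. Fix $\omega\in(0,1)$ and the metric $d(x,y)=\omega^{m}$, where $m$ is the largest integer with $x_i=y_i$ for all $|i|<m$. $W^s_{loc}(x)=\{y:y_n=x_n\ \forall n\ge0\}$, $W^u_{loc}(x)=\{y:y_n=x_n\ \forall n<0\}$; $W^s(x)=\{y: T^ny\in W^s_{loc}(T^nx)\text{ for some }n\ge0\}$, $W^u(x)=\{y:T^ny\in W^u_{loc}(T^nx)\text{ for some }n\le0\}$. Cocycles: for $\mathcal{A}:\Sigma\to GL(k,\mathbb{R})$, $\mathcal{A}^n(x)=\mathcal{A}(T^{n-1}x)\cdots\mathcal{A}(x)$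 and $\mathcal{A}^{-n}(x)=\mathcal{A}(T^{-n}x)^{-1}\cdots\mathcal{A}(T^{-1}x)^{-1}$ for $n\ge1$; $\|\cdot\|$ is the Euclidean operator norm. Fix $r>0$. $H^r_b(\Sigma,GL(k,\mathbb{R}))$ is the set of $r$-Hölder maps $\mathcal{A}:\Sigma\to GL(k,\mathbb{R})$ that are fiber bunched: $\|\mathcal{A}(x)\|\,\|\mathcal{A}(x)^{-1}\|\,\omega^r<1$ for all $x$. It carries the distance $D_r(\mathcal{A}_1,\mathcal{A}_2)=\sup_x\|\mathcal{A}_1(x)-\mathcal{A}_2(x)\|+h_r(\mathcal{A}_1-\mathcal{A}_2)$, with $h_r$ the smallest $r$-Hölder constant; convergence $\mathcal{A}_l\to\mathcal{A}$ is with respect to $D_r$. For such $\mathcal{A}$ the canonical holonomies $H^s_{y\leftarrow x}=\lim_{n\to\infty}\mathcal{A}^n(y)^{-1}\mathcal{A}^n(x)$ ($y\in W^s_{loc}(x)$) and $H^u_{y\leftarrow x}=\lim_{n\to-\infty}\mathcal{A}^n(y)^{-1}\mathcal{A}^n(x)$ ($y\in W^u_{loc}(x)$) exist; they extend to $y\in W^{s}(x)$ (resp. $W^u(x)$) by $H^{s/u}_{y\leftarrow x}=\mathcal{A}^n(y)^{-1}H^{s/u}_{T^ny\leftarrow T^nx}\mathcal{A}^n(x)$ with $n$ (resp. $-n$) large. Typical cocycles: $\mathcal{A}\in H^r_b(\Sigma,GL(k,\mathbb{R}))$ is 1-typical if there are a periodic point $p$ and a homoclinic point $z\in W^s(p)\cap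 W^u(p)$, $z\ne p$, such that (i) the eigenvalues of $P:=\mathcal{A}^{per(p)}(p)$ have multiplicity 1 and distinct absolute values, with eigenvectors $v_1,\dots,v_k$; (ii) with $\psi:=H^s_{p\leftarrow z}\circ H^u_{z\leftarrow p}$, for all $1\le i,j\le k$, $\psi(v_i)$ is not in the hyperplane spanned by all the $v_m$ with $m\ne j$. A 1-typical $\mathcal{A}$ is $t$-typical ($2\le t\le k-1$) if, for the same $p,z$: (I) all products of $t$ distinct eigenvalues of $P$ are distinct; (II) the induced map $\psi^{\wedge t}$ on $\wedge^t\mathbb{R}^k$ satisfies the analogue of (ii) with respect to the eigenvectors $\{v_{i_1}\wedge\dots\wedge v_{i_t}\}_{i_1<\dots<i_t}$ of $P^{\wedge t}$. $\mathcal{A}$ is typical if it is $t$-typical for all $1\le t\le k-1$ (same $p,z$); $\mathcal{W}\subset H^r_b(\Sigma,GL(k,\mathbb{R}))$ is the set of typical maps. $E_{\mathcal{A}}(\alpha)=\{x\in\Sigma:\lim_{n\to\infty}\frac1n\log\|\mathcal{A}^n(x)\|=\alpha\}$; $\beta(\mathcal{A})=\lim_{n\to\infty}\frac1n\log\sup_{x\in\Sigma}\|\mathcal{A}^n(x)\|$. Topological entropy of a subset $Y\subset\Sigma$ (Bowen): let $d_n(x,y)=\max_{0\le j<n}d(T^jx,T^jy)$, $B_n(x,\epsilon)$ the open $d_n$-ball. $S(Y,s,N,\epsilon)=\inf\sum_ie^{-sn_i}$ over countable covers of $Y$ by balls $B_{n_i}(x_i,\epsilon)$ with all $n_i\ge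 N$; $S(Y,s,\epsilon)=\lim_{N\to\infty}S(Y,s,N,\epsilon)$; $h_{top}(T,Y,\epsilon)$ is the critical $s$ at which $S(Y,s,\epsilon)$ jumps from $\infty$ to $0$; $h_{top}(Y)=\lim_{\epsilon\to0}h_{top}(T,Y,\epsilon)$. Pressure: $\Phi_{\mathcal{A}}=\{\log\|\mathcal{A}^n\|\}_{n\ge1}$, and $P_{\Phi_{\mathcal{A}}}(q)=\lim_{\epsilon\to0}\limsup_{n\to\infty}\frac1n\log\sup\{\sum_{x\in E}\|\mathcal{A}^n(x)\|^q: E\subset\Sigma\ (n,\epsilon)\text{-separated}\}$, where $E$ is $(n,\epsilon)$-separated if $d_n(x,y)>\epsilon$ for distinct $x,y\in E$. For $\mathcal{A}\in\mathcal{W}$, $P_{\Phi_{\mathcal{A}}}$ is differentiable on $(0,\infty)$, and $P'_{\Phi_{\mathcal{A}}}$ denotes its derivative. *)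

(* Defs.v *)
From HB Require Import structures.
From mathcomp Require Import all_boot all_order all_algebra all_fingroup.
From mathcomp Require Import all_classical all_reals all_analysis.

Set Implicit Arguments.
Unset Strict Implicit.
Unset Printing Implicit Defensive.

Import Order.TTheory GRing.Theory Num.Theory.
Import numFieldNormedType.Exports.

Local Open Scope classical_set_scope.
Local Open Scope ring_scope.

(** * Two-sided subshifts of finite type *)

(* A 0-1 matrix is a boolean matrix. *)
Record subshift (a : nat) (Q : 'M[bool]_a) := Subshift {
  coords :> int -> 'I_a;
  coordsP : forall i : int, Q (coords i) (coords (i + 1))
}.

(* \esum needs a choiceType. *)
HB.instance Definition _ (a : nat) (Q : 'M[bool]_a) := gen_eqMixin (subshift Q).
HB.instance Definition _ (a : nat) (Q : 'M[bool]_a) :=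
  gen_choiceMixin (subshift Q).

Section Shift.
Context {a : nat} {Q : 'M[bool]_a}.
Local Notation Sigma := (subshift Q).

Lemma shift_subproof (n : int) (x : Sigma) (i : int) :
  Q (x (i + n)) (x (i + 1 + n)).
Proof. by rewrite addrAC; exact: coordsP. Qed.

(* shiftz n is the n-th power T^n, n in Z, of the left shift T = shiftz 1. *)
Definition shiftz (n : int) (x : Sigma) : Sigma :=
  @Subshift a Q (fun i => x (i + n)) (shift_subproof n x).

Definition least_period (p : Sigma) (n : nat) : Prop :=
  [/\ (0 < n)%N, shiftz n%:Z p = p &
      forall m : nat, (0 < m < n)%N -> shiftz m%:Z p <> p].

Definition Wsloc (x : Sigma) : set Sigma :=
  [set y | forall n : int, 0 <= n -> y n = x n].

Definition Wuloc (x : Sigma) : set Sigma :=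
  [set y | forall n : int, n < 0 -> y n = x n].

Definition Ws (x : Sigma) : set Sigma :=
  [set y | exists n : nat, Wsloc (shiftz n%:Z x) (shiftz n%:Z y)].

Definition Wu (x : Sigma) : set Sigma :=
  [set y | exists n : nat, Wuloc (shiftz (- n%:Z) x) (shiftz (- n%:Z) y)].

Definition agree (x y : Sigma) (m : nat) : Prop :=
  forall i : int, (`|i| < m%:Z)%R -> x i = y i.

(* For x <> y, the largest m such that x_i = y_i whenever |i| < m. *)
Definition agreement (x y : Sigma) : nat :=
  xget 0%N [set m | agree x y m /\
                    forall m' : nat, agree x y m' -> (m' <= m)%N].

Context {R : realType} (omega : R).

Definition sdist (x y : Sigma) : R :=
  if x == y then 0 else omega ^+ agreement x y.

Definition sopen (U : set Sigma) : Prop :=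
  forall x, U x -> exists2 e : R, 0 < e & [set y | sdist x y < e] `<=` U.

Definition topologically_mixing : Prop :=
  forall U V : set Sigma, sopen U -> sopen V -> U !=set0 -> V !=set0 ->
  exists N : nat, forall n : nat, (N <= n)%N ->
  (shiftz n%:Z @` U) `&` V !=set0.

Definition bowen_dist (n : nat) (x y : Sigma) : R :=
  \big[Num.max/0]_(j < n) sdist (shiftz (j : nat)%:Z x) (shiftz (j : nat)%:Z y).

Definition bowen_ball (n : nat) (x : Sigma) (e : R) : set Sigma :=
  [set y | bowen_dist n x y < e].

(** * Topological entropy of a subset *)

(* A countable cover is a family of balls B_(n i)(x i, e) indexed by an
   arbitrary set D of natural numbers. *)
Definition bowen_cover (Y : set Sigma) (N : nat) (e : R)
    (D : set nat) (n : nat -> nat) (x : nat -> Sigma) : Prop :=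
  (forall i, D i -> (N <= n i)%N) /\
  Y `<=` \bigcup_(i in D) bowen_ball (n i) (x i) e.

Definition bowen_sum_N (Y : set Sigma) (s : R) (N : nat) (e : R) : \bar R :=
  ereal_inf [set S | exists D n x, bowen_cover Y N e D n x /\
    S = (\esum_(i in D) (expR (- s * (n i)%:R))%:E)%E].

Definition bowen_sum (Y : set Sigma) (s e : R) : \bar R :=
  limn (fun N => bowen_sum_N Y s N e).

Definition htop_eps (Y : set Sigma) (e : R) : \bar R :=
  ereal_inf [set s%:E | s in [set s : R | bowen_sum Y s e = 0%E]].

Definition htop (Y : set Sigma) : \bar R :=
  lim (htop_eps Y e @[e --> 0^'+]).

End Shift.

(** * Linear algebra *)

Section LinearAlgebra.
Context {R : realType} {k : nat}.

Definition enorm (v : 'cV[R]_k) : R := Num.sqrt (\sum_i v i 0 ^+ 2).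

(* Euclidean operator norm; the norm `|M| of the library is the sup norm of the
   entries. *)
Definition opnorm (M : 'M[R]_k) : R :=
  sup [set enorm (M *m v) | v in [set v : 'cV[R]_k | enorm v <= 1]].

(* Tensors of order t over R^k, by coordinates: w f is the coefficient of
   e_(f 0) (x) ... (x) e_(f (t-1)).  The exterior power is realized as the
   subspace of alternating tensors. *)
Definition tensor (t : nat) := {ffun {ffun 'I_t -> 'I_k} -> R^o}.

(* u_0 /\ ... /\ u_(t-1) =
     \sum_s sgn(s) u_(s 0) (x) ... (x) u_(s (t-1)). *)
Definition wedge (t : nat) (u : 'I_t -> 'cV[R]_k) : tensor t :=
  [ffun f : {ffun 'I_t -> 'I_k} =>
    (\det (\matrix_(i < t, j < t) u i (f j) 0) : R^o)].

(* The t-th tensor power of M, which restricts to the induced map M^(/\t) on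
   alternating tensors; see ext_pow_wedge. *)
Definition ext_pow (t : nat) (M : 'M[R]_k) (w : tensor t) : tensor t :=
  [ffun f : {ffun 'I_t -> 'I_k} =>
    (\sum_(g : {ffun 'I_t -> 'I_k}) (\prod_i M (f i) (g i)) * w g : R^o)].

Lemma ext_pow_wedge (t : nat) (M : 'M[R]_k) (u : 'I_t -> 'cV[R]_k) :
  ext_pow M (wedge u) = wedge (fun i => M *m u i).
Proof.
apply/ffunP => f; rewrite !ffunE.
under eq_bigr do rewrite ffunE -det_tr /determinant mulr_sumr.
rewrite exchange_big/= -det_tr /determinant; apply: eq_bigr => s _.
under eq_bigr do rewrite mulrCA -big_split/=.
rewrite -mulr_sumr; congr (_ * _).
under [RHS]eq_bigr do rewrite !mxE.
rewrite bigA_distr_bigA/=; apply: eq_bigr => g _; apply: eq_bigr => i _.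
by rewrite !mxE.
Qed.

(* Multi-indices i_1 < ... < i_t. *)
Definition increasing (t : nat) (s : {ffun 'I_t -> 'I_k}) : bool :=
  [forall i : 'I_t, forall j : 'I_t, (i < j)%N ==> (s i < s j)%N].

Definition wedge_at (t : nat) (v : 'I_k -> 'cV[R]_k)
    (s : {ffun 'I_t -> 'I_k}) : tensor t :=
  wedge (fun i => v (s i)).

(* The eigenvalues of P, with multiplicity, are lambda_1, ..., lambda_k; they
   are automatically real when their absolute values are distinct, since
   non-real eigenvalues come in conjugate pairs. *)
Definition simple_spectrum (P : 'M[R]_k) (lambda : 'I_k -> R)
    (v : 'I_k -> 'cV[R]_k) : Prop :=
  [/\ char_poly P = \prod_i ('X - (lambda i)%:P),
      injective (fun i => `|lambda i|),
      (forall i, v i != 0) &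
      forall i, P *m v i = lambda i *: v i].

Definition twisted (psi : 'M[R]_k) (v : 'I_k -> 'cV[R]_k) : Prop :=
  forall i j : 'I_k,
    psi *m v i \notin <<[seq v m | m <- enum 'I_k & m != j]>>%VS.

Definition distinct_products (t : nat) (lambda : 'I_k -> R) : Prop :=
  forall s s' : {ffun 'I_t -> 'I_k}, increasing s -> increasing s' ->
  s != s' -> \prod_i lambda (s i) != \prod_i lambda (s' i).

Definition other_wedges (t : nat) (v : 'I_k -> 'cV[R]_k)
    (s : {ffun 'I_t -> 'I_k}) : seq (tensor t) :=
  [seq wedge_at v m | m <- enum {: {ffun 'I_t -> 'I_k}}
                    & increasing m && (m != s)].

Definition wedge_twisted (t : nat) (psi : 'M[R]_k)
    (v : 'I_k -> 'cV[R]_k) : Prop :=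
  forall s s' : {ffun 'I_t -> 'I_k}, increasing s -> increasing s' ->
    ext_pow psi (wedge_at v s) \notin <<other_wedges v s'>>%VS.

End LinearAlgebra.

(** * Cocycles *)

Section Cocycles.
Context {a : nat} {Q : 'M[bool]_a} {R : realType} {k : nat}.
Local Notation Sigma := (subshift Q).
Implicit Types A : Sigma -> 'M[R]_k.

Fixpoint cocycle_pos A (n : nat) (x : Sigma) : 'M[R]_k :=
  if n is m.+1 then A (shiftz m%:Z x) *m cocycle_pos A m x else 1%:M.

Fixpoint cocycle_neg A (n : nat) (x : Sigma) : 'M[R]_k :=
  if n is m.+1 then invmx (A (shiftz (- m.+1%:Z) x)) *m cocycle_neg A m x
  else 1%:M.

(* A^n(x) for n in Z; Negz n is -(n+1). *)
Definition cocycle A (n : int) (x : Sigma) : 'M[R]_k :=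
  match n with
  | Posz n => cocycle_pos A n x
  | Negz n => cocycle_neg A n.+1 x
  end.

Definition holder_bound (omega r : R) (B : Sigma -> 'M[R]_k) (C : R) : Prop :=
  0 <= C /\ forall x y, opnorm (B x - B y) <= C * sdist omega x y `^ r.

(* H^r_b(Sigma, GL(k, R)) *)
Definition fiber_bunched (omega r : R) A : Prop :=
  [/\ forall x, A x \in unitmx,
      exists C, holder_bound omega r A C &
      forall x, opnorm (A x) * opnorm (invmx (A x)) * omega `^ r < 1].

Definition holder_const (omega r : R) (B : Sigma -> 'M[R]_k) : R :=
  inf [set C | holder_bound omega r B C].

Definition Dr (omega r : R) (A1 A2 : Sigma -> 'M[R]_k) : R :=
  sup [set opnorm (A1 x - A2 x) | x in [set: Sigma]] +
  holder_const omega r (fun x => A1 x - A2 x).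

Definition Hs_loc A (y x : Sigma) : 'M[R]_k :=
  lim ((invmx (cocycle A n%:Z y) *m cocycle A n%:Z x) @[n --> \oo]).

Definition Hu_loc A (y x : Sigma) : 'M[R]_k :=
  lim ((invmx (cocycle A (- n%:Z) y) *m cocycle A (- n%:Z) x) @[n --> \oo]).

(* The value does not depend on the chosen n: a n that works can be replaced by
   any larger one. *)
Definition Hs A (y x : Sigma) : 'M[R]_k :=
  let n := (xget 0%N
    [set n : nat | Wsloc (shiftz n%:Z x) (shiftz n%:Z y)])%:Z in
  invmx (cocycle A n y) *m Hs_loc A (shiftz n y) (shiftz n x) *m cocycle A n x.

Definition Hu A (y x : Sigma) : 'M[R]_k :=
  let n := - (xget 0%N
    [set n : nat | Wuloc (shiftz (- n%:Z) x) (shiftz (- n%:Z) y)])%:Z in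
  invmx (cocycle A n y) *m Hu_loc A (shiftz n y) (shiftz n x) *m cocycle A n x.

(* For k = 1 the range of t is empty and the conditions at t = 1 hold
   automatically. *)
Definition typical (omega r : R) A : Prop :=
  fiber_bunched omega r A /\
  exists (p z : Sigma) (per : nat),
    [/\ least_period p per, Ws p z, Wu p z & z <> p] /\
  exists (lambda : 'I_k -> R) (v : 'I_k -> 'cV[R]_k),
    let psi := Hs A p z *m Hu A z p in
    [/\ simple_spectrum (cocycle A per%:Z p) lambda v,
        twisted psi v &
        forall t : nat, (2 <= t <= k.-1)%N ->
          distinct_products t lambda /\ wedge_twisted t psi v].

(** * Level sets, maximal exponent and pressure *)

Definition level_set A (alpha : R) : set Sigma :=
  [set x | (n%:R^-1 * ln (opnorm (cocycle A n%:Z x))) @[n --> \oo] --> alpha].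

Definition max_exponent A : R :=
  limn (fun n : nat => n%:R^-1 *
    ln (sup [set opnorm (cocycle A n%:Z x) | x in [set: Sigma]])).

Definition separated (omega : R) (n : nat) (e : R) (E : set Sigma) : Prop :=
  forall x y, E x -> E y -> x <> y -> e < bowen_dist omega n x y.

Definition pressure_sum (omega : R) A (q : R) (n : nat) (e : R) : \bar R :=
  ereal_sup [set (\esum_(x in E) (opnorm (cocycle A n%:Z x) `^ q)%:E)%E
            | E in [set E | separated omega n e E]].

Definition pressure_ereal (omega : R) A (q : R) : \bar R :=
  lim (limn_esup (fun n : nat =>
         (n%:R^-1)%:E * lne (pressure_sum omega A q n e))%E @[e --> 0^'+]).

Definition pressure (omega : R) A (q : R) : R := fine (pressure_ereal omega A q).

Definition dpressure (omega : R) A (q : R) : R := derive1 (pressure omega A) q.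

End Cocycles.

(* Main.v *)
Require Import Defs.
From mathcomp Require Import all_boot all_order all_algebra.
From mathcomp Require Import all_classical all_reals all_analysis.
From mathcomp Require Import ring lra zify.

Import Order.TTheory GRing.Theory Num.Theory.
Import numFieldNormedType.Exports.

Local Open Scope classical_set_scope.
Local Open Scope ring_scope.

Set Implicit Arguments.
Unset Strict Implicit.
Unset Printing Implicit Defensive.

(** For a word [w] let [N(w)] be the supremum of [|A^n|] over the cylinder of [w].
Fiber bunching makes [|A^n|] comparable to [N] on each cylinder, and typicality makes
[N] quasi-multiplicative: [c N(u) N(v) <= N(u s v)] for some connecting word [s] of
bounded length.  To find [s], one follows [p] for a while, then the homoclinic orbit
of [z], then [p] again; this inserts a matrix close to [P^i psi P^j], and by twisting
(only [t = 1] is needed) some [i, j < k] avoids any cancellation.  All the constants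
can be chosen uniformly for the cocycles in a neighbourhood of [A].

For such a weight, [log sum_(|w| = n) N(w)^q] is [n P(q)] up to an error that is
bounded, uniformly in the cocycle; so the pressure [P(q)] depends continuously on the
cocycle.  It is convex, and it has no corner: if the slopes at [t] were [a < b],
then for the Gibbs weights at [t + 1/n] a block of length [n] would have [log N] below
[n b], by an amount of order [n], with a definite probability; on long concatenations of
such blocks the mean of [log N] per letter would then be less than [b].

Let [a = P'(t)].  Covering by words with [log N(w) >= n (a - e)] gives
[htop(E(a)) <= P(q) - q a] for all [q > 0].  Conversely, differentiability at [t] gives
about [exp(n (P(t) - t a))] words of length [n] with [log N(w)] close to [n a];
concatenating longer and longer such words, and distributing mass over the resulting
Moran set, yields [htop(E(a)) = P(t) - t a].  The right-hand side is continuous in the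
cocycle and in [t], by convexity.  As [t] tends to infinity it tends to the infimum of
[P(q) - q beta], where [beta] is the maximal exponent, and the same two bounds identify
this infimum with [htop(E(beta))]. *)

(** * Euclidean operator norm *)

Section OperatorNorm.
Context {R : realType} {k : nat}.
Implicit Types (u v : 'cV[R]_k) (M N : 'M[R]_k).

(** No invariant measure is built. Gibbs states are replaced by weighted sums over words of one
    length, and the mass distribution by a supermartingale on finite words. Since the error in the
    logarithm of such a sum stays bounded in the length, one sum at a large length fixes the
    pressure up to a small error; it involves finitely many suprema, each continuous in the cocycle,
    and this is all that the passage to the limit needs. The delicate point is a
    quasi-multiplicativity constant common to nearby cocycles, while the joined words are
    arbitrarily long and two cocycles diverge along them. Long products are therefore compared only
    with products of the same cocycle on nearby orbits. The number of periods spent near [p] is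
    fixed first, so that fiber bunching beats the conjugation of the distortion errors by a power of
    [P]. Two cocycles are compared only on the inserted block, whose length is then bounded, and the
    neighbourhood is chosen last. *)

Lemma sum_sqr_ge0 n (f : 'I_n -> R) : 0 <= \sum_i f i ^+ 2.
Proof. by apply: sumr_ge0 => i _; exact: sqr_ge0. Qed.

(** Cauchy-Schwarz, from the nonnegative form [s ^ 2 a + 2 s t c + t ^ 2 b] at [(b, - c)]. When
    [b = 0] that point is void, and a large [t] of sign opposite to [c] forces [c = 0]. *)
Lemma sum_mul_le_sqrt n (f g : 'I_n -> R) :
  `|\sum_i f i * g i| <= Num.sqrt (\sum_i f i ^+ 2) * Num.sqrt (\sum_i g i ^+ 2).
Proof.
rewrite -sqrtrM ?sum_sqr_ge0// -[leLHS]sqrtr_sqr ler_wsqrtr//.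
set a := \sum_i f i ^+ 2; set b := \sum_i g i ^+ 2; set c := \sum_i _.
have h (s t : R) : 0 <= s ^+ 2 * a + 2 * s * t * c + t ^+ 2 * b.
  rewrite (_ : _ + _ = \sum_i (s * f i + t * g i) ^+ 2) ?sum_sqr_ge0//.
  rewrite /a /b /c !mulr_sumr -!big_split/=; apply: eq_bigr => i _; ring.
have [b0|b0] := eqVneq b 0.
  rewrite b0 mulr0; have [->|c0] := eqVneq c 0; first by rewrite expr0n.
  have h4 := h 1 (- ((a + 1) / c)).
  rewrite b0 in h4.
  have e : 2 * 1 * - ((a + 1) / c) * c = - 2 * (a + 1) by field.
  have a0 : 0 <= a := sum_sqr_ge0 f.
  by rewrite e in h4; lra.
have bp : 0 < b by rewrite lt_neqAle eq_sym b0 sum_sqr_ge0.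
have h1 := h b (- c).
have e : b ^+ 2 * a + 2 * b * - c * c + (- c) ^+ 2 * b = b * (a * b - c ^+ 2) by ring.
by rewrite e pmulr_rge0// subr_ge0 in h1.
Qed.

Lemma enorm_ge0 v : 0 <= enorm v.
Proof. exact: sqrtr_ge0. Qed.

Lemma enorm_sqr v : enorm v ^+ 2 = \sum_i v i 0 ^+ 2.
Proof. by rewrite sqr_sqrtr ?sum_sqr_ge0. Qed.

Lemma enorm_entry v i : `|v i 0| <= enorm v.
Proof.
rewrite -sqrtr_sqr ler_wsqrtr// (bigD1 i)//= lerDl.
by apply: sumr_ge0 => j _; exact: sqr_ge0.
Qed.

Lemma enormD u v : enorm (u + v) <= enorm u + enorm v.
Proof.
rewrite -(@ler_pXn2r _ 2)// ?nnegrE ?addr_ge0 ?enorm_ge0//.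
rewrite sqrrD !enorm_sqr.
have -> : \sum_i (u + v) i 0 ^+ 2 = \sum_i u i 0 ^+ 2 +
    (\sum_i u i 0 * v i 0) *+ 2 + \sum_i v i 0 ^+ 2.
  rewrite -sumrMnl -!big_split/=; apply: eq_bigr => i _.
  by rewrite mxE sqrrD.
rewrite lerD2r lerD2l lerMn2r/=.
exact: le_trans (ler_norm _) (sum_mul_le_sqrt _ _).
Qed.

Lemma enormZ (a : R) v : enorm (a *: v) = `|a| * enorm v.
Proof.
rewrite /enorm -[X in X * _]sqrtr_sqr -sqrtrM ?sqr_ge0//.
by congr Num.sqrt; rewrite mulr_sumr; apply: eq_bigr => i _; rewrite mxE exprMn.
Qed.

Lemma enorm0 : enorm (0 : 'cV[R]_k) = 0.
Proof. by rewrite -(scale0r 0) enormZ normr0 mul0r. Qed.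

Lemma enormN v : enorm (- v) = enorm v.
Proof. by rewrite -scaleN1r enormZ normrN1 mul1r. Qed.

Lemma enorm_eq0 v : (enorm v == 0) = (v == 0).
Proof.
apply/eqP/eqP => [e|->]; last exact: enorm0.
apply/matrixP => i j; rewrite ord1 mxE; apply/eqP; rewrite -normr_le0 -e.
exact: enorm_entry.
Qed.

Lemma enorm_gt0 v : (0 < enorm v) = (v != 0).
Proof. by rewrite lt_neqAle enorm_ge0 andbT eq_sym enorm_eq0. Qed.

Lemma enorm_le_sum v : enorm v <= \sum_i `|v i 0|.
Proof.
have s0 : 0 <= \sum_i `|v i 0| by exact: sumr_ge0.
rewrite -(@ler_pXn2r _ 2)// ?nnegrE ?enorm_ge0//.
rewrite enorm_sqr [leRHS]expr2 mulr_suml ler_sum// => i _.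
rewrite -real_normK ?num_real// expr2 ler_wpM2l// (bigD1 i)//= lerDl.
exact: sumr_ge0.
Qed.

Lemma enorm_mulmx_le M v : enorm (M *m v) <= (\sum_i \sum_j `|M i j|) * enorm v.
Proof.
apply: (le_trans (enorm_le_sum _)); rewrite mulr_suml ler_sum// => i _.
rewrite mxE; apply: (le_trans (ler_norm_sum _ _ _)).
rewrite mulr_suml ler_sum// => j _; rewrite normrM ler_wpM2l//.
exact: enorm_entry.
Qed.

Lemma opnorm_has_sup M :
  has_sup [set enorm (M *m v) | v in [set v : 'cV[R]_k | enorm v <= 1]].
Proof.
split; first by exists (enorm (M *m 0)), 0 => //=; rewrite enorm0.
exists (\sum_i \sum_j `|M i j|) => _ [v /= v1 <-].
apply: (le_trans (enorm_mulmx_le _ _)); rewrite ler_piMr//.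
by apply: sumr_ge0 => i _; exact: sumr_ge0.
Qed.

Lemma opnorm_ge0 M : 0 <= opnorm M.
Proof.
apply: (le_trans (enorm_ge0 (M *m 0))); apply: ub_le_sup.
  by have [] := opnorm_has_sup M.
by exists 0 => //=; rewrite enorm0.
Qed.

Lemma enorm_mulmx M v : enorm (M *m v) <= opnorm M * enorm v.
Proof.
have [->|v0] := eqVneq v 0; first by rewrite mulmx0 !enorm0 mulr0.
have vp : 0 < enorm v by rewrite enorm_gt0.
rewrite -ler_pdivrMr//.
have -> : enorm (M *m v) / enorm v = enorm (M *m ((enorm v)^-1 *: v)).
  by rewrite -scalemxAr enormZ ger0_norm ?invr_ge0 ?enorm_ge0// mulrC.
apply: ub_le_sup; first by have [] := opnorm_has_sup M.
exists ((enorm v)^-1 *: v) => //=.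
by rewrite enormZ ger0_norm ?invr_ge0 ?enorm_ge0// mulVf// gt_eqF.
Qed.

Lemma opnorm_le M (C : R) : 0 <= C ->
  (forall v, enorm (M *m v) <= C * enorm v) -> opnorm M <= C.
Proof.
move=> C0 h; apply: ge_sup; first by have [] := opnorm_has_sup M.
move=> _ [v /= v1 <-]; apply: (le_trans (h v)); exact: ler_piMr.
Qed.

Lemma opnorm_le_sum M : opnorm M <= \sum_i \sum_j `|M i j|.
Proof.
apply: opnorm_le (enorm_mulmx_le M).
by apply: sumr_ge0 => i _; exact: sumr_ge0.
Qed.

Lemma opnormM M N : opnorm (M *m N) <= opnorm M * opnorm N.
Proof.
apply: opnorm_le; first by rewrite mulr_ge0 ?opnorm_ge0.
move=> v; rewrite -mulmxA -mulrA; apply: (le_trans (enorm_mulmx _ _)).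
by rewrite ler_wpM2l ?opnorm_ge0// enorm_mulmx.
Qed.

Lemma opnormD M N : opnorm (M + N) <= opnorm M + opnorm N.
Proof.
apply: opnorm_le; first by rewrite addr_ge0 ?opnorm_ge0.
move=> v; rewrite mulmxDl mulrDl; apply: (le_trans (enormD _ _)).
by rewrite lerD// enorm_mulmx.
Qed.

Lemma opnormN M : opnorm (- M) = opnorm M.
Proof.
congr sup; apply/seteqP; split => _ [v v1 <-]; exists v => //.
  by rewrite mulNmx enormN.
by rewrite mulNmx enormN.
Qed.

Lemma opnormB M N : opnorm (M - N) <= opnorm M + opnorm N.
Proof. by rewrite -(opnormN N) opnormD. Qed.

Lemma opnorm_distC M N : opnorm (M - N) = opnorm (N - M).
Proof. by rewrite -opnormN opprB. Qed.

Lemma opnorm0 : opnorm (0 : 'M[R]_k) = 0.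
Proof.
apply/eqP; rewrite eq_le opnorm_ge0 andbT; apply: opnorm_le => // v.
by rewrite mul0mx enorm0 mul0r.
Qed.

Lemma opnorm_dist M N : `|opnorm M - opnorm N| <= opnorm (M - N).
Proof.
rewrite ler_norml lerBlDr; apply/andP; split.
  rewrite lerNl opprB lerBlDr opnorm_distC.
  by apply: (le_trans _ (opnormD _ _)); rewrite subrK.
by apply: (le_trans _ (opnormD _ _)); rewrite subrK.
Qed.

Lemma opnorm_entry M i j : `|M i j| <= opnorm M.
Proof.
have e : M i j = (M *m (delta_mx j 0 : 'cV_k)) i 0.
  rewrite mxE (bigD1 j)//= mxE !eqxx mulr1 big1 ?addr0// => l lj.
  by rewrite mxE (negbTE lj) mulr0.
rewrite e; apply: (le_trans (enorm_entry _ _)).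
apply: (le_trans (enorm_mulmx _ _)); rewrite ler_piMr ?opnorm_ge0//.
apply: (le_trans (enorm_le_sum _)).
rewrite (bigD1 j)//= mxE !eqxx normr1 big1 ?addr0// => l lj.
by rewrite mxE (negbTE lj) normr0.
Qed.

(** Lower bounds for norms of products can thus be checked on one entry, a scalar of the form row
    times matrix times column. *)
Lemma opnorm_max_entry M : (0 < k)%N ->
  exists i j, opnorm M <= k%:R ^+ 2 * `|M i j|.
Proof.
move=> k0; pose i0 := Ordinal k0.
pose p := [arg max_(p > (i0, i0)) `|M p.1 p.2|]%O.
have hp q : `|M q.1 q.2| <= `|M p.1 p.2|.
  by rewrite /p; case: arg_maxP => // i _ h; exact: h.
exists p.1, p.2; apply: (le_trans (opnorm_le_sum _)).
apply: (@le_trans _ _ (\sum_(i < k) \sum_(j < k) `|M p.1 p.2|)).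
  by apply: ler_sum => i _; apply: ler_sum => j _; exact: (hp (i, j)).
by rewrite !sumr_const !card_ord -mulrnA -[leLHS]mulr_natl natrM expr2.
Qed.

Lemma opnorm1_le : opnorm (1%:M : 'M[R]_k) <= 1.
Proof. by apply: opnorm_le => // v; rewrite mul1mx mul1r. Qed.

Lemma opnorm1 : (0 < k)%N -> opnorm (1%:M : 'M[R]_k) = 1.
Proof.
move=> k0; apply/eqP; rewrite eq_le opnorm1_le/=.
by have := opnorm_entry 1%:M (Ordinal k0) (Ordinal k0); rewrite mxE eqxx normr1.
Qed.

Lemma opnorm_unit_ge1 M : (0 < k)%N -> M \in unitmx ->
  1 <= opnorm M * opnorm (invmx M).
Proof. by move=> k0 uM; rewrite -opnorm1// -(mulmxV uM) opnormM. Qed.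

Lemma opnorm_unit_gt0 M : (0 < k)%N -> M \in unitmx -> 0 < opnorm M.
Proof.
move=> k0 uM; rewrite lt_neqAle opnorm_ge0 andbT eq_sym.
apply: contraTneq (opnorm_unit_ge1 k0 uM) => ->.
by rewrite mul0r -ltNge ltr01.
Qed.

(** Comes from [N^-1 = M^-1 + N^-1 (M - N) M^-1]. The form without division postpones any smallness
    condition to its uses. *)
Lemma opnorm_inv_le M N : M \in unitmx -> N \in unitmx ->
  opnorm (invmx N) * (1 - opnorm (invmx M) * opnorm (N - M)) <= opnorm (invmx M).
Proof.
move=> uM uN.
have e : invmx N = invmx M + invmx N *m (M - N) *m invmx M.
  by rewrite mulmxBr mulmxBl -mulmxA mulmxV// mulVmx// mulmx1 mul1mx addrC subrK.
rewrite mulrBr mulr1 lerBlDr {1}e; apply: (le_trans (opnormD _ _)).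
rewrite lerD2l; apply: (le_trans (opnormM _ _)).
rewrite [X in _ <= _ * X]mulrC mulrA ler_wpM2r ?opnorm_ge0// opnorm_distC.
exact: opnormM.
Qed.

Lemma row_mul_le (X : 'rV[R]_k) M v :
  `|(X *m M *m v) 0 0| <= enorm X^T * opnorm M * enorm v.
Proof.
rewrite -mulmxA mxE -mulrA.
have -> : \sum_j X 0 j * (M *m v) j 0 = \sum_j X^T j 0 * (M *m v) j 0.
  by apply: eq_bigr => j _; rewrite [X^T _ _]mxE.
apply: (le_trans (sum_mul_le_sqrt _ _)).
by rewrite ler_wpM2l ?enorm_ge0// enorm_mulmx.
Qed.

(** Tested on the vector [Y^T], for which [Y *m Y^T] is the square of the norm to be bounded. *)
Lemma enorm_row_mul (X : 'rV[R]_k) M : enorm (X *m M)^T <= opnorm M * enorm X^T.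
Proof.
set Y := X *m M.
have [->|Y0] := eqVneq Y^T 0; first by rewrite enorm0 mulr_ge0 ?opnorm_ge0 ?enorm_ge0.
have Yp : 0 < enorm Y^T by rewrite enorm_gt0.
rewrite -(ler_pM2r Yp) -expr2 enorm_sqr.
have := row_mul_le X M Y^T; rewrite -/Y mxE [X in _ -> _ <= X * _]mulrC.
apply: le_trans; rewrite ler_normr; apply/orP; left.
by apply: ler_sum => i _; rewrite !mxE expr2.
Qed.

Lemma enorm_col_entry M i j : `|M i j| <= enorm (col j M).
Proof. by have := enorm_entry (col j M) i; rewrite mxE. Qed.

Lemma enorm_row_entry M i j : `|M i j| <= enorm (row i M)^T.
Proof. by have := enorm_entry (row i M)^T j; rewrite !mxE. Qed.

End OperatorNorm.

(** * Quasi-multiplicative weights on words *)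

Section Words.
Context {T : finType}.

Fixpoint words (n : nat) : seq (seq T) :=
  if n is m.+1 then [seq a :: w | a <- enum T, w <- words m] else [:: [::]].

Lemma mem_words n w : (w \in words n) = (size w == n).
Proof.
elim: n w => [|n IH] [|a w] /=; rewrite ?inE//.
  by apply/negbTE/negP => /allpairsP[[x y]] [].
rewrite eqSS -IH; apply/allpairsP/idP => [[[x y] /= [_ h [_ ->]]]//|h].
by exists (a, w); rewrite /= mem_enum.
Qed.

Lemma size_words n w : w \in words n -> size w = n.
Proof. by rewrite mem_words => /eqP. Qed.

Lemma card_words n : size (words n) = (#|T| ^ n)%N.
Proof. by elim: n => //= n IH; rewrite size_allpairs IH -cardE expnS. Qed.

Lemma uniq_words n : uniq (words n).
Proof.
elim: n => //= n IH; apply: allpairs_uniq => //; first exact: enum_uniq.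
by move=> [a w] [b v] _ _ /= [-> ->].
Qed.

Lemma big_words_cat (R : nmodType) n m (F : seq T -> R) :
  \sum_(w <- words (n + m)) F w =
  \sum_(u <- words n) \sum_(v <- words m) F (u ++ v).
Proof.
elim: n F => [|n IH] F; first by rewrite add0n big_seq1.
by rewrite addSn /= !big_allpairs_dep; apply: eq_bigr => a _; rewrite IH.
Qed.

End Words.

(** * Almost additive sequences *)

Section AlmostAdditive.
Context {R : realType}.

Lemma le_of_natmul (x y C : R) : (forall n : nat, n%:R * x <= n%:R * y + C) ->
  x <= y.
Proof.
move=> h; rewrite leNgt; apply/negP => yx.
have d0 : 0 < x - y by rewrite subr_gt0.
have := h (Num.bound (C / (x - y))).+1; apply/negP; rewrite -ltNge.
rewrite -ltrBrDl -mulrBr -ltr_pdivrMr//.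
apply: (le_lt_trans (ler_norm _)).
apply: (lt_trans (archi_boundP (normr_ge0 _))).
by rewrite ltr_nat ltnS /Num.bound normr_id.
Qed.

(** Comparing [f (m * n)] with both [m * f n] and [n * f m] shows that every [f n / n - 2 C / n]
    lies below every [f m / m + 2 C / m]; the supremum of the former is the limit and comes with its
    error bound. *)
Lemma almost_additive (f : nat -> R) (C : R) :
  (forall n m, `|f (n + m)%N - f n - f m| <= C) ->
  exists l, forall n, `|f n - n%:R * l| <= 2 * C.
Proof.
move=> h.
have f0 : `|f 0%N| <= C by have := h 0%N 0%N; rewrite addn0 subrr sub0r normrN.
have C0 : 0 <= C by apply: le_trans f0.
have hm n m : `|f (m * n)%N - m%:R * f n| <= (m%:R + 1) * C.
  elim: m => [|m IH]; first by rewrite mul0n mul0r subr0 add0r mul1r.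
  have := h n (m * n)%N; rewrite -mulSn => h1.
  have -> : f (m.+1 * n)%N - m.+1%:R * f n =
     (f (m.+1 * n)%N - f n - f (m * n)%N) + (f (m * n)%N - m%:R * f n).
    by rewrite -natr1; ring.
  apply: (le_trans (ler_normD _ _)); rewrite -natr1; lra.
have hq n m : (0 < n)%N -> (0 < m)%N ->
    `|f n / n%:R - f m / m%:R| <= 2 * C * (n%:R^-1 + m%:R^-1).
  move=> n0 m0.
  have n1 : 1 <= n%:R :> R by rewrite (ler_nat R 1).
  have m1 : 1 <= m%:R :> R by rewrite (ler_nat R 1).
  have e : f n / n%:R - f m / m%:R =
    ((f (m * n)%N - n%:R * f m) - (f (m * n)%N - m%:R * f n)) / (n%:R * m%:R).
    by field; lra.
  have p : 0 < n%:R * m%:R :> R by rewrite mulr_gt0//; lra.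
  rewrite e normrM normfV (ger0_norm (ltW p)) ler_pdivrMr//.
  apply: (le_trans (ler_normB _ _)).
  have -> : 2 * C * (n%:R^-1 + m%:R^-1) * (n%:R * m%:R) = 2 * C * (m%:R + n%:R) :> R.
    by field; lra.
  have := hm n m; have := hm m n; rewrite mulnC => a1 a2.
  apply: (le_trans (lerD a1 a2)); nra.
pose S := [set x | exists2 n : nat, (0 < n)%N & x = f n / n%:R - 2 * C / n%:R].
have ub m : (0 < m)%N -> ubound S (f m / m%:R + 2 * C / m%:R).
  move=> m0 _ [n n0 ->]; have := hq _ _ n0 m0.
  by rewrite ler_norml => /andP[_]; rewrite mulrDr; lra.
exists (sup S) => -[|n]; first by rewrite mul0r subr0; lra.
have n0 : (0 < n.+1)%N by [].
have nr : 0 < n.+1%:R :> R by rewrite ltr0n.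
have h1 : sup S <= f n.+1 / n.+1%:R + 2 * C / n.+1%:R.
  by apply: ge_sup; [exists (f 1%N / 1 - 2 * C / 1), 1%N | exact: ub].
have h2 : f n.+1 / n.+1%:R - 2 * C / n.+1%:R <= sup S.
  by apply: ub_le_sup; [exists (f 1%N / 1 + 2 * C / 1); exact: (ub 1%N) | exists n.+1].
rewrite -mulrDl ler_pdivlMr// in h1.
rewrite -mulrBl ler_pdivrMr// in h2.
by rewrite ler_norml; apply/andP; split; lra.
Qed.

End AlmostAdditive.

Lemma expRN1_le (R : realType) : 2 * expR (- 1) <= 1 :> R.
Proof.
have h1 : 2 <= expR 1 :> R by have := expR_ge1Dx (1 : R); lra.
by have := ler_wpM2r (expR_ge0 (- 1)) h1; rewrite -expRD subrr expR0.
Qed.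

Lemma expRN2_le (R : realType) : 4 * expR (- 2) <= 1 :> R.
Proof.
have -> : 4 * expR (- 2) = (2 * expR (- 1)) * (2 * expR (- 1)) :> R.
  by rewrite mulrACA -expRD; congr (_ * expR _); ring.
by apply: mulr_ile1; rewrite ?mulr_ge0 ?expR_ge0 ?expRN1_le.
Qed.

(** * Weighted words: partition sums and pressure *)

Section QmSystem.
Context {R : realType} {T : finType}.

(** A weight on a factorial language that extends to both sides; one letter changes [ln N] by at
    most [D], and the connecting words of [qm_join] have variable length at most [K]. The constants
    are parameters because a whole neighbourhood of cocycles has to share them. *)
Record qm_system (L : pred (seq T)) (N : seq T -> R) (D c : R) (K : nat) : Prop :=
  QmSystem {
  qm_D : 0 <= D;
  qm_c : 0 < c;
  qm_nil : L [::];
  qm_N1 : N [::] = 1;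
  qm_factl : forall u v, L (u ++ v) -> L u;
  qm_factr : forall u v, L (u ++ v) -> L v;
  qm_extr : forall u, L u -> exists a, L (rcons u a);
  qm_extl : forall u, L u -> exists a, L (a :: u);
  qm_gt0 : forall u, L u -> 0 < N u;
  qm_sub : forall u v, L (u ++ v) -> N (u ++ v) <= N u * N v;
  qm_subl : forall u v, L (u ++ v) -> N u <= expR (D * (size v)%:R) * N (u ++ v);
  qm_subr : forall u v, L (u ++ v) -> N v <= expR (D * (size u)%:R) * N (u ++ v);
  qm_bound : forall u, L u -> N u <= expR (D * (size u)%:R);
  qm_join : forall u v, L u -> L v -> exists s : seq T,
    [/\ (size s <= K)%N, L (u ++ s ++ v) & c * (N u * N v) <= N (u ++ s ++ v)]
}.

Context {L : pred (seq T)} {N : seq T -> R} {D c : R} {K : nat}.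
Hypothesis HS : qm_system L N D c K.

Definition qweight (q : R) (w : seq T) : R :=
  if L w then expR (q * ln (N w)) else 0.

Definition qsum (q : R) (n : nat) : R := \sum_(w <- words n) qweight q w.

(** Loss in [ln N] when two words are joined and the result is padded to a fixed length. *)
Let g := D * K%:R - ln c.

Lemma qweight_ge0 q w : 0 <= qweight q w.
Proof. by rewrite /qweight; case: ifP => // _; exact: expR_ge0. Qed.

Lemma N_cat_gt0 u v : L (u ++ v) -> 0 < N u * N v.
Proof.
move=> h; rewrite mulr_gt0//; apply: (qm_gt0 HS).
  exact: (qm_factl HS h).
exact: (qm_factr HS h).
Qed.

Lemma lnN_cat u v : L (u ++ v) -> ln (N (u ++ v)) <= ln (N u) + ln (N v).
Proof.
move=> h; rewrite -lnM ?posrE; first by rewrite ler_ln ?posrE ?N_cat_gt0 ?(qm_gt0 HS)// (qm_sub HS).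
  by apply: (qm_gt0 HS); exact: (qm_factl HS h).
by apply: (qm_gt0 HS); exact: (qm_factr HS h).
Qed.

Lemma lnN_subl u v : L (u ++ v) -> ln (N u) <= D * (size v)%:R + ln (N (u ++ v)).
Proof.
move=> h; have h1 := qm_factl HS h.
rewrite -[X in X + _]expRK -lnM ?posrE ?expR_gt0 ?(qm_gt0 HS)//.
by rewrite ler_ln ?posrE ?mulr_gt0 ?expR_gt0 ?(qm_gt0 HS)// (qm_subl HS).
Qed.

Lemma lnN_subr u v : L (u ++ v) -> ln (N v) <= D * (size u)%:R + ln (N (u ++ v)).
Proof.
move=> h; have h1 := qm_factr HS h.
rewrite -[X in X + _]expRK -lnM ?posrE ?expR_gt0 ?(qm_gt0 HS)//.
by rewrite ler_ln ?posrE ?mulr_gt0 ?expR_gt0 ?(qm_gt0 HS)// (qm_subr HS).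
Qed.

Lemma lnN_le u : L u -> ln (N u) <= D * (size u)%:R.
Proof.
move=> h; rewrite -[X in _ <= X]expRK ler_ln ?posrE ?expR_gt0 ?(qm_gt0 HS)//.
exact: (qm_bound HS).
Qed.

Lemma lnN_ge u : L u -> - (D * (size u)%:R) <= ln (N u).
Proof. by move=> h; have := @lnN_subl [::] u h; rewrite (qm_N1 HS) ln1; lra. Qed.

Lemma normr_lnN u : L u -> `|ln (N u)| <= D * (size u)%:R.
Proof. by move=> h; rewrite ler_norml lnN_ge ?lnN_le. Qed.

Lemma extend_right u n : L u -> exists2 v, size v = n & L (u ++ v).
Proof.
move=> Lu; elim: n => [|n [v sv Lv]]; first by exists [::]; rewrite ?cats0.
have [a La] := qm_extr HS Lv.
by exists (rcons v a); rewrite ?size_rcons ?sv -?rcons_cat.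
Qed.

Lemma extend_left u n : L u -> exists2 v, size v = n & L (v ++ u).
Proof.
move=> Lu; elim: n => [|n [v sv Lv]]; first by exists [::].
by have [a La] := qm_extl HS Lv; exists (a :: v); rewrite //= sv.
Qed.

Lemma word_exists n : exists2 w, size w = n & L w.
Proof. by have [w sw Lw] := extend_right n (qm_nil HS); exists w. Qed.

Lemma qsum_gt0 q n : 0 < qsum q n.
Proof.
have [w sw Lw] := word_exists n.
have hw : w \in words n by rewrite mem_words sw.
rewrite /qsum (big_rem w)//= ltr_wpDr//; last by rewrite /qweight Lw expR_gt0.
by apply: sumr_ge0 => i _; exact: qweight_ge0.
Qed.

Lemma qweight_cat q u v : 0 <= q ->
  qweight q (u ++ v) <= qweight q u * qweight q v.
Proof.
move=> q0; rewrite {1}/qweight; case: ifPn => [h|_]; last by rewrite mulr_ge0 ?qweight_ge0.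
rewrite /qweight (qm_factl HS h) (qm_factr HS h) -expRD ler_expR -mulrDr.
by rewrite ler_wpM2l// lnN_cat.
Qed.

Lemma qsum_cat q n m : 0 <= q -> qsum q (n + m) <= qsum q n * qsum q m.
Proof.
move=> q0; rewrite /qsum big_words_cat mulr_suml; apply: ler_sum => u _.
by rewrite mulr_sumr; apply: ler_sum => v _; exact: qweight_cat.
Qed.

(** The connecting word has variable length; the padding [r] brings the total to that of [u] and [v]
    plus [K], as sums over words of one length require. *)
Lemma join_right u v : L u -> L v -> exists s r : seq T,
  [/\ (size s <= K)%N, (size s + size r = K)%N, L (u ++ s ++ v ++ r) &
   ln (N u) + ln (N v) - g <= ln (N (u ++ s ++ v ++ r))].
Proof.
move=> Lu Lv; have [s [sK Ls hs]] := qm_join HS Lu Lv.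
have [r sr Lr] := extend_right (K - size s) Ls.
exists s, r; rewrite sr subnKC//; rewrite -!catA in Lr; split => //.
have h1 := @lnN_subl (u ++ s ++ v) r; rewrite -!catA in h1.
have {}h1 := h1 Lr.
have h2 : ln c + (ln (N u) + ln (N v)) <= ln (N (u ++ s ++ v)).
  have uv0 : 0 < N u * N v by rewrite mulr_gt0 ?(qm_gt0 HS).
  rewrite -[X in _ + X]lnM ?posrE ?(qm_gt0 HS)//.
  rewrite -lnM ?posrE ?(qm_c HS)//.
  by rewrite ler_ln ?posrE ?(qm_gt0 HS)// mulr_gt0 ?(qm_c HS).
have h3 : D * (size r)%:R <= D * K%:R.
  by rewrite ler_wpM2l ?(qm_D HS)// ler_nat sr leq_subr.
rewrite /g; lra.
Qed.

Lemma join_left u v : L u -> L v -> exists s r : seq T,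
  [/\ (size s <= K)%N, (size s + size r = K)%N, L (r ++ u ++ s ++ v) &
   ln (N u) + ln (N v) - g <= ln (N (r ++ u ++ s ++ v))].
Proof.
move=> Lu Lv; have [s [sK Ls hs]] := qm_join HS Lu Lv.
have [r sr Lr] := extend_left (K - size s) Ls.
exists s, r; rewrite sr subnKC//; split => //.
have h1 := @lnN_subr r (u ++ s ++ v) Lr.
have h2 : ln c + (ln (N u) + ln (N v)) <= ln (N (u ++ s ++ v)).
  have uv0 : 0 < N u * N v by rewrite mulr_gt0 ?(qm_gt0 HS).
  rewrite -[X in _ + X]lnM ?posrE ?(qm_gt0 HS)//.
  rewrite -lnM ?posrE ?(qm_c HS)//.
  by rewrite ler_ln ?posrE ?(qm_gt0 HS)// mulr_gt0 ?(qm_c HS).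
have h3 : D * (size r)%:R <= D * K%:R.
  by rewrite ler_wpM2l ?(qm_D HS)// ler_nat sr leq_subr.
rewrite /g; lra.
Qed.

Lemma le_big_seq (I : eqType) (r : seq I) (F : I -> R) i :
  i \in r -> (forall j, 0 <= F j) -> F i <= \sum_(j <- r) F j.
Proof.
move=> ir F0; rewrite (big_rem i)//= lerDl.
by apply: sumr_ge0 => j _; exact: F0.
Qed.

(** All pairs [(s, r)] are summed, not only the one that joins [u] and [v]: the terms are
    nonnegative, and this spares an injectivity argument when [u] and [v] vary. *)
Lemma join_right_sum q u v : 0 <= q -> qweight q u * qweight q v <=
  expR (q * g) * \sum_(l < K.+1) \sum_(s <- words l) \sum_(r <- words (K - l))
    qweight q (u ++ s ++ v ++ r).
Proof.
move=> q0; set RHS := (X in _ <= X).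
have R0 : 0 <= RHS.
  rewrite mulr_ge0 ?expR_ge0//; apply: sumr_ge0 => l _; apply: sumr_ge0 => s _.
  by apply: sumr_ge0 => r _; exact: qweight_ge0.
rewrite {1}/qweight; case: ifPn => [Lu|_]; last by rewrite mul0r.
rewrite /qweight; case: ifPn => [Lv|_]; last by rewrite mulr0.
have [s [r [sK srK Lw hw]]] := join_right Lu Lv.
rewrite -expRD /RHS.
apply: (@le_trans _ _ (expR (q * g) * qweight q (u ++ s ++ v ++ r))).
  by rewrite /qweight Lw -expRD ler_expR -!mulrDr ler_wpM2l//; lra.
rewrite ler_wpM2l ?expR_ge0//.
have sK' : (size s < K.+1)%N by [].
rewrite (bigD1 (Ordinal sK'))//=.
apply: (@le_trans _ _ (\sum_(s0 <- words (size s)) \sum_(r0 <- words (K - size s))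
    qweight q (u ++ s0 ++ v ++ r0))); last first.
  rewrite lerDl; apply: sumr_ge0 => l _; apply: sumr_ge0 => s0 _.
  by apply: sumr_ge0 => r0 _; exact: qweight_ge0.
apply: (le_trans _ (@le_big_seq _ _ (fun s0 => \sum_(r0 <- words (K - size s))
    qweight q (u ++ s0 ++ v ++ r0)) s _ _)); last 2 first.
- by rewrite mem_words.
- by move=> j; apply: sumr_ge0 => r0 _; exact: qweight_ge0.
apply: (@le_big_seq _ _ (fun r0 => qweight q (u ++ s ++ v ++ r0)) r) => [|j].
  by rewrite mem_words -srK addKn.
exact: qweight_ge0.
Qed.

Lemma join_left_sum q u v : 0 <= q -> qweight q u * qweight q v <=
  expR (q * g) * \sum_(l < K.+1) \sum_(r <- words (K - l)) \sum_(s <- words l)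
    qweight q (r ++ u ++ s ++ v).
Proof.
move=> q0; set RHS := (X in _ <= X).
have R0 : 0 <= RHS.
  rewrite mulr_ge0 ?expR_ge0//; apply: sumr_ge0 => l _; apply: sumr_ge0 => s _.
  by apply: sumr_ge0 => r _; exact: qweight_ge0.
rewrite {1}/qweight; case: ifPn => [Lu|_]; last by rewrite mul0r.
rewrite /qweight; case: ifPn => [Lv|_]; last by rewrite mulr0.
have [s [r [sK srK Lw hw]]] := join_left Lu Lv.
rewrite -expRD /RHS.
apply: (@le_trans _ _ (expR (q * g) * qweight q (r ++ u ++ s ++ v))).
  by rewrite /qweight Lw -expRD ler_expR -!mulrDr ler_wpM2l//; lra.
rewrite ler_wpM2l ?expR_ge0//.
have sK' : (size s < K.+1)%N by [].
rewrite (bigD1 (Ordinal sK'))//=.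
apply: (@le_trans _ _ (\sum_(r0 <- words (K - size s)) \sum_(s0 <- words (size s))
    qweight q (r0 ++ u ++ s0 ++ v))); last first.
  rewrite lerDl; apply: sumr_ge0 => l _; apply: sumr_ge0 => s0 _.
  by apply: sumr_ge0 => r0 _; exact: qweight_ge0.
apply: (le_trans _ (@le_big_seq _ _ (fun r0 => \sum_(s0 <- words (size s))
    qweight q (r0 ++ u ++ s0 ++ v)) r _ _)); last 2 first.
- by rewrite mem_words -srK addKn.
- by move=> j; apply: sumr_ge0 => r0 _; exact: qweight_ge0.
apply: (@le_big_seq _ _ (fun s0 => qweight q (r ++ u ++ s0 ++ v)) s) => [|j].
  by rewrite mem_words.
exact: qweight_ge0.
Qed.

Definition gap_err : R := `|D * K%:R - ln c|.

(** Twice the defect of additivity of [ln (qsum q n)]: the loss of a join, the [K.+1] possible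
    lengths of the connecting word, and a bound of [qsum q K]. The absolute value in [gap_err] makes
    it nondecreasing in [q]. *)
Definition qerr (q : R) : R :=
  2 * (q * gap_err + ln K.+1%:R + ln (#|T| ^ K)%:R + q * (D * K%:R)).

Lemma card_alphabet_gt0 : (0 < #|T|)%N.
Proof. by have [a _] := qm_extr HS (qm_nil HS); apply/card_gt0P; exists a. Qed.

Lemma ln_natS_ge0 (n : nat) : (0 < n)%N -> 0 <= ln n%:R :> R.
Proof. by move=> n0; rewrite ln_ge0// (ler_nat _ 1). Qed.

Lemma qerr_ge0 q : 0 <= q -> 0 <= qerr q.
Proof.
move=> q0; have h1 := @ln_natS_ge0 K.+1 isT.
have h2 : 0 <= ln (#|T| ^ K)%:R :> R.
  by apply: ln_natS_ge0; rewrite expn_gt0 card_alphabet_gt0.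
have h3 : 0 <= q * gap_err by rewrite mulr_ge0// normr_ge0.
have h4 : 0 <= q * (D * K%:R) by rewrite !mulr_ge0// (qm_D HS).
rewrite /qerr; lra.
Qed.

Lemma qerr_le (q q' : R) : q <= q' -> qerr q <= qerr q'.
Proof.
move=> qq; rewrite /qerr ler_wpM2l// !lerD// ler_wpM2r ?normr_ge0//.
by rewrite mulr_ge0// (qm_D HS).
Qed.

Lemma qweight_le q n w : 0 <= q -> w \in words n ->
  qweight q w <= expR (q * (D * n%:R)).
Proof.
move=> q0 /size_words <-; rewrite /qweight; case: ifPn => [Lw|_]; last exact: expR_ge0.
by rewrite ler_expR ler_wpM2l// lnN_le.
Qed.

Lemma qsum_le q n : 0 <= q ->
  qsum q n <= (#|T| ^ n)%:R * expR (q * (D * n%:R)).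
Proof.
move=> q0; have -> : (#|T| ^ n)%:R * expR (q * (D * n%:R)) =
    \sum_(w <- @words T n) expR (q * (D * n%:R)).
  by rewrite big_const_seq count_predT card_words iter_addr addr0 mulr_natl.
by rewrite /qsum !big_seq; apply: ler_sum => w /qweight_le; exact.
Qed.

Lemma qsum_join q n m : 0 <= q ->
  qsum q n * qsum q m <= expR (q * gap_err) * K.+1%:R * qsum q (n + m + K).
Proof.
move=> q0; have h : qsum q n * qsum q m <= expR (q * g) * K.+1%:R * qsum q (n + m + K).
  rewrite /qsum mulr_suml.
  under eq_bigr do rewrite mulr_sumr.
  apply: (@le_trans _ _ (\sum_(u <- words n) \sum_(v <- words m) expR (q * g) *
     \sum_(l < K.+1) \sum_(s <- words l) \sum_(r <- words (K - l))
    qweight q (u ++ s ++ v ++ r))).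
    by apply: ler_sum => u _; apply: ler_sum => v _; exact: join_right_sum.
  under eq_bigr do rewrite -mulr_sumr exchange_big/=.
  rewrite -mulr_sumr exchange_big/= -mulrA ler_wpM2l ?expR_ge0//.
  rewrite mulr_natl -[in X in _ <= X](card_ord K.+1) -sumr_const ler_sum// => l _.
  have -> : (n + m + K = n + (l + (m + (K - l))))%N by have := ltn_ord l; lia.
  rewrite big_words_cat ler_sum// => u _.
  rewrite big_words_cat exchange_big/= ler_sum// => s _.
  by rewrite big_words_cat.
apply: (le_trans h); rewrite ler_wpM2r ?(ltW (qsum_gt0 _ _))//.
by rewrite ler_wpM2r// ler_expR ler_wpM2l// ler_norm.
Qed.

(** One side is submultiplicativity, the other is joining; the [K] surplus letters of the join are
    then removed by submultiplicativity again. *)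
Lemma ln_qsum_additive q n m : 0 <= q ->
  `|ln (qsum q (n + m)) - ln (qsum q n) - ln (qsum q m)| <= qerr q / 2.
Proof.
move=> q0; have e0 := qerr_ge0 q0.
have [zn zm znm zK] := And4 (qsum_gt0 q n) (qsum_gt0 q m) (qsum_gt0 q (n + m))
  (qsum_gt0 q K).
have zc : 0 < (#|T| ^ K)%:R :> R by rewrite ltr0n expn_gt0 card_alphabet_gt0.
rewrite ler_norml; apply/andP; split; last first.
  have := qsum_cat n m q0; rewrite -ler_ln ?posrE ?mulr_gt0// lnM ?posrE//; lra.
have h1 := qsum_join n m q0.
have h2 : qsum q n * qsum q m <=
    expR (q * gap_err) * K.+1%:R * (qsum q (n + m) * ((#|T| ^ K)%:R * expR (q * (D * K%:R)))).
  apply: (le_trans h1); rewrite ler_wpM2l ?mulr_ge0 ?expR_ge0//.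
  apply: (le_trans (qsum_cat _ _ q0)); rewrite ler_wpM2l ?(ltW znm)//.
  exact: qsum_le.
move: h2; rewrite -ler_ln ?posrE ?mulr_gt0 ?expR_gt0 ?ltr0n//.
rewrite !lnM ?posrE ?mulr_gt0 ?expR_gt0 ?ltr0n// ?expn_gt0 ?card_alphabet_gt0// !expRK /qerr.
  lra.
by rewrite expn_gt0 card_alphabet_gt0.
Qed.

(** The limit of [ln (qsum q n) / n], chosen with its error bound; such a value is unique, as two of
    them differ by at most [2 * qerr q / n] for all [n > 0]. *)
Definition qpressure (q : R) : R :=
  xget 0 [set l | forall n, `|ln (qsum q n) - n%:R * l| <= qerr q].

Lemma qpressureP q n : 0 <= q -> `|ln (qsum q n) - n%:R * qpressure q| <= qerr q.
Proof.
move=> q0; have [l hl] := almost_additive (fun n m => ln_qsum_additive n m q0).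
rewrite /qpressure; case: xgetP => [_ _ //|/(_ l) []].
by move=> m /=; rewrite (le_trans (hl m))//; lra.
Qed.

Lemma qsum_upper q n : 0 <= q -> qsum q n <= expR (n%:R * qpressure q + qerr q).
Proof.
move=> q0; rewrite -[leLHS](lnK (qsum_gt0 q n)) ler_expR.
by have := qpressureP n q0; rewrite ler_norml; lra.
Qed.

Lemma qsum_lower q n : 0 <= q -> expR (n%:R * qpressure q - qerr q) <= qsum q n.
Proof.
move=> q0; rewrite -[leRHS](lnK (qsum_gt0 q n)) ler_expR.
by have := qpressureP n q0; rewrite ler_norml; lra.
Qed.

(* The Gibbs distribution on words of length [n] gives a supporting line. *)
Definition qmean (q : R) (n : nat) : R :=
  (\sum_(w <- words n) qweight q w * ln (N w)) / qsum q n.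

(** Jensen's inequality for the Gibbs distribution: [1 + x <= expR x] at
    [x = (q' - q) * (ln (N w) - mu)], whose mean is zero. *)
Lemma ln_qsum_support q q' n :
  ln (qsum q n) + (q' - q) * qmean q n <= ln (qsum q' n).
Proof.
set mu := qmean q n.
rewrite -[X in _ + X]expRK -lnM ?posrE ?qsum_gt0 ?expR_gt0//.
rewrite ler_ln ?posrE ?mulr_gt0 ?qsum_gt0 ?expR_gt0//.
have -> : qsum q n * expR ((q' - q) * mu) = \sum_(w <- words n)
    qweight q w * (expR ((q' - q) * mu) * (1 + (q' - q) * (ln (N w) - mu))).
  transitivity (expR ((q' - q) * mu) * (qsum q n +
     (q' - q) * ((\sum_(w <- words n) qweight q w * ln (N w)) - mu * qsum q n))).
    rewrite /mu /qmean divfK ?gt_eqF ?qsum_gt0// subrr mulr0 addr0 mulrC//.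
  rewrite mulr_sumr -sumrB mulr_sumr -big_split/= mulr_sumr.
  by apply: eq_bigr => w _; ring.
apply: ler_sum => w _; rewrite /qweight; case: ifPn => _; last by rewrite mul0r.
have -> : q' * ln (N w) = q * ln (N w) + ((q' - q) * mu + (q' - q) * (ln (N w) - mu)) by ring.
by rewrite !expRD !ler_wpM2l ?expR_ge0// expR_ge1Dx.
Qed.

Lemma qmean_bound q n : `|qmean q n| <= D * n%:R.
Proof.
rewrite /qmean normrM normfV (gtr0_norm (qsum_gt0 q n)) ler_pdivrMr ?qsum_gt0//.
apply: (le_trans (ler_norm_sum _ _ _)); rewrite /qsum mulr_sumr !big_seq.
apply: ler_sum => w /size_words <-; rewrite normrM ger0_norm ?qweight_ge0// mulrC.
rewrite /qweight; case: ifPn => [Lw|_]; last by rewrite !mulr0.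
by rewrite ler_wpM2r ?expR_ge0// normr_lnN.
Qed.

(** Holds at each finite length by the supporting line at [y]; the errors do not grow with [n] and
    vanish after division by it. *)
Lemma qpressure_convex x y z : 0 <= x -> x <= y -> y <= z ->
  (z - x) * qpressure y <= (z - y) * qpressure x + (y - x) * qpressure z.
Proof.
move=> x0 xy yz.
apply: (@le_of_natmul _ _ _ ((z - x) * (2 * qerr z))) => n.
have h1 := ln_qsum_support y x n.
have h2 := ln_qsum_support y z n.
have e1 := @qerr_le x z (le_trans xy yz); have e2 := qerr_le yz.
have := @qpressureP x n x0; have := @qpressureP y n (le_trans x0 xy).
have := @qpressureP z n (le_trans x0 (le_trans xy yz)).
rewrite !ler_norml => /andP[a1 a2] /andP[a3 a4] /andP[a5 a6].
have b1 : 0 <= y - x by lra.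
have b2 : 0 <= z - y by lra.
have c1 : n%:R * qpressure y - 2 * qerr z + (x - y) * qmean y n <= n%:R * qpressure x by lra.
have c2 : n%:R * qpressure y - 2 * qerr z + (z - y) * qmean y n <= n%:R * qpressure z by lra.
have d1 := ler_wpM2l b2 c1; have d2 := ler_wpM2l b1 c2.
lra.
Qed.

Lemma qpressure_lipschitz x y : 0 <= x -> 0 <= y ->
  `|qpressure x - qpressure y| <= D * `|x - y|.
Proof.
have main x' y' : 0 <= x' -> 0 <= y' -> qpressure x' - qpressure y' <= D * `|x' - y'|.
  move=> x0 y0; apply: (@le_of_natmul _ _ _ (qerr x' + qerr y')) => n.
  have h1 := ln_qsum_support x' y' n.
  have := qpressureP n x0; have := qpressureP n y0.
  rewrite !ler_norml => /andP[a1 a2] /andP[a3 a4].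
  have h2 : `|(y' - x') * qmean x' n| <= n%:R * (D * `|x' - y'|).
    rewrite normrM distrC mulrC mulrA ler_wpM2r// mulrC.
    exact: qmean_bound.
  move: h2; rewrite ler_norml => /andP[h2 h3]; lra.
move=> x0 y0; rewrite ler_norml; apply/andP; split; last exact: main.
by have := main y x y0 x0; rewrite distrC; lra.
Qed.

(** * Differentiability of the pressure *)

Lemma left_marginal q i v : 0 <= q ->
  qsum q i * qweight q v <=
  expR (q * gap_err) * K.+1%:R * \sum_(x <- words (i + K)) qweight q (x ++ v).
Proof.
move=> q0; have h : qsum q i * qweight q v <=
    expR (q * g) * K.+1%:R * \sum_(x <- words (i + K)) qweight q (x ++ v).
  rewrite /qsum mulr_suml.
  apply: le_trans; first by apply: ler_sum => u _; exact: (join_left_sum u v q0).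
  rewrite -mulr_sumr exchange_big/= -mulrA ler_wpM2l ?expR_ge0//.
  rewrite mulr_natl -[in X in _ <= X](card_ord K.+1) -sumr_const ler_sum// => l _.
  have -> : (i + K = (K - l) + (i + l))%N by have := ltn_ord l; lia.
  rewrite big_words_cat exchange_big/= ler_sum// => r _.
  rewrite big_words_cat ler_sum// => u _.
  by apply: ler_sum => s _; rewrite -!catA.
apply: (le_trans h); rewrite ler_wpM2r//.
  by apply: sumr_ge0 => x _; exact: qweight_ge0.
by rewrite ler_wpM2r// ler_expR ler_wpM2l// ler_norm.
Qed.

Lemma right_marginal q j v : 0 <= q ->
  qweight q v * qsum q j <=
  expR (q * gap_err) * K.+1%:R * \sum_(y <- words (j + K)) qweight q (v ++ y).
Proof.
move=> q0; have h : qweight q v * qsum q j <=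
    expR (q * g) * K.+1%:R * \sum_(y <- words (j + K)) qweight q (v ++ y).
  rewrite /qsum mulr_sumr.
  apply: le_trans; first by apply: ler_sum => u _; exact: (join_right_sum v u q0).
  rewrite -mulr_sumr exchange_big/= -mulrA ler_wpM2l ?expR_ge0//.
  rewrite mulr_natl -[in X in _ <= X](card_ord K.+1) -sumr_const ler_sum// => l _.
  have -> : (j + K = l + (j + (K - l)))%N by have := ltn_ord l; lia.
  rewrite big_words_cat exchange_big/= ler_sum// => s _.
  by rewrite big_words_cat.
apply: (le_trans h); rewrite ler_wpM2r//.
  by apply: sumr_ge0 => x _; exact: qweight_ge0.
by rewrite ler_wpM2r// ler_expR ler_wpM2l// ler_norm.
Qed.

(** Unnormalized Gibbs probability that a word of length [i + size v + j] shows [v] at position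
    [i]. *)
Definition marginal q i j v : R :=
  \sum_(u <- words i) \sum_(u' <- words j) qweight q (u ++ v ++ u').

Lemma marginal_le q i j v : 0 <= q ->
  marginal q i j v <= qweight q v * (qsum q i * qsum q j).
Proof.
move=> q0; rewrite /marginal mulrCA /qsum mulr_suml; apply: ler_sum => u _.
rewrite mulrA mulr_sumr; apply: ler_sum => u' _.
apply: (le_trans (qweight_cat _ _ q0)); rewrite -mulrA ler_wpM2l ?qweight_ge0//.
exact: qweight_cat.
Qed.

Definition marginal_const (q : R) : R :=
  (expR (q * gap_err) * K.+1%:R * ((#|T| ^ K)%:R * expR (q * (D * K%:R)))) ^+ 2.

Lemma marginal_const_gt0 q : 0 < marginal_const q.
Proof.
by rewrite exprn_gt0// !mulr_gt0 ?expR_gt0 ?ltr0n ?expn_gt0 ?card_alphabet_gt0.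
Qed.

Lemma marginal_const_le (q q' : R) : q <= q' -> marginal_const q <= marginal_const q'.
Proof.
move=> qq; rewrite /marginal_const lerXn2r ?nnegrE ?mulr_ge0 ?expR_ge0//.
rewrite ler_pM ?mulr_ge0 ?expR_ge0//.
  by rewrite ler_wpM2r// ler_expR ler_wpM2r// normr_ge0.
by rewrite ler_wpM2l// ler_expR ler_wpM2r// mulr_ge0// (qm_D HS).
Qed.

Lemma marginal_ge0 q i j v : 0 <= marginal q i j v.
Proof. by apply: sumr_ge0 => u _; apply: sumr_ge0 => u' _; exact: qweight_ge0. Qed.

(** Gibbs property: up to a constant, the two sides are independent of [v]. On each side of [v], [K]
    letters are used for the join, hence the bounds on [i] and [j]. *)
Lemma marginal_ge q i j v : 0 <= q -> (K <= i)%N -> (K <= j)%N ->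
  qweight q v * (qsum q i * qsum q j) <= marginal_const q * marginal q i j v.
Proof.
move=> q0 Ki Kj; set G := expR (q * gap_err) * K.+1%:R.
set zK := (#|T| ^ K)%:R * expR (q * (D * K%:R)).
have G0 : 0 <= G by rewrite mulr_ge0 ?expR_ge0.
have zK0 : 0 <= zK by rewrite mulr_ge0 ?expR_ge0.
have h : qsum q (i - K) * qweight q v * qsum q (j - K) <= G ^+ 2 * marginal q i j v.
  apply: (@le_trans _ _ (G * \sum_(x <- words i) qweight q (x ++ v) * qsum q (j - K))).
    rewrite -mulr_suml mulrA ler_wpM2r ?(ltW (qsum_gt0 _ _))//.
    by have := left_marginal (i - K) v q0; rewrite subnK.
  rewrite expr2 -mulrA ler_wpM2l// /marginal mulr_sumr ler_sum// => x _.
  have := right_marginal (j - K) (x ++ v) q0; rewrite subnK//.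
  by under eq_bigr do rewrite -catA.
have hz m : (K <= m)%N -> qsum q m <= qsum q (m - K) * zK.
  move=> Km; rewrite -{1}(subnK Km); apply: (le_trans (qsum_cat _ _ q0)).
  by rewrite ler_wpM2l ?(ltW (qsum_gt0 _ _))// qsum_le.
apply: (@le_trans _ _ (qweight q v * ((qsum q (i - K) * zK) * (qsum q (j - K) * zK)))).
  by rewrite ler_wpM2l ?qweight_ge0// ler_pM ?hz// ltW// qsum_gt0.
have -> : qweight q v * (qsum q (i - K) * zK * (qsum q (j - K) * zK)) =
   zK ^+ 2 * (qsum q (i - K) * qweight q v * qsum q (j - K)) by ring.
have -> : marginal_const q * marginal q i j v =
    zK ^+ 2 * (G ^+ 2 * marginal q i j v) by rewrite /marginal_const -/G -/zK; ring.
by rewrite ler_wpM2l ?sqr_ge0.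
Qed.

Lemma lnN_blocks n B w : L w -> size w = (B * n)%N ->
  ln (N w) <= \sum_(j < B) ln (N (take n (drop (j * n) w))).
Proof.
elim: B w => [|B IH] w Lw sw.
  by move: sw; rewrite mul0n => /size0nil ->; rewrite (qm_N1 HS) ln1 big_ord0.
rewrite big_ord_recl/= mul0n drop0.
have e := cat_take_drop n w; rewrite -[in X in X <= _]e.
have Lw' : L (take n w ++ drop n w) by rewrite e.
apply: (le_trans (lnN_cat Lw')); rewrite lerD2l.
apply: (le_trans (IH _ (qm_factr HS Lw') _)).
  by rewrite size_drop sw mulSn addKn.
by apply: ler_sum => j _; rewrite drop_drop /bump /= add1n mulSn addnC.
Qed.

Lemma block_sum q n B (j : 'I_B) (F : seq T -> R) :
  \sum_(w <- words (B * n)) qweight q w * F (take n (drop (j * n) w)) =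
  \sum_(v <- words n) marginal q (j * n) ((B - j.+1) * n) v * F v.
Proof.
have e : (B * n = j * n + (n + (B - j.+1) * n))%N.
  by rewrite -{1}(subnK (ltn_ord j)) mulnDl addnC mulSn addnCA addnA.
rewrite e big_words_cat.
transitivity (\sum_(u <- words (j * n)) \sum_(v <- words n)
   \sum_(u' <- words ((B - j.+1) * n)) qweight q (u ++ v ++ u') * F v).
  rewrite !big_seq; apply: eq_bigr => u /size_words su.
  rewrite big_words_cat !big_seq; apply: eq_bigr => v /size_words sv.
  apply: eq_bigr => u' _.
  by rewrite drop_size_cat// take_size_cat.
rewrite exchange_big/=; apply: eq_bigr => v _; rewrite /marginal mulr_suml.
by apply: eq_bigr => u _; rewrite mulr_suml.
Qed.

(** Chernoff bound: [tau * y <= expR (tau * y)] turns the positive part into a sum at the parameter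
    [q + tau]. *)
Lemma positive_part_le q n b tau : 0 < tau ->
  \sum_(w <- words n) qweight q w * Num.max (ln (N w) - n%:R * b) 0 <=
  tau^-1 * (qsum (q + tau) n * expR (- (tau * (n%:R * b)))).
Proof.
move=> t0; rewrite /qsum mulr_suml mulr_sumr; apply: ler_sum => w _.
rewrite /qweight; case: ifPn => _; last by rewrite !mul0r mulr0.
rewrite -expRD.
have -> : (q + tau) * ln (N w) - tau * (n%:R * b) =
  q * ln (N w) + tau * (ln (N w) - n%:R * b) by ring.
rewrite expRD mulrCA ler_wpM2l ?expR_ge0//.
rewrite ge_max mulr_ge0 ?invr_ge0 ?expR_ge0 ?(ltW t0)// andbT ler_pdivlMl//.
by apply: le_trans (expR_ge1Dx _); rewrite lerDr.
Qed.

(** Chernoff bound in reverse: with [y = n b - ln N] positive, [expR (tau * y) - 1 <= tau * y * expR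
    (tau * y)], and [y <= n D'] bounds the last exponential. *)
Lemma negative_part_ge q n b tau D' : 0 <= tau -> `|b| + D <= D' ->
  expR (tau * (n%:R * b)) * qsum (q - tau) n <=
  qsum q n + tau * expR (tau * (n%:R * D')) *
    \sum_(w <- words n) qweight q w * Num.max (n%:R * b - ln (N w)) 0.
Proof.
move=> t0 hD; rewrite /qsum !mulr_sumr -big_split/= !big_seq.
apply: ler_sum => w /size_words sw.
rewrite /qweight; case: ifPn => [Lw|_]; last by rewrite !(mul0r, mulr0) addr0.
rewrite -expRD.
have -> : tau * (n%:R * b) + (q - tau) * ln (N w) =
  q * ln (N w) + tau * (n%:R * b - ln (N w)) by ring.
rewrite expRD mulrCA -{2}(mulr1 (expR _)) -mulrDr ler_wpM2l ?expR_ge0//.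
set y := n%:R * b - ln (N w).
have yD : y <= n%:R * D'.
  have h1 := lnN_ge Lw; rewrite sw in h1.
  have h2 : n%:R * b <= n%:R * `|b| by rewrite ler_wpM2l// ler_norm.
  have h3 : n%:R * (`|b| + D) <= n%:R * D' by rewrite ler_wpM2l.
  by rewrite /y; lra.
have [y0|y0] := leP y 0.
  rewrite mulr0 addr0 -expR0 ler_expR; exact: mulr_ge0_le0.
have h1 : expR (tau * y) <= expR (tau * (n%:R * D')) by rewrite ler_expR ler_wpM2l.
have h2 := expR_ge1Dx (- (tau * y)).
have h3 : expR (tau * y) * (1 - tau * y) <= 1.
  apply: (@le_trans _ _ (expR (tau * y) * expR (- (tau * y)))).
    by rewrite ler_wpM2l ?expR_ge0.
  by rewrite -expRD subrr expR0.
have h4 : 0 <= tau * y by rewrite mulr_ge0// ltW.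
have h5 := ler_wpM2r h4 h1.
rewrite mulrBr mulr1 in h3.
have -> : tau * expR (tau * (n%:R * D')) * y = expR (tau * (n%:R * D')) * (tau * y) by ring.
lra.
Qed.

(** The positive part is controlled by [marginal_le], the negative part by [marginal_ge]; the factor
    [2 * marginal_const q] makes the latter win by [C]. *)
Lemma middle_block q i j n b C : 0 <= q -> (K <= i)%N -> (K <= j)%N -> 0 <= C ->
  \sum_(w <- words n) qweight q w * Num.max (ln (N w) - n%:R * b) 0 <= C * qsum q n ->
  2 * marginal_const q * C * qsum q n <=
    \sum_(w <- words n) qweight q w * Num.max (n%:R * b - ln (N w)) 0 ->
  \sum_(v <- words n) marginal q i j v * (ln (N v) - n%:R * b) <=
  - (C * qsum q (i + (n + j))).
Proof.
move=> q0 Ki Kj C0 hp hn; have M0 := marginal_const_gt0 q; set M := marginal_const q in M0 hn.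
set Sp := \sum_(w <- _) _ in hp; set Sn := \sum_(w <- _) _ in hn.
have Zi := qsum_gt0 q i; have Zj := qsum_gt0 q j; have Zn := qsum_gt0 q n.
have h : \sum_(v <- words n) marginal q i j v * (ln (N v) - n%:R * b) <=
    qsum q i * qsum q j * (Sp - M^-1 * Sn).
  set ZZ := qsum q i * qsum q j.
  rewrite mulrBr /Sp /Sn !mulr_sumr -sumrB; apply: ler_sum => v _.
  have e : ln (N v) - n%:R * b =
      Num.max (ln (N v) - n%:R * b) 0 - Num.max (n%:R * b - ln (N v)) 0.
    by rewrite !maxEle; case: ifPn; case: ifPn; rewrite -?ltNge; lra.
  rewrite [X in marginal _ _ _ _ * X]e mulrBr /ZZ; apply: lerB.
    have -> : qsum q i * qsum q j * (qweight q v * Num.max (ln (N v) - n%:R * b) 0) =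
      qweight q v * (qsum q i * qsum q j) * Num.max (ln (N v) - n%:R * b) 0 by ring.
    by rewrite ler_wpM2r ?marginal_le// le_max lexx orbT.
  have -> : qsum q i * qsum q j * (M^-1 * (qweight q v * Num.max (n%:R * b - ln (N v)) 0)) =
      M^-1 * (qweight q v * (qsum q i * qsum q j)) * Num.max (n%:R * b - ln (N v)) 0 by ring.
  rewrite ler_wpM2r//; first by rewrite le_max lexx orbT.
  by rewrite ler_pdivrMl// marginal_ge.
apply: (le_trans h).
have h2 : 2 * C * qsum q n <= M^-1 * Sn.
  by rewrite ler_pdivlMl//; apply: le_trans hn; rewrite le_eqVlt; apply/orP; left; apply/eqP; ring.
have h3 : Sp - M^-1 * Sn <= - (C * qsum q n) by lra.
apply: (@le_trans _ _ (qsum q i * qsum q j * - (C * qsum q n))).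
  by rewrite ler_wpM2l// mulr_ge0// ltW.
have -> : qsum q i * qsum q j * - (C * qsum q n) =
  - (C * (qsum q i * (qsum q n * qsum q j))) by ring.
rewrite lerN2 ler_wpM2l//; apply: (le_trans (qsum_cat _ _ q0)).
by rewrite ler_wpM2l ?(ltW Zi)// qsum_cat.
Qed.

(** The first and the last block may lack the room for a join, so they get only the trivial
    bound. *)
Lemma edge_block q i j n b : 0 <= q ->
  \sum_(v <- words n) marginal q i j v * (ln (N v) - n%:R * b) <=
  n%:R * (D + `|b|) * qsum q (i + (n + j)).
Proof.
move=> q0.
have -> : qsum q (i + (n + j)) = \sum_(v <- words n) marginal q i j v.
  rewrite /qsum big_words_cat; under eq_bigr do rewrite big_words_cat.
  by rewrite exchange_big.
rewrite mulr_sumr !big_seq; apply: ler_sum => v /size_words sv.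
rewrite mulrC.
case Lv : (L v).
  rewrite ler_wpM2r ?marginal_ge0//; have := lnN_le Lv; rewrite sv mulrDr.
  have : n%:R * - b <= n%:R * `|b| by rewrite ler_wpM2l// -normrN ler_norm.
  lra.
have -> : marginal q i j v = 0; last by rewrite !mulr0.
rewrite /marginal big1// => u _; rewrite big1// => u' _; rewrite /qweight.
case: ifPn => // h; have := qm_factl HS (qm_factr HS h).
by rewrite Lv.
Qed.

(** By submultiplicativity [ln N] is at most its sum over the blocks; each of the [B] middle blocks
    loses [C], at the price of the two edge blocks. *)
Lemma qmean_blocks q n B b C : 0 <= q -> (K <= n)%N -> 0 <= C ->
  \sum_(w <- words n) qweight q w * Num.max (ln (N w) - n%:R * b) 0 <= C * qsum q n ->
  2 * marginal_const q * C * qsum q n <=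
    \sum_(w <- words n) qweight q w * Num.max (n%:R * b - ln (N w)) 0 ->
  qmean q (B.+2 * n) <= (B.+2)%:R * (n%:R * b) +
    2 * (n%:R * (D + `|b|)) - B%:R * C.
Proof.
move=> q0 Kn C0 hp hn; rewrite /qmean ler_pdivrMr ?qsum_gt0//.
set Z := qsum q (B.+2 * n).
pose F v := ln (N v) - n%:R * b.
have h1 : \sum_(w <- words (B.+2 * n)) qweight q w * ln (N w) <=
    \sum_(w <- words (B.+2 * n)) qweight q w * ((B.+2)%:R * (n%:R * b)) +
    \sum_(j < B.+2) \sum_(w <- words (B.+2 * n)) qweight q w * F (take n (drop (j * n) w)).
  rewrite exchange_big -big_split/= !big_seq; apply: ler_sum => w /size_words sw.
  rewrite -mulr_sumr -mulrDr /qweight; case: ifPn => [Lw|_]; last by rewrite !mul0r.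
  rewrite ler_wpM2l ?expR_ge0//; apply: (le_trans (lnN_blocks Lw sw)).
  by rewrite /F sumrB sumr_const card_ord mulr_natl addrC subrK.
apply: (le_trans h1); rewrite -mulr_suml -/(qsum _ _) -/Z.
set S2 := \sum_(j < B.+2) _.
suff: S2 <= 2 * (n%:R * (D + `|b|)) * Z - B%:R * C * Z.
  by move: (B.+2%:R) => x; lra.
rewrite {h1}/S2.
have eZ (j : 'I_B.+2) : qsum q (j * n + (n + (B.+2 - j.+1) * n)) = Z.
  rewrite /Z; congr qsum.
  by rewrite -[in RHS](subnK (ltn_ord j)) mulnDl [RHS]addnC mulSn addnCA addnA.
under eq_bigr do rewrite block_sum.
rewrite big_ord_recl big_ord_recr/=.
have he (j : 'I_B.+2) : \sum_(v <- words n) marginal q (j * n) ((B.+2 - j.+1) * n) v * F v <=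
    n%:R * (D + `|b|) * Z.
  by rewrite -(eZ j); exact: edge_block.
have e0 := he ord0; have e1 := he (lift ord0 ord_max); rewrite /= in e0 e1.
have hm (j : 'I_B) : \sum_(v <- words n) marginal q (bump 0 j * n) ((B.+2 - (bump 0 j).+1) * n) v * F v <=
    - (C * Z).
  have := ltn_ord j; rewrite /bump/= add1n => jB.
  have jB2 : (j.+1 < B.+2)%N by lia.
  have := eZ (Ordinal jB2) => /= <-.
  apply: middle_block => //; first by rewrite (leq_trans Kn)// mulSn leq_addr.
  have -> : (B.+2 - j.+2 = (B - j.+1).+1)%N by lia.
  by rewrite (leq_trans Kn)// mulSn leq_addr.
have hs : \sum_(i < B) \sum_(v <- words n)
     marginal q (bump 0 i * n) ((B.+2 - (bump 0 i).+1) * n) v * F v <= - (B%:R * (C * Z)).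
  apply: (@le_trans _ _ (\sum_(i < B) - (C * Z))); first by apply: ler_sum => i _; exact: hm.
  by rewrite sumr_const card_ord mulr_natl mulNrn.
apply: (@le_trans _ _ (n%:R * (D + `|b|) * Z + (- (B%:R * (C * Z)) + n%:R * (D + `|b|) * Z))).
  by rewrite lerD// lerD.
by rewrite le_eqVlt; apply/orP; left; apply/eqP; ring.
Qed.

Lemma nat_above (x : R) : exists n : nat, x <= n%:R.
Proof.
exists (Num.bound `|x|); apply: (le_trans (ler_norm _)).
exact: ltW (archi_boundP (normr_ge0 _)).
Qed.

Lemma positive_part_small (q n0 b tau x e : R) n : n0 = n%:R -> 0 <= q -> 0 < tau ->
  qerr q <= e -> qerr (q + tau) <= e ->
  n0 * (qpressure (q + tau) - qpressure q) - tau * (n0 * b) <= x ->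
  \sum_(w <- words n) qweight q w * Num.max (ln (N w) - n0 * b) 0 <=
  tau^-1 * (qsum q n * expR (2 * e + x)).
Proof.
move=> -> q0 tp e1 e2 hx; apply: (le_trans (positive_part_le q n b tp)).
rewrite ler_wpM2l ?invr_ge0 ?(ltW tp)//.
have zu := @qsum_upper (q + tau) n ltac:(lra); have zl := @qsum_lower q n q0.
apply: (le_trans (ler_wpM2r (expR_ge0 _) zu)).
apply: (le_trans _ (ler_wpM2r (expR_ge0 _) zl)).
rewrite -!expRD ler_expR; lra.
Qed.

Lemma negative_part_large (q n0 b tau D' e : R) n : n0 = n%:R -> 0 <= q - tau -> 0 <= tau ->
  `|b| + D <= D' -> qerr q <= e -> qerr (q - tau) <= e ->
  1 + 2 * e <= n0 * (qpressure (q - tau) - qpressure q) + tau * (n0 * b) ->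
  qsum q n <= tau * expR (tau * (n0 * D')) *
    \sum_(w <- words n) qweight q w * Num.max (n0 * b - ln (N w)) 0.
Proof.
move=> -> q0 tp hD e1 e2 hx; have := negative_part_ge q n tp hD.
have zl := @qsum_lower (q - tau) n q0; have zu := @qsum_upper q n ltac:(lra).
have h2 : 2 * qsum q n <= expR (tau * (n%:R * b)) * qsum (q - tau) n.
  apply: (@le_trans _ _ (expR 1 * qsum q n)).
    rewrite ler_wpM2r ?(ltW (qsum_gt0 _ _))//.
    by have := expR_ge1Dx (1 : R); lra.
  apply: (le_trans (ler_wpM2l (expR_ge0 _) zu)).
  apply: (le_trans _ (ler_wpM2l (expR_ge0 _) zl)).
  rewrite -!expRD ler_expR; lra.
by move=> h; have := le_trans h2 h; rewrite mulr_natl mulr2n lerD2l.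
Qed.

Lemma eq_ler (x y : R) : x = y -> x <= y.
Proof. by move->. Qed.

(* Under the Gibbs distribution at [t + 1/n], a corner of the pressure at [t]
   makes [ln N - n b] negative of order [n] with a definite weight and positive
   of order [n] with a small one, while the mean over long words is at least
   [b] per letter. *)
Lemma qpressure_no_corner (t a b : R) : 0 < t -> a < b ->
  (forall s : R, 0 <= s <= t -> qpressure t - a * s <= qpressure (t - s)) ->
  (forall s : R, 0 <= s -> qpressure t + b * s <= qpressure (t + s)) ->
  (forall eta : R, 0 < eta -> exists2 s0 : R, 0 < s0 &
     forall s : R, 0 <= s <= s0 -> qpressure (t + s) <= qpressure t + (b + eta) * s) ->
  False.
Proof.
move=> t0 ab Hl Hr Hu.
have [e0 [e00 qe]] : exists e0, 0 <= e0 /\ forall x : R, x <= t + 1 -> qerr x <= e0.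
  exists (qerr (t + 1)); split; first by apply: qerr_ge0; lra.
  by move=> x; exact: qerr_le.
(* Tilting by [K1 / n] from [q = t + 1 / n] crosses the corner to [t - (K1 - 1) / n]. There the
   pressure exceeds the line of slope [b] by about [(K1 - 1) * (b - a) / n]; this choice beats the
   error [2 * e0] with a margin that also absorbs [eta]. *)
have [K1 [K10 K1e]] : exists K1 : R, 1 <= K1 /\ (K1 - 1) * (b - a) = 2 + 2 * e0.
  exists (1 + (2 + 2 * e0) / (b - a)); split; last by field; lra.
  by rewrite lerDl divr_ge0//; lra.
have [D' hD'] : exists D' : R, `|b| + D <= D' by exists (`|b| + D).
(* [kap] inverts the factor in front of the negative part in [negative_part_large] at the tilt
   [K1 / n], up to the factor [n]. *)
have [kap [kap0 ekap]] : exists kap : R, 0 < kap /\ kap * (K1 * expR (K1 * D')) = 1.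
  have h : 0 < K1 * expR (K1 * D') by rewrite mulr_gt0 ?expR_gt0//; lra.
  by exists (K1 * expR (K1 * D'))^-1; rewrite invr_gt0 h mulVf ?gt_eqF.
have [M [M0 hM]] : exists M : R, 0 < M /\ forall x : R, x <= t + 1 -> marginal_const x <= M.
  exists (marginal_const (t + 1)); rewrite marginal_const_gt0; split => // x.
  exact: marginal_const_le.
have [C [C0 eC]] : exists C : R, 0 < C /\ 2 * M * C = kap.
  exists (kap / (2 * M)); split; first by rewrite divr_gt0// mulr_gt0.
  by field; rewrite gt_eqF.
(* With the tilt [K2 / n] to the right and the slope precision [eta] below, the exponent in the
   positive part is at most [2 * e0 + 1]; dividing by the tilt leaves exactly [n * C]. *)
have [K2 [K20 eK2]] : exists K2 : R, 0 < K2 /\ expR (2 * e0 + 1) = C * K2.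
  exists (expR (2 * e0 + 1) / C); split; first by rewrite divr_gt0 ?expR_gt0.
  by rewrite mulrCA divff ?gt_eqF// mulr1.
have [eta [eta0 [eta1 eeta]]] : exists eta : R, 0 < eta /\ eta <= 1 /\ eta * (K2 + 1) = 1.
  have h : 0 < K2 + 1 by lra.
  exists (K2 + 1)^-1; rewrite invr_gt0 invf_le1// mulVf ?gt_eqF//.
  by repeat split; lra.
have [s0 s00 Hs0] := Hu _ eta0.
have [n [s [n0 [Kn [ns [sp [ns0 [n1 nt]]]]]]]] : exists (n : nat) (s : R),
    0 < n%:R :> R /\ (K <= n)%N /\ n%:R * s = 1 /\ 0 < s /\
    (1 + K2) * s <= s0 /\ (1 + K2) * s <= 1 /\ K1 * s <= t.
  have [n hn] := nat_above (K%:R + (1 + K2) / s0 + (1 + K2) + K1 / t + 1).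
  have p1 : 0 <= (1 + K2) / s0 by rewrite divr_ge0//; lra.
  have p2 : 0 <= K1 / t by rewrite divr_ge0//; lra.
  have p3 : 0 <= K%:R :> R by [].
  have n0 : 0 < n%:R :> R by lra.
  exists n, n%:R^-1; rewrite invr_gt0 n0 divff ?gt_eqF// !ler_pdivrMr//.
  split => //; split; first by rewrite -(ler_nat R); lra.
  repeat split => //.
  - by rewrite mulrC -ler_pdivrMr//; lra.
  - by lra.
  - by rewrite mulrC -ler_pdivrMr//; lra.
have [nR enR] : exists nR : R, nR = n%:R by exists n%:R.
rewrite -enR in n0 ns.
have K2s : 0 < K2 * s by rewrite mulr_gt0.
have sK1 : s <= K1 * s by rewrite ler_peMl// ltW.
have ess : (1 + K2) * s = s + K2 * s by rewrite mulrDl mul1r.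
rewrite ess in ns0 n1.
have sK2 : s <= s + K2 * s by rewrite lerDl ltW.
have K1s : 0 <= K1 * s := le_trans (ltW sp) sK1.
have [q eq] : exists q : R, q = t + s by exists (t + s).
have q0 : 0 <= q by rewrite eq addr_ge0 ?ltW.
have qt : q <= t + 1 by rewrite eq lerD2l (le_trans sK2).
have Pq1 : qpressure t + b * s <= qpressure q by rewrite eq; apply: Hr; exact: ltW.
have Pq2 : qpressure q <= qpressure t + (b + eta) * s.
  by rewrite eq; apply: Hs0; rewrite (ltW sp) (le_trans sK2).
have Pq3 : qpressure (q + K2 * s) <= qpressure t + (b + eta) * (s + K2 * s).
  by rewrite eq -addrA; apply: Hs0; rewrite (le_trans (ltW sp) sK2).
have Pq4 : qpressure t - a * (K1 * s - s) <= qpressure (q - K1 * s).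
  have -> : q - K1 * s = t - (K1 * s - s) by rewrite eq; ring.
  by apply: Hl; rewrite subr_ge0 sK1 (le_trans _ nt)// gerBl ltW.
have hp : \sum_(w <- words n) qweight q w * Num.max (ln (N w) - nR * b) 0 <=
    (nR * C) * qsum q n.
  have q1 := qe q qt; have q2 : qerr (q + K2 * s) <= e0.
    by apply: qe; rewrite eq -addrA lerD2l.
  apply: (le_trans (positive_part_small (x := 1) enR q0 K2s q1 q2 _)).
    apply: (@le_trans _ _ (nR * (qpressure t + (b + eta) * (s + K2 * s) -
       (qpressure t + b * s)) - K2 * s * (nR * b))).
      by rewrite lerD2r ler_wpM2l ?lerB// ltW.
    apply: eq_ler; transitivity ((nR * s) * (eta * (K2 + 1))); first by ring.
    by rewrite ns eeta mulr1.
  rewrite eK2; apply: eq_ler.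
  have -> : nR = s^-1 by rewrite -[LHS]mulr1 -(mulfV (x := s)) ?gt_eqF// mulrA ns mul1r.
  by field; rewrite !gt_eqF.
have hng : 2 * marginal_const q * (nR * C) * qsum q n <=
    \sum_(w <- words n) qweight q w * Num.max (nR * b - ln (N w)) 0.
  set Sn := \sum_(w <- _) _.
  have q1 := qe q qt; have q2 : qerr (q - K1 * s) <= e0.
    by apply: qe; rewrite (le_trans _ qt)// gerBl.
  have qK : 0 <= q - K1 * s by rewrite subr_ge0 eq (le_trans nt)// lerDl ltW.
  have h3 : qsum q n <= K1 * s * expR (K1 * s * (nR * D')) * Sn.
    apply: (negative_part_large enR qK K1s hD' q1 q2).
    apply: (@le_trans _ _ (nR * ((qpressure t - a * (K1 * s - s)) -
       (qpressure t + (b + eta) * s)) + K1 * s * (nR * b))); last first.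
      by rewrite lerD2r ler_wpM2l ?lerB// ltW.
    have -> : nR * (qpressure t - a * (K1 * s - s) - (qpressure t + (b + eta) * s)) +
      K1 * s * (nR * b) = (nR * s) * ((K1 - 1) * (b - a)) - (nR * s) * eta by ring.
    by rewrite ns K1e; lra.
  have e1 : K1 * s * (nR * D') = (nR * s) * (K1 * D') by ring.
  rewrite e1 ns mul1r in h3.
  have nk : 0 <= nR * kap by rewrite mulr_ge0// ltW.
  have h4 := ler_wpM2l nk h3.
  have e2 : nR * kap * (K1 * s * expR (K1 * D') * Sn) =
     (nR * s) * (kap * (K1 * expR (K1 * D'))) * Sn by ring.
  rewrite e2 ns ekap mulr1 mul1r in h4; apply: le_trans h4.
  rewrite ler_wpM2r ?(ltW (qsum_gt0 _ _))//.
  have -> : nR * kap = 2 * M * (nR * C) by rewrite -eC; ring.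
  by rewrite ler_wpM2r ?mulr_ge0 ?(ltW n0) ?(ltW C0)// ler_wpM2l// (hM _ qt).
(* Comparing the pressures at [q] and [t] forces the mean [mu] over words of [B.+2] blocks to
   satisfy [mu / n >= B.+2 * b - 2 * e0]; with this many blocks the losses [B * C] contradict it. *)
have [B hB] := nat_above ((2 * e0 + 2 * (D + `|b|) + 1) / C + 1).
have nC : 0 <= nR * C by rewrite mulr_ge0// ltW.
rewrite enR in hp hng nC.
have h1 := @qmean_blocks q n B b _ q0 Kn nC hp hng.
have h2 := @ln_qsum_support q t (B.+2 * n).
have h3 := @qpressureP q (B.+2 * n) q0; have h4 := @qpressureP t (B.+2 * n) (ltW t0).
have q1 := qe q qt.
have q2 : qerr t <= e0 by apply: qe; rewrite lerDl ler01.
move: h3 h4; rewrite !ler_norml => /andP[h3 _] /andP[_ h4].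
have [B2 eB2] : exists B2 : R, B2 = B.+2%:R by exists B.+2%:R.
rewrite natrM -eB2 -enR in h1 h2 h3 h4.
move: (qmean q (B.+2 * n)) h1 h2 => mu h1 h2.
move: (ln (qsum q (B.+2 * n))) h2 h3 => lq h2 h3.
move: (ln (qsum t (B.+2 * n))) h2 h4 => lt h2 h4.
have h5 := ler_wpM2l (ltW sp) h1.
have e1 : s * (B2 * (nR * b) + 2 * (nR * (D + `|b|)) - B%:R * (nR * C)) =
  (nR * s) * (B2 * b + 2 * (D + `|b|) - B%:R * C) by ring.
rewrite e1 ns mul1r in h5.
have e2 : (t - q) * mu = - (s * mu) by rewrite eq; ring.
rewrite e2 in h2.
have Bn : 0 <= B2 * nR by rewrite eB2 enR mulr_ge0.
have h6 := ler_wpM2l Bn Pq1.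
have e3 : B2 * nR * (qpressure t + b * s) = B2 * nR * qpressure t + B2 * b * (nR * s) by ring.
rewrite e3 ns mulr1 in h6.
have h7 : (2 * e0 + 2 * (D + `|b|) + 1) + C <= B%:R * C.
  by rewrite -ler_pdivrMr// mulrDl divff ?gt_eqF.
clear Hl Hr Hu Hs0 qe hM hp hng Pq1 Pq2 Pq3 Pq4 h1 ns0 n1 nt e1 e2 e3 eeta eta0 eta1 eK2 eC ekap K1e.
lra.
Qed.

(** * Words of prescribed growth *)

Definition near_words (alpha eps : R) (n : nat) : seq (seq T) :=
  [seq w <- words n | L w && (`|ln (N w) - n%:R * alpha| <= eps * n%:R)].

Lemma near_wordsP alpha eps n w : w \in near_words alpha eps n ->
  [/\ size w = n, L w & `|ln (N w) - n%:R * alpha| <= eps * n%:R].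
Proof. by rewrite mem_filter => /andP[/andP[? ?] /size_words]. Qed.

Lemma uniq_near_words alpha eps n : uniq (near_words alpha eps n).
Proof. by rewrite filter_uniq// uniq_words. Qed.

(** Words with larger [ln N] are charged to the sum at [t + s], those with smaller [ln N] to the sum
    at [t - s], and each remaining word weighs at most [expR (t * n * (alpha + eps))]. *)
Lemma qsum_split (t s alpha eps : R) n : 0 <= t -> 0 <= s ->
  qsum t n <= qsum (t + s) n * expR (- (s * (n%:R * (alpha + eps)))) +
   qsum (t - s) n * expR (s * (n%:R * (alpha - eps))) +
   (size (near_words alpha eps n))%:R * expR (t * (n%:R * (alpha + eps))).
Proof.
move=> t0 s0; rewrite /qsum !mulr_suml.
have -> : (size (near_words alpha eps n))%:R * expR (t * (n%:R * (alpha + eps))) =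
    \sum_(w <- words n) (if L w && (`|ln (N w) - n%:R * alpha| <= eps * n%:R)
      then expR (t * (n%:R * (alpha + eps))) else 0).
  by rewrite -big_mkcond -big_filter big_const_seq count_predT iter_addr addr0 mulr_natl.
rewrite -!big_split/=; apply: ler_sum => w _.
have E := expR_ge0.
rewrite /qweight; case: ifPn => [Lw|_] /=; last by rewrite !mul0r !addr0.
rewrite -!expRD.
set X := ln (N w).
have p1 := expR_ge0 ((t + s) * X + - (s * (n%:R * (alpha + eps)))).
have p2 := expR_ge0 ((t - s) * X + s * (n%:R * (alpha - eps))).
have p3 : 0 <= (if `|X - n%:R * alpha| <= eps * n%:R
   then expR (t * (n%:R * (alpha + eps))) else 0) by case: ifP.
have [h|h] := leP X (n%:R * (alpha + eps)); last first.
  apply: (@le_trans _ _ (expR ((t + s) * X + - (s * (n%:R * (alpha + eps)))))); last first.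
    by rewrite -addrA lerDl addr_ge0.
  rewrite ler_expR mulrDl -addrA lerDl -mulrBr mulr_ge0// subr_ge0; exact: ltW.
have [h'|h'] := leP (n%:R * (alpha - eps)) X; last first.
  apply: (@le_trans _ _ (expR ((t - s) * X + s * (n%:R * (alpha - eps))))); last first.
    by rewrite addrAC lerDr addr_ge0.
  rewrite ler_expR mulrBl -addrA lerDl -mulNr addrC mulNr -mulrBr mulr_ge0// subr_ge0; exact: ltW.
rewrite ifT; last by rewrite ler_norml; apply/andP; split; lra.
apply: (@le_trans _ _ (expR (t * (n%:R * (alpha + eps))))).
  by rewrite ler_expR ler_wpM2l.
by rewrite lerDr addr_ge0.
Qed.

Lemma count_near_words (t alpha : R) : 0 < t ->
  (forall eta : R, 0 < eta -> exists2 s0 : R, 0 < s0 <= t &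
     forall s : R, 0 <= s <= s0 -> qpressure (t + s) <= qpressure t + (alpha + eta) * s /\
       qpressure (t - s) <= qpressure t - (alpha - eta) * s) ->
  forall eps : R, 0 < eps -> exists n0, forall n, (n0 <= n)%N ->
    expR (n%:R * (qpressure t - t * alpha - eps)) <= (size (near_words alpha eps n))%:R.
Proof.
move=> t0 hd eps eps0.
(* A window of width [e1] costs [t * e1] in the exponent, here at most [eps / 2]; the other half of
   [eps] pays for the bounded error [e0 + 1]. *)
have [e1 [e10 e1e e1eps]] : exists e1 : R, [/\ 0 < e1, e1 * t <= eps / 2 & e1 <= eps].
  exists (eps / (2 * (t + 1))).
  have h : 0 < 2 * (t + 1) by lra.
  have h2 : eps / (2 * (t + 1)) * (2 * (t + 1)) = eps by rewrite divfK// gt_eqF.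
  have h3 : 0 < eps / (2 * (t + 1)) by rewrite divr_gt0.
  have h4 : 0 < eps / (2 * (t + 1)) * t by rewrite mulr_gt0.
  by split; lra.
(* Slope precision [e1 / 2] leaves each tail an exponent [- n * s * e1 / 2] relative to the sum at
   [t], up to bounded errors; for large [n] each tail is then at most a quarter of the total. *)
have [s /andP[s0 st] hs] := hd (e1 / 2) ltac:(lra).
have {hs} [hs1 hs2] := hs s ltac:(apply/andP; split; lra).
pose e0 := qerr (t + t).
have e00 : 0 <= e0 by apply: qerr_ge0; lra.
have qe x : x <= t + t -> qerr x <= e0 by exact: qerr_le.
have [n0 hn0] := nat_above ((2 * e0 + 2) / (s * (e1 / 2)) + (e0 + 1) / (eps / 2)).
exists n0 => n n0n.
have sp : 0 < s * (e1 / 2) by rewrite mulr_gt0//; lra.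
have ep2 : 0 < eps / 2 by lra.
have nn : (2 * e0 + 2) / (s * (e1 / 2)) + (e0 + 1) / (eps / 2) <= n%:R.
  by apply: (le_trans hn0); rewrite ler_nat.
have r1 : 0 <= (2 * e0 + 2) / (s * (e1 / 2)) by rewrite divr_ge0 ?(ltW sp)//; lra.
have r2 : 0 <= (e0 + 1) / (eps / 2) by rewrite divr_ge0 ?(ltW ep2)//; lra.
have n1 : 2 * e0 + 2 <= n%:R * (s * (e1 / 2)) by rewrite -ler_pdivrMr//; lra.
have n2 : e0 + 1 <= n%:R * (eps / 2) by rewrite -ler_pdivrMr//; lra.
have := qsum_split alpha e1 n (ltW t0) (ltW s0).
set G := (size _)%:R.
have GG : G <= (size (near_words alpha eps n))%:R.
  rewrite ler_nat !size_filter; apply: sub_count => w /andP[-> /= h].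
  by apply: (le_trans h); rewrite ler_wpM2r.
set A := _ * expR (- _); set B := _ * expR (s * _) => hsplit.
have zl := @qsum_lower t n (ltW t0); have qt := qe t ltac:(lra).
set Z := expR (n%:R * qpressure t - e0).
have Zp : 0 < Z by exact: expR_gt0.
have hZ : Z <= qsum t n by apply: le_trans zl; rewrite ler_expR; lra.
have quarter := expRN2_le R.
have ns := ler0n R n.
have hA : 4 * A <= Z.
  have zu := @qsum_upper (t + s) n (addr_ge0 (ltW t0) (ltW s0)).
  have qs : qerr (t + s) <= e0 by apply: qe; rewrite lerD2l.
  apply: (@le_trans _ _ (4 * expR (-2) * Z)); last by rewrite ler_piMl// ltW.
  rewrite -mulrA ler_wpM2l// /A; apply: (le_trans (ler_wpM2r (expR_ge0 _) zu)).
  rewrite -!expRD ler_expR.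
  have h := ler_wpM2l ns hs1; lra.
have hB : 4 * B <= Z.
  have ts : 0 <= t - s by rewrite subr_ge0.
  have zu := @qsum_upper (t - s) n ts.
  have qs : qerr (t - s) <= e0.
    by apply: qe; rewrite (@le_trans _ _ t)// ?gerBl ?lerDl ltW.
  apply: (@le_trans _ _ (4 * expR (-2) * Z)); last by rewrite ler_piMl// ltW.
  rewrite -mulrA ler_wpM2l// /B; apply: (le_trans (ler_wpM2r (expR_ge0 _) zu)).
  rewrite -!expRD ler_expR.
  have h := ler_wpM2l ns hs2; lra.
have hG : Z <= 2 * (G * expR (t * (n%:R * (alpha + e1)))) by lra.
apply: le_trans GG.
have half := expRN1_le R.
have hG2 : Z * expR (- 1) <= G * expR (t * (n%:R * (alpha + e1))).
  have h1 := ler_wpM2r (expR_ge0 (- 1)) hG.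
  have h2 : 0 <= G * expR (t * (n%:R * (alpha + e1))) by rewrite mulr_ge0 ?expR_ge0.
  have h3 := ler_wpM2l h2 half; lra.
have hG3 := ler_wpM2r (expR_ge0 (- (t * (n%:R * (alpha + e1))))) hG2.
rewrite -[X in _ <= X]mulrA -[in X in _ <= X]expRD subrr expR0 mulr1 in hG3.
apply: le_trans hG3; rewrite /Z -!expRD ler_expR.
have h := ler_wpM2l ns e1e; lra.
Qed.

(** * Maximal words and maximal growth *)

Lemma max_in_seq (s : seq (seq T)) w0 : w0 \in s -> L w0 ->
  exists w, [/\ w \in s, L w & forall v, v \in s -> L v -> N v <= N w].
Proof.
elim: s w0 => // v s IH w0; rewrite inE => w0s Lw0.
have [[w1 w1s Lw1]|ne] := pselect (exists2 w, w \in s & L w).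
  have [w [ws Lw hw]] := IH w1 w1s Lw1.
  have [Lv|nLv] := boolP (L v); last first.
    exists w; rewrite inE ws orbT; split => // u; rewrite inE => /predU1P[->|/hw//].
    by rewrite (negbTE nLv).
  have [h|h] := leP (N v) (N w).
    by exists w; rewrite inE ws orbT; split => // u; rewrite inE => /predU1P[->|/hw//].
  exists v; rewrite inE eqxx; split => // u; rewrite inE => /predU1P[->//|us Lu].
  by apply: (le_trans (hw u us Lu)); exact: ltW.
have w0v : w0 = v by move: w0s => /predU1P[//|w0s]; case: ne; exists w0.
have Lv : L v by rewrite -w0v.
exists v; rewrite inE eqxx; split => // u; rewrite inE => /predU1P[->//|us Lu].
by case: ne; exists u.
Qed.

Definition is_max_word (w : seq T) : Prop :=
  L w /\ forall v, size v = size w -> L v -> N v <= N w.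

Lemma max_word_exists n : exists2 w, size w = n & is_max_word w.
Proof.
have [w0 sw0 Lw0] := word_exists n.
have w0n : w0 \in words n by rewrite mem_words sw0.
have [w [/size_words sw Lw hw]] := max_in_seq w0n Lw0.
exists w => //; split => // v; rewrite sw => sv; apply: hw.
by rewrite mem_words sv.
Qed.

Definition max_word n : seq T := xget [::] [set w | size w = n /\ is_max_word w].

Lemma max_wordP n : size (max_word n) = n /\ is_max_word (max_word n).
Proof.
have [w sw hw] := max_word_exists n.
by apply: (@xgetPex _ [::] [set w | size w = n /\ is_max_word w]); exists w.
Qed.

Lemma size_max_word n : size (max_word n) = n.
Proof. by have [] := max_wordP n. Qed.

Lemma L_max_word n : L (max_word n).
Proof. by have [_ []] := max_wordP n. Qed.

Lemma N_le_max_word v : L v -> ln (N v) <= ln (N (max_word (size v))).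
Proof.
move=> Lv; rewrite ler_ln ?posrE ?(qm_gt0 HS)// ?L_max_word//.
by have [s [_ h]] := max_wordP (size v); apply: h.
Qed.

(** Upper bound: both parts of a maximal word are words. Lower bound: join two maximal words and cut
    off the last [K] letters. *)
Lemma ln_max_word_additive n m :
  `|ln (N (max_word (n + m))) - ln (N (max_word n)) - ln (N (max_word m))| <=
  2 * (D * K%:R) + `|ln c|.
Proof.
have DK : 0 <= D * K%:R by rewrite mulr_ge0// (qm_D HS).
rewrite ler_norml; apply/andP; split; last first.
  set w := max_word (n + m).
  have Lw : L (take n w ++ drop n w) by rewrite cat_take_drop; exact: L_max_word.
  have := lnN_cat Lw; rewrite cat_take_drop.
  have := N_le_max_word (qm_factl HS Lw); have := N_le_max_word (qm_factr HS Lw).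
  rewrite size_takel ?size_drop size_max_word ?leq_addr// addKn.
  by have := normr_ge0 (ln c); lra.
have [s [r [sK srK Lw hw]]] := join_right (L_max_word n) (L_max_word m).
set w := _ ++ _ in Lw hw.
have sw : size w = (n + m + K)%N by rewrite /w !size_cat !size_max_word; lia.
have Lw' : L (take (n + m) w ++ drop (n + m) w) by rewrite cat_take_drop.
have := lnN_cat Lw'; rewrite cat_take_drop.
have := N_le_max_word (qm_factl HS Lw'); have := lnN_le (qm_factr HS Lw').
rewrite size_takel ?size_drop sw ?leq_addr// addKn.
have := ler_norm (- ln c); rewrite normrN.
move: hw; rewrite /g; lra.
Qed.

(** The maximal exponent of the weight. By the two bounds below, [qpressure q - q * growth] stays
    between [0] and [ln #|T|], so this is the slope of the pressure at infinity. *)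
Definition growth : R := xget 0 [set l | forall n,
  `|ln (N (max_word n)) - n%:R * l| <= 2 * (2 * (D * K%:R) + `|ln c|)].

Lemma growthP n : `|ln (N (max_word n)) - n%:R * growth| <= 2 * (2 * (D * K%:R) + `|ln c|).
Proof.
have [l hl] := almost_additive ln_max_word_additive.
by rewrite /growth; case: xgetP => [_ _ //|/(_ l) []].
Qed.

Lemma growth_le_qpressure (q : R) : 0 <= q -> q * growth <= qpressure q.
Proof.
move=> q0; apply: (@le_of_natmul _ _ _ (q * (2 * (2 * (D * K%:R) + `|ln c|)) + qerr q)) => n.
have h1 := growthP n; have h2 := qpressureP n q0.
have h3 : expR (q * ln (N (max_word n))) <= qsum q n.
  have := @le_big_seq _ (words n) (qweight q) (max_word n).
  rewrite /qweight L_max_word; apply; last by move=> j; exact: qweight_ge0.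
  by rewrite mem_words size_max_word.
rewrite -[leRHS](lnK (qsum_gt0 q n)) ler_expR in h3.
move: h1 h2; rewrite !ler_norml => /andP[h1 _] /andP[_ h2].
have := ler_wpM2l q0 h1; lra.
Qed.

Lemma qpressure_le_growth (q : R) : 0 <= q ->
  qpressure q <= q * growth + ln #|T|%:R.
Proof.
move=> q0; apply: (@le_of_natmul _ _ _ (q * (2 * (2 * (D * K%:R) + `|ln c|)) + qerr q)) => n.
have h1 := growthP n; have h2 := qpressureP n q0.
have T0 : 0 < #|T|%:R :> R by rewrite ltr0n card_alphabet_gt0.
have h3 : qsum q n <= #|T|%:R ^+ n * expR (q * ln (N (max_word n))).
  have -> : #|T|%:R ^+ n * expR (q * ln (N (max_word n))) =
      \sum_(w <- @words T n) expR (q * ln (N (max_word n))).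
    by rewrite big_const_seq count_predT card_words iter_addr addr0 -natrX mulr_natl.
  rewrite /qsum !big_seq; apply: ler_sum => w /size_words sw.
  rewrite /qweight; case: ifPn => [Lw|_]; last exact: expR_ge0.
  by rewrite ler_expR ler_wpM2l//; have := N_le_max_word Lw; rewrite sw.
rewrite -ler_ln ?posrE ?qsum_gt0 ?mulr_gt0 ?expR_gt0 ?exprn_gt0// in h3.
rewrite lnM ?posrE ?expR_gt0 ?exprn_gt0// expRK lnXn// in h3.
move: h1 h2; rewrite !ler_norml => /andP[_ h1] /andP[h2 _].
rewrite -[_ *+ n]mulr_natl in h3.
have := ler_wpM2l q0 h1; lra.
Qed.

End QmSystem.

(** * Slopes of convex functions *)

Section ConvexSlopes.
Context {R : realType}.
Implicit Types (P f : R -> R) (t d : R).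

(** Upper bounds only: together with the lower bounds in [support_at] they say that [d] is the
    derivative at [t]. *)
Definition slope_at P t d : Prop :=
  forall eta : R, 0 < eta -> exists2 s0 : R, 0 < s0 <= t &
    forall s : R, 0 <= s <= s0 -> P (t + s) <= P t + (d + eta) * s /\
      P (t - s) <= P t - (d - eta) * s.

Definition support_at P t d : Prop :=
  forall q, 0 <= q -> P t + d * (q - t) <= P q.

Lemma derive1_slope f P t d : 0 < t -> (forall q, 0 < q -> f q = P q) ->
  slope_at P t d -> support_at P t d -> derive1 f t = d.
Proof.
move=> t0 fP hs hsup; rewrite /derive1; apply/cvg_lim => //.
apply/cvgrPdist_le => eta eta0.
have [s0 /andP[s00 s0t] hs0] := hs _ eta0.
near=> h.
have h0 : h != 0 by near: h; exact: nbhs_dnbhs_neq.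
have hh : `|h| < s0.
  by near: h; exact: dnbhs0_lt.
have htp : 0 < h + t by move: hh; rewrite ltr_norml => /andP[]; lra.
rewrite !fP//.
have -> : d - h^-1 *: (P (h + t) - P t) = h^-1 * (d * h - (P (h + t) - P t)).
  by rewrite mulrBr mulrCA mulVf// mulr1.
rewrite normrM normfV ler_pdivrMl ?normr_gt0//.
have := hsup (h + t) (ltW htp); rewrite addrK => h1.
have [hp|hn] := leP 0 h.
  have [h2 _] := hs0 h ltac:(move: hh; rewrite ger0_norm//; lra).
  rewrite addrC in h2; rewrite (ger0_norm hp) ler_norml; apply/andP; split; lra.
have hn' := ltW hn.
have [_ h2] := hs0 (- h) ltac:(move: hh; rewrite ler0_norm//; lra).
rewrite opprK addrC in h2; rewrite (ler0_norm hn') ler_norml; apply/andP; split; lra.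
Unshelve. all: by end_near. Qed.

(** The supremum [a] of the left slopes and the infimum [b] of the right slopes are the one-sided
    derivatives; the last hypothesis excludes [a < b]. *)
Lemma convex_slope P t (D : R) : 0 < t ->
  (forall x y z : R, 0 <= x -> x <= y -> y <= z ->
    (z - x) * P y <= (z - y) * P x + (y - x) * P z) ->
  (forall x y : R, 0 <= x -> 0 <= y -> `|P x - P y| <= D * `|x - y|) ->
  (forall a b : R, a < b ->
    (forall s : R, 0 <= s <= t -> P t - a * s <= P (t - s)) ->
    (forall s : R, 0 <= s -> P t + b * s <= P (t + s)) ->
    (forall eta : R, 0 < eta -> exists2 s0 : R, 0 < s0 &
      forall s : R, 0 <= s <= s0 -> P (t + s) <= P t + (b + eta) * s) -> False) ->
  exists d, slope_at P t d /\ support_at P t d.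
Proof.
move=> t0 cvx lip nc.
pose RS := [set x : R | exists2 s : R, 0 < s & x = (P (t + s) - P t) / s].
pose LS := [set x : R | exists2 s : R, 0 < s <= t & x = (P t - P (t - s)) / s].
have RS0 : RS !=set0 by exists ((P (t + 1) - P t) / 1), 1.
have LS0 : LS !=set0 by exists ((P t - P (t - t)) / t), t => //; rewrite t0 lexx.
have LR x y : LS x -> RS y -> x <= y.
  move=> [s /andP[s0 st] ->] [s' s'0 ->].
  rewrite ler_pdivrMr// mulrAC ler_pdivlMr//.
  have := cvx (t - s) t (t + s') ltac:(lra) ltac:(lra) ltac:(lra); lra.
have hL : has_sup LS.
  by split => //; have [y Ry] := RS0; exists y => x Lx; exact: LR.
have hR : has_inf RS.
  by split => //; have [x Lx] := LS0; exists x => y Ry; exact: LR.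
pose a := sup LS; pose b := inf RS.
have ab : a <= b.
  apply: ge_sup => // x Lx; apply: lb_le_inf => // y Ry; exact: LR.
have Ha s : 0 <= s <= t -> P t - a * s <= P (t - s).
  move=> /andP[]; rewrite le_eqVlt => /predU1P[<- _|s0 st].
    by rewrite mulr0 !subr0.
  have : (P t - P (t - s)) / s <= a.
    by apply: ub_le_sup; [exact: (proj2 hL)|exists s => //; rewrite s0].
  rewrite ler_pdivrMr//; lra.
have Hb s : 0 <= s -> P t + b * s <= P (t + s).
  rewrite le_eqVlt => /predU1P[<-|s0]; first by rewrite mulr0 !addr0.
  have : b <= (P (t + s) - P t) / s.
    by apply: ge_inf; [exact: (proj2 hR)|exists s].
  rewrite ler_pdivlMr//; lra.
have Hbu (eta : R) : 0 < eta -> exists2 s0 : R, 0 < s0 &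
      forall s : R, 0 <= s <= s0 -> P (t + s) <= P t + (b + eta) * s.
  move=> eta0; have [_ [s0 s00 ->] hlt] := inf_adherent eta0 hR.
  exists s0 => // s /andP[s0' ss].
  rewrite -/b ltr_pdivrMr// in hlt.
  have := cvx t (t + s) (t + s0) ltac:(lra) ltac:(lra) ltac:(lra).
  have -> : t + s0 - t = s0 by ring.
  have -> : t + s0 - (t + s) = s0 - s by ring.
  have -> : t + s - t = s by ring.
  move=> h; have h1 := ler_wpM2l s0' (ltW hlt).
  rewrite -(ler_pM2l s00); lra.
have Hau (eta : R) : 0 < eta -> exists2 s0 : R, 0 < s0 <= t &
      forall s : R, 0 <= s <= s0 -> P (t - s) <= P t - (a - eta) * s.
  move=> eta0; have [_ [s0 /andP[s00 s0t] ->] hlt] := sup_adherent eta0 hL.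
  exists s0; first by rewrite s00.
  move=> s /andP[s0' ss].
  rewrite -/a ltr_pdivlMr// in hlt.
  have := cvx (t - s0) (t - s) t ltac:(lra) ltac:(lra) ltac:(lra).
  have -> : t - (t - s0) = s0 by ring.
  have -> : t - (t - s) = s by ring.
  have -> : t - s - (t - s0) = s0 - s by ring.
  move=> h; have h1 := ler_wpM2l s0' (ltW hlt).
  rewrite -(ler_pM2l s00); lra.
have ea : a = b.
  apply/eqP; rewrite eq_le ab /= leNgt; apply/negP => h.
  exact: (nc a b h Ha Hb Hbu).
exists b; split.
  move=> eta eta0; have [s1 s10 h1] := Hbu _ eta0.
  have [s2 /andP[s20 s2t] h2] := Hau _ eta0.
  exists (Num.min s1 s2); first by rewrite lt_min s10 s20 ge_min s2t orbT.
  move=> s /andP[s0]; rewrite le_min => /andP[ss1 ss2]; split.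
    by apply: h1; rewrite s0.
  by rewrite -ea; apply: h2; rewrite s0.
move=> q q0; have [tq|qt] := leP t q.
  by have := Hb (q - t) ltac:(lra); rewrite (_ : t + (q - t) = q)//; ring.
have := Ha (t - q) ltac:(apply/andP; split; lra).
rewrite (_ : t - (t - q) = q); last by ring.
rewrite ea; lra.
Qed.

Lemma support_between Q t d tl dl (s s' eta : R) : 0 < tl -> 0 < s -> s' < t ->
  support_at Q tl dl -> tl < t + s -> t - s' < tl ->
  (Q (t + s) - Q tl) / (t + s - tl) < d + eta ->
  d - eta < (Q tl - Q (t - s')) / (tl - (t - s')) -> 0 < t -> `|d - dl| <= eta.
Proof.
move=> tl0 s0 s't sup z1 z2 w1 w2 t0.
have y1 := sup (t + s) ltac:(lra); have y2 := sup (t - s') ltac:(lra).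
rewrite ltr_pdivrMr in w1; last by lra.
rewrite ltr_pdivlMr in w2; last by lra.
have d1 : dl * (t + s - tl) < (d + eta) * (t + s - tl) by lra.
have d2 : (d - eta) * (tl - (t - s')) < dl * (tl - (t - s')) by lra.
rewrite ltr_pM2r in d1; last by lra.
rewrite ltr_pM2r in d2; last by lra.
by rewrite ler_norml; apply/andP; split; lra.
Qed.

(** A supporting slope at a point lies between difference quotients on its two sides, and these
    converge with the functions; so pointwise convergence traps the slopes. *)
Lemma support_limit (P_ : nat -> R -> R) P (t_ d_ : nat -> R) t d (D : R) :
  0 < t -> t_ l @[l --> \oo] --> t ->
  (forall q, 0 < q -> P_ l q @[l --> \oo] --> P q) ->
  (\forall l \near \oo, 0 < t_ l /\ support_at (P_ l) (t_ l) (d_ l) /\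
     forall x y : R, 0 <= x -> 0 <= y -> `|P_ l x - P_ l y| <= D * `|x - y|) ->
  slope_at P t d ->
  P_ l (t_ l) - t_ l * d_ l @[l --> \oo] --> P t - t * d.
Proof.
move=> t0 tt PP hl hs.
have nt : `|t_ l - t| @[l --> \oo] --> 0.
  by rewrite -(normr0 R) -(subrr t); apply: cvg_norm; apply: cvgB => //; exact: cvg_cst.
(* The common Lipschitz constant allows the replacement of [t_ l] by [t]. *)
have cP : P_ l (t_ l) @[l --> \oo] --> P t.
  have -> : P t = P t + D * 0 by rewrite mulr0 addr0.
  have h1 : P_ l t + D * `|t_ l - t| @[l --> \oo] --> P t + D * 0.
    apply: cvgD; first exact: PP.
    by apply: cvgM => //; exact: cvg_cst.
  have h2 : P_ l t - D * `|t_ l - t| @[l --> \oo] --> P t + D * 0.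
    have -> : P t + D * 0 = P t - D * 0 by rewrite mulr0 oppr0.
    apply: cvgB; first exact: PP.
    by apply: cvgM => //; exact: cvg_cst.
  apply: (squeeze_cvgr _ h2 h1).
  near=> l.
  have [tl [_ lip]] : 0 < t_ l /\ support_at (P_ l) (t_ l) (d_ l) /\
     forall x y : R, 0 <= x -> 0 <= y -> `|P_ l x - P_ l y| <= D * `|x - y| by near: l.
  have := lip (t_ l) t (ltW tl) (ltW t0).
  by rewrite ler_norml => /andP[]; lra.
apply: cvgB => //; apply: cvgM => //.
apply/cvgrPdist_le => eta eta0.
have e2 : 0 < eta / 2 by lra.
have [s /andP[s0 st] /(_ s)] := hs _ e2.
have -> : (0 <= s <= s) by rewrite lexx ltW.
move=> /(_ isT)[hs1 hs2].
(* Halving [s1] keeps [t - s'] positive, where pointwise convergence is available. *)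
have [s' s'0 s't] : exists2 s' : R, 0 < s' & s' < t /\ P (t - s') <= P t - (d - eta / 2) * s'.
  have [s1 /andP[s10 s1t] h] := hs _ e2.
  exists (s1 / 2); first by lra.
  split; first by lra.
  by have [] := h (s1 / 2) ltac:(apply/andP; split; lra).
case: s't => s't hs2'.
have u1 : (P_ l (t + s) - P_ l (t_ l)) / (t + s - t_ l) @[l --> \oo] --> (P (t + s) - P t) / (t + s - t).
  apply: cvgM; first by apply: cvgB => //; apply: PP; lra.
  apply: cvgV; first by rewrite addrAC subrr add0r gt_eqF.
  by apply: cvgB => //; exact: cvg_cst.
have u2 : (P_ l (t_ l) - P_ l (t - s')) / (t_ l - (t - s')) @[l --> \oo] -->
    (P t - P (t - s')) / (t - (t - s')).
  apply: cvgM; first by apply: cvgB => //; apply: PP; lra.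
  apply: cvgV; first by rewrite opprB addrC subrK gt_eqF.
  by apply: cvgB => //; exact: cvg_cst.
have v1 : (P (t + s) - P t) / (t + s - t) < d + eta.
  rewrite (_ : t + s - t = s); last by ring.
  rewrite ltr_pdivrMr//; have := mulr_gt0 s0 eta0; lra.
have v2 : d - eta < (P t - P (t - s')) / (t - (t - s')).
  rewrite (_ : t - (t - s') = s'); last by ring.
  rewrite ltr_pdivlMr//; have := mulr_gt0 s'0 eta0; lra.
near=> l.
have [tl [sup _]] : 0 < t_ l /\ support_at (P_ l) (t_ l) (d_ l) /\
   forall x y : R, 0 <= x -> 0 <= y -> `|P_ l x - P_ l y| <= D * `|x - y| by near: l.
apply: (support_between tl s0 s't sup _ _ _ _ t0).
- by near: l; apply: (cvgr_lt _ tt); rewrite ltrDl.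
- by near: l; apply: (cvgr_gt _ tt); rewrite ltrBlDr ltrDl.
- by near: l; exact: (cvgr_lt _ u1).
- by near: l; exact: (cvgr_gt _ u2).
Unshelve. all: by end_near. Qed.

(** * Asymptote of a convex function *)

Section Asymptote.
Variables (P d : R -> R) (beta C : R).
Hypothesis hsup : forall t : R, 0 < t -> support_at P t (d t).
Hypothesis hlow : forall q : R, 0 <= q -> q * beta <= P q.
Hypothesis hupp : forall q : R, 0 <= q -> P q <= q * beta + C.

(** Height at [0] of the asymptote of slope [beta]; it will be the entropy of the level set at
    [beta]. *)
Definition asymptote_gap : R := inf [set P q - q * beta | q in [set q : R | 0 < q]].

Lemma asymptote_has_inf : has_inf [set P q - q * beta | q in [set q : R | 0 < q]].
Proof.
split; first by exists (P 1 - 1 * beta), 1 => //=; exact: ltr01.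
by exists 0 => _ [q /= q0 <-]; rewrite subr_ge0 hlow// ltW.
Qed.

Lemma asymptote_gap_le q : 0 < q -> asymptote_gap <= P q - q * beta.
Proof.
by move=> q0; apply: ge_inf; [exact: (proj2 asymptote_has_inf)|exists q].
Qed.

Lemma support_le_asymptote t : 0 < t -> d t <= beta.
Proof.
move=> t0; apply: (@le_of_natmul _ _ _ (C + d t * t - P t)) => n.
have := hsup t0 (ler0n R n); have := hupp (ler0n R n); lra.
Qed.

Lemma asymptote_gap_le_support t : 0 < t -> asymptote_gap <= P t - t * d t.
Proof.
move=> t0; apply: (le_trans (asymptote_gap_le t0)).
by rewrite lerB// ler_wpM2l ?(ltW t0)// support_le_asymptote.
Qed.

(** The left side is the value at [0] of the supporting line at [t], and that line lies below [P] at
    [t / 2]. *)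
Lemma support_gap_le t : 0 < t ->
  P t - t * d t <= 2 * (P (t / 2) - t / 2 * beta) - (P t - t * beta).
Proof.
move=> t0; have := hsup t0 (q := t / 2) ltac:(lra); lra.
Qed.

Lemma asymptote_gap_noninc q q' : 0 < q -> q <= q' ->
  P q' - q' * beta <= P q - q * beta.
Proof.
move=> q0 qq; have := hsup (t := q') ltac:(lra) (ltW q0).
have q'0 : 0 < q' by lra.
have h : d q' * (q' - q) <= beta * (q' - q).
  by rewrite ler_wpM2r ?support_le_asymptote//; lra.
lra.
Qed.

Lemma support_gap_cvg : P t - t * d t @[t --> +oo] --> asymptote_gap.
Proof.
apply/cvgrPdist_le => eps eps0.
have e2 : 0 < eps / 2 by lra.
have [_ [q0 /= q00 <-] hq0] := inf_adherent e2 asymptote_has_inf.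
near=> t.
have t2 : 2 * q0 <= t by near: t; apply: nbhs_pinfty_ge; exact: num_real.
have t0 : 0 < t by lra.
have h1 := support_gap_le t0.
have h2 := asymptote_gap_le t0; have h3 := asymptote_gap_le_support t0.
have h4 := @asymptote_gap_noninc q0 (t / 2) q00 ltac:(lra).
rewrite -/asymptote_gap in hq0.
by rewrite distrC ger0_norm; lra.
Unshelve. all: by end_near. Qed.

Lemma support_near_asymptote (eps : R) : 0 < eps -> 0 <= C ->
  exists2 t, 0 < t & beta - eps <= d t.
Proof.
move=> eps0 C0; have h0 : 0 <= 2 * C / eps by rewrite divr_ge0// ?mulr_ge0// ltW.
(* Since [t * (beta - d t) <= 2 * C] for all [t > 0], this [t] is large enough. *)
exists (2 * C / eps + 1); first by lra.
set t := _ + 1; have t0 : 0 < t by rewrite /t; lra.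
have h1 := support_gap_le t0; have h2 := hlow (ltW t0).
have h3 := hupp (q := t / 2) ltac:(lra).
have e : 2 * C / eps * eps = 2 * C by rewrite divfK// gt_eqF.
have h4 : 2 * C <= eps * t by rewrite /t; lra.
have h5 : t * (beta - eps) <= t * d t by lra.
by rewrite ler_pM2l in h5.
Qed.

End Asymptote.
End ConvexSlopes.

(** * Subshifts *)

Section Symbolic.
Context {a : nat} {Q : 'M[bool]_a}.
Local Notation Sigma := (subshift Q).
Implicit Types x y z : Sigma.

Lemma subshift_ext x y : (forall i, x i = y i) -> x = y.
Proof.
case: x => f hf; case: y => g hg /= fg.
have e : f = g by apply/funext => i; exact: fg.
by subst g; congr Subshift; exact: Prop_irrelevance.
Qed.

Lemma shiftzD (m n : int) x : shiftz m (shiftz n x) = shiftz (m + n) x.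
Proof. by apply: subshift_ext => i /=; rewrite addrA. Qed.

Lemma shiftz0 x : shiftz 0 x = x.
Proof. by apply: subshift_ext => i /=; rewrite addr0. Qed.

(** Markov property: a past and a future fit together as soon as the transition between them is
    allowed. *)
Lemma glue_exists x y : Q (x (-1)) (y 0) ->
  exists w : Sigma, (forall i, i < 0 -> w i = x i) /\ (forall i, 0 <= i -> w i = y i).
Proof.
move=> xy; pose f (i : int) := if i < 0 then x i else y i.
have hf i : Q (f i) (f (i + 1)).
  rewrite /f; case: (ltP i 0) => i0; case: (ltP (i + 1) 0) => i1; try lia.
  - exact: coordsP.
  - have -> : i = -1 by lia.
    exact: xy.
  - exact: coordsP.
exists (Subshift hf); split => i i0 /=; rewrite /f.
  by rewrite i0.
by rewrite ltNge i0.
Qed.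

Lemma agree_sym x y m : agree x y m -> agree y x m.
Proof. by move=> h i im; rewrite h. Qed.

Lemma agree_le x y (m n : nat) : (n <= m)%N -> agree x y m -> agree x y n.
Proof. by move=> nm h i im; apply: h; lia. Qed.

Lemma agreementP x y : x <> y -> agree x y (agreement x y) /\
  forall m, agree x y m -> (m <= agreement x y)%N.
Proof.
move=> xy; have [i xyi] : exists i, x i <> y i.
  by apply: contrapT => h; apply: xy; apply: subshift_ext => i; apply: contrapT => h'; apply: h; exists i.
have bd m : agree x y m -> (m <= `|i|)%N.
  move=> h; rewrite leqNgt; apply/negP => mi; apply: xyi; apply: h; lia.
pose P := fun m => `[< agree x y m >].
have ex : exists m, P m by exists 0%N; apply/asboolP => j; lia.
have ub m : P m -> (m <= `|i|)%N by move=> /asboolP; exact: bd.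
apply: (@xgetPex _ 0%N [set m | agree x y m /\ forall m', agree x y m' -> (m' <= m)%N]).
case: (ex_maxnP ex ub) => m /asboolP hm hmax.
by exists m; split => // m' h'; apply: hmax; apply/asboolP.
Qed.

(** * Metric and mixing *)

Section Distance.
Context {R : realType} {omega : R}.
Hypothesis om : 0 < omega < 1.

Let om0 : 0 < omega. Proof. by case/andP: om. Qed.
Let om1 : omega <= 1. Proof. by case/andP: om => _ /ltW. Qed.

Lemma sdist_ge0 x y : 0 <= sdist omega x y.
Proof. by rewrite /sdist; case: ifP => // _; rewrite exprn_ge0// ltW. Qed.

Lemma sdist_agree x y m : agree x y m -> sdist omega x y <= omega ^+ m.
Proof.
move=> h; rewrite /sdist; case: ifPn => [_|/eqP xy]; first by rewrite exprn_ge0// ltW.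
have [_ hm] := agreementP xy; apply: ler_wiXn2l => //; [exact: ltW|exact: hm].
Qed.

Lemma agree_of_sdist x y m : sdist omega x y < omega ^+ m -> agree x y m.+1.
Proof.
rewrite /sdist; case: ifPn => [/eqP -> //|/eqP xy h].
have [ha _] := agreementP xy; apply: agree_le ha.
rewrite ltnNge; apply/negP => hm; move: h; apply/negP; rewrite -leNgt.
by apply: ler_wiXn2l => //; exact: ltW.
Qed.

Lemma omega_small (e : R) : 0 < e -> exists m : nat, omega ^+ m < e.
Proof.
move=> e0; have h : geometric 1 omega n @[n --> \oo] --> (0 : R).
  by apply: cvg_geometric; rewrite gtr0_norm//; case/andP: om.
have [m _ hm] : \forall n \near \oo, geometric 1 omega n < e by exact: (cvgr_lt _ h).
by exists m; have := hm m (leqnn m); rewrite /= mul1r.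
Qed.

Lemma sopen_coord0 b : @sopen a Q R omega [set x | x 0 = b].
Proof.
move=> x /= xb; exists 1; first exact: ltr01.
move=> y /=; rewrite -(expr0 omega) => /agree_of_sdist h.
by rewrite -xb; apply/esym; apply: h.
Qed.

(** Mixing on cylinders of one letter gives a threshold for each pair of letters; as the alphabet is
    finite, the largest threshold serves all points. *)
Lemma connect_exists : @topologically_mixing a Q R omega ->
  exists n0 : nat, forall x y, exists w : Sigma,
    (forall i, i < 0 -> w i = x i) /\ (forall i, 0 <= i -> w (i + n0%:Z) = y i).
Proof.
move=> mix.
have h1 (b c : 'I_a) : exists n0 : nat, forall n, (n0 <= n)%N -> forall x y,
    x 0 = b -> y 0 = c -> exists z, z 0 = b /\ z n%:Z = c.
  (* Mixing speaks of nonempty sets; for a letter that occurs in no point the claim is vacuous. *)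
  have [[x xb]|nx] := pselect (exists x : Sigma, x 0 = b); last first.
    by exists 0%N => n _ x y xb; case: nx; exists x.
  have [[y yc]|ny] := pselect (exists y : Sigma, y 0 = c); last first.
    by exists 0%N => n _ x' y _ yc; case: ny; exists y.
  have Ub : [set x : Sigma | x 0 = b] !=set0 by exists x.
  have Uc : [set y : Sigma | y 0 = c] !=set0 by exists y.
  have [n0 hn0] := mix _ _ (sopen_coord0 (b := b)) (sopen_coord0 (b := c)) Ub Uc.
  exists n0 => n n0n _ _ _ _; have [_ [[z /= zb <-] /= zc]] := hn0 n n0n.
  by exists z; rewrite zb; split => //; rewrite -zc add0r.
have [f hf] := choice (fun bc : 'I_a * 'I_a => h1 bc.1 bc.2).
pose M := (\max_(bc : 'I_a * 'I_a) f bc).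
exists M => x y.
(* The connecting orbit starts with the letter [x (-1)], one step before the gap, hence [M.+1]. *)
have [z [zb zc]] := hf (x (-1), y 0) M.+1 ltac:(by rewrite ltnW// ltnS /M leq_bigmax)
  (shiftz (-1) x) y ltac:(by rewrite /= add0r) erefl.
rewrite /= in zb zc.
have [w1 [w1x w1z]] := @glue_exists x (shiftz 1 z) ltac:(by rewrite /= -zb; exact: coordsP).
have w1M : w1 M%:Z = y 0 by rewrite w1z//= -zc; congr (z _); lia.
have hQ : Q (shiftz M%:Z w1 (-1)) (y 0).
  by rewrite -w1M /=; have := coordsP w1 (-1 + M%:Z); rewrite (_ : -1 + M%:Z + 1 = M%:Z)//; lia.
have [w2 [w2w w2y]] := glue_exists hQ.
exists (shiftz (- M%:Z) w2); split => i i0 /=.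
  by rewrite w2w /=; [rewrite subrK; exact: w1x|lia].
by rewrite addrK; exact: w2y.
Qed.

End Distance.

(** Compactness: the alphabet being finite, an ultrafilter selects one letter at each coordinate,
    and finitely many coordinates are attained together, so these letters form a point. *)
Lemma subshift_cluster (u : nat -> Sigma) :
  exists z, forall m n, exists2 n', (n <= n')%N & agree z (u n') m.
Proof.
have [G [GU Goo]] := ultraFilterLemma (F := \oo) _.
have FG : Filter G by exact _.
have h1 (i : int) : exists b, G [set n | u n i = b].
  apply: contrapT => h.
  have h2 (b : 'I_a) : G (~` [set n | u n i = b]).
    by have [hb|//] := in_ultra_setVsetC [set n | u n i = b] GU; case: h; exists b.
  have := @filter_forall _ _ _ G FG h2.
  by move=> /filter_ex[n /(_ (u n i))] /=; apply.
have [f hf] := choice h1.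
have hQ i : Q (f i) (f (i + 1)).
  have [n [/= <- <-]] := filter_ex (filterI (hf i) (hf (i + 1))).
  exact: coordsP.
exists (Subshift hQ) => m n.
have h2 : G [set n' | forall j : 'I_(m + m), u n' (j%:Z - m%:Z) = f (j%:Z - m%:Z)].
  by apply: filter_forall => j; exact: hf.
have [n' [/= nn' h3]] := filter_ex (filterI (Goo _ (nbhs_infty_ge n)) h2).
exists n' => // i im /=.
have jm : (absz (i + m%:Z)%R < m + m)%N by lia.
have := h3 (Ordinal jm); rewrite /= (_ : (absz (i + m%:Z)%R)%:Z - m%:Z = i)//; lia.
Qed.

(** Points that violate [P] for larger and larger [n] would accumulate at a point, against the local
    bound there. *)
Lemma subshift_uniform (P : Sigma -> nat -> Prop) :
  (forall x n n', (n <= n')%N -> P x n -> P x n') ->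
  (forall x, exists m n, forall y, agree x y m -> P y n) ->
  exists n, forall y, P y n.
Proof.
move=> mono loc; apply: contrapT => h.
have h1 (n : nat) : exists y, ~ P y n.
  by apply: contrapT => h'; apply: h; exists n => y; apply: contrapT => h2; apply: h'; exists y.
have [u hu] := choice h1.
have [z hz] := subshift_cluster u.
have [m [n hmn]] := loc z; have [n' nn' zn'] := hz m n.
exact: (hu n' (mono _ _ _ nn' (hmn _ zn'))).
Qed.

(** * Language of the subshift *)

Definition word_of x (n : nat) : seq 'I_a := mkseq (fun i => x i%:Z) n.

(** Words that occur in points, not merely words with allowed transitions: extension to both sides
    is then immediate. *)
Definition lang (w : seq 'I_a) : bool := `[< exists x, word_of x (size w) = w >].

Lemma size_word_of x n : size (word_of x n) = n.
Proof. exact: size_mkseq. Qed.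

Lemma word_of_cat x n m :
  word_of x (n + m) = word_of x n ++ word_of (shiftz n%:Z x) m.
Proof.
rewrite /word_of /mkseq iotaD map_cat; congr (_ ++ _).
rewrite add0n -[n in iota n m]addn0 iotaDl -map_comp; apply: eq_map => i /=.
by congr (x _); lia.
Qed.

Lemma word_of_eq x y n :
  (forall i : int, 0 <= i < n%:Z -> x i = y i) <-> word_of x n = word_of y n.
Proof.
split=> [h|h i /andP[i0 inn]].
  by apply/eq_in_map => i; rewrite mem_iota => /andP[_ h']; apply: h; lia.
have := congr1 (fun s => nth (x i) s (absz i)) h.
rewrite !nth_mkseq; [|lia|lia].
by rewrite (_ : `|i|%N%:Z = i)//; lia.
Qed.

Lemma lang_word_of x n : lang (word_of x n).
Proof. by apply/asboolP; exists x; rewrite size_word_of. Qed.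

Lemma langP w : lang w -> exists x, word_of x (size w) = w.
Proof. by move=> /asboolP. Qed.

Lemma word_of_catP x u v : word_of x (size (u ++ v)) = u ++ v ->
  word_of x (size u) = u /\ word_of (shiftz (size u)%:Z x) (size v) = v.
Proof.
rewrite size_cat word_of_cat => /eqP; rewrite eqseq_cat ?size_word_of//.
by case/andP => /eqP -> /eqP ->.
Qed.

Lemma lang_catl u v : lang (u ++ v) -> lang u.
Proof. by move=> /langP[x /word_of_catP[<- _]]; exact: lang_word_of. Qed.

Lemma lang_catr u v : lang (u ++ v) -> lang v.
Proof. by move=> /langP[x /word_of_catP[_ <-]]; exact: lang_word_of. Qed.

Lemma lang_extr u : lang u -> exists b, lang (rcons u b).
Proof.
move=> /langP[x hx]; exists (x (size u)%:Z).
have -> : rcons u (x (size u)%:Z) = word_of x (size u).+1.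
  rewrite -addn1 word_of_cat hx -cats1; congr (_ ++ [:: x _]); lia.
exact: lang_word_of.
Qed.

Lemma lang_extl u : lang u -> exists b, lang (b :: u).
Proof.
move=> /langP[x hx]; exists (x (-1)).
have -> : x (-1) :: u = word_of (shiftz (-1) x) (size u).+1.
  rewrite -add1n word_of_cat shiftzD addrC subrr shiftz0 hx.
  by rewrite /word_of /= add0r.
exact: lang_word_of.
Qed.

End Symbolic.

Arguments lang {a} Q w.

(** * Bounded distortion of fiber-bunched cocycles *)

Section Cocycle.
Context {a : nat} {Q : 'M[bool]_a} {R : realType} {k : nat}.
Hypothesis k0 : (0 < k)%N.
Local Notation Sigma := (subshift Q).
Implicit Types (A B : Sigma -> 'M[R]_k) (x y z : Sigma).

Lemma invmx_mulmx (M N : 'M[R]_k) : M \in unitmx -> N \in unitmx ->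
  invmx (M *m N) = invmx N *m invmx M.
Proof.
move=> uM uN; have uMN : M *m N \in unitmx by rewrite unitmx_mul uM.
apply: (row_free_inj (A := M *m N)); first by rewrite row_free_unit.
by rewrite mulVmx// -mulmxA [invmx M *m _]mulmxA mulVmx// mul1mx mulVmx.
Qed.

Lemma cocycle_posD A n m x :
  cocycle_pos A (n + m) x = cocycle_pos A n (shiftz m%:Z x) *m cocycle_pos A m x.
Proof.
elim: n => [|n IH]; first by rewrite mul1mx.
by rewrite addSn /= IH mulmxA shiftzD.
Qed.

Lemma cocycle_pos1 A x : cocycle_pos A 1 x = A x.
Proof. by rewrite /= mulmx1 shiftz0. Qed.

Section Unit.
Variable A : Sigma -> 'M[R]_k.
Hypothesis uA : forall x, A x \in unitmx.

Lemma cocycle_pos_unit n x : cocycle_pos A n x \in unitmx.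
Proof. by elim: n => [|n IH] /=; [exact: unitmx1|rewrite unitmx_mul uA IH]. Qed.

Lemma cocycle_negE n x :
  cocycle_neg A n x = invmx (cocycle_pos A n (shiftz (- n%:Z) x)).
Proof.
have h m y : cocycle_neg A m y *m cocycle_pos A m (shiftz (- m%:Z) y) = 1%:M.
  elim: m => [|m IH]; first by rewrite mulmx1.
  rewrite -addn1 cocycle_posD cocycle_pos1 addn1 /= shiftzD.
  rewrite mulmxA -[_ *m _ *m cocycle_pos _ _ _]mulmxA (_ : 1%:Z - m.+1%:Z = - m%:Z); last by lia.
  by rewrite IH mulmx1 mulVmx.
have := h n x; set M := cocycle_pos _ _ _ => e.
by rewrite -[LHS]mulmx1 -(mulmxV (cocycle_pos_unit n (shiftz (- n%:Z) x))) mulmxA e mul1mx.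
Qed.

End Unit.

(** [rho] stands for [omega ^ r], so that the Hölder condition reads in terms of agreement.
    Non-strict inequalities with explicit constants can hold for a whole neighbourhood of
    cocycles. *)
Record unif_bunched (rho H b theta : R) (B : Sigma -> 'M[R]_k) : Prop := UnifBunched {
  ub_unit : forall x, B x \in unitmx;
  ub_norm : forall x, opnorm (B x) <= b;
  ub_normV : forall x, opnorm (invmx (B x)) <= b;
  ub_bunch : forall x, opnorm (B x) * opnorm (invmx (B x)) * rho <= theta;
  ub_holder : forall x y m, agree x y m -> opnorm (B x - B y) <= H * rho ^+ m
}.

(** Ratio of two cocycle products along nearby orbits, built from the inside out, so that each new
    pair of factors surrounds a product already close to the identity. *)
Fixpoint sandwich (M N : nat -> 'M[R]_k) (n : nat) : 'M[R]_k :=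
  if n is m.+1 then M m *m sandwich M N m *m N m else 1%:M.

(* Measured at the scale [rho ^+ (n + m - j)], the error after [j] factors is
   damped by [theta] at each step, up to factors [1 + c rho ^+ (n + m - j)] whose
   product is bounded. *)
Lemma sandwich_close (M N : nat -> 'M[R]_k) (rho theta c : R) n m :
  0 < rho < 1 -> 0 <= theta < 1 -> 0 <= c ->
  (forall j, (j < n)%N -> opnorm (M j *m N j - 1%:M) <= c * rho ^+ (n + m - j)) ->
  (forall j, (j < n)%N -> opnorm (M j) * opnorm (N j) * rho <=
      theta * (1 + c * rho ^+ (n + m - j))) ->
  opnorm (sandwich M N n - 1%:M) <=
    expR (c * (1 - rho)^-1) * (c * (1 - theta)^-1) * rho ^+ m.
Proof.
move=> /andP[r0 r1] /andP[t0 t1] c0 h1 h2.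
have ir0 : 0 <= (1 - rho)^-1 by rewrite invr_ge0; lra.
have it0 : 0 <= (1 - theta)^-1 by rewrite invr_ge0; lra.
have eir : (1 - rho) * (1 - rho)^-1 = 1 by rewrite divff// gt_eqF//; lra.
have eit : (1 - theta) * (1 - theta)^-1 = 1 by rewrite divff// gt_eqF//; lra.
(* [S j] is a tail of the geometric series of the errors, and [S j.+1 - S j] is the exponent added
   at step [j]; [E] solves [E = theta * E + c]. *)
pose S j := c * rho ^+ (n + m - j).+1 * (1 - rho)^-1.
pose E := c * (1 - theta)^-1.
have E0 : 0 <= E by rewrite mulr_ge0.
suff h j : (j <= n)%N -> opnorm (sandwich M N j - 1%:M) <= expR (S j) * E * rho ^+ (n + m - j).
  apply: (le_trans (h n (leqnn n))); rewrite addKn ler_wpM2r ?exprn_ge0 ?(ltW r0)//.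
  rewrite ler_wpM2r// ler_expR /S ler_wpM2r// -[leRHS]mulr1 ler_wpM2l//.
  by rewrite exprn_ile1// ltW.
elim: j => [|j IH] jn.
  by rewrite /= subrr opnorm0 !mulr_ge0 ?expR_ge0 ?exprn_ge0 ?(ltW r0).
have {}IH := IH (ltnW jn).
have ej : (n + m - j = (n + m - j.+1).+1)%N.
  by rewrite -subSn ?subSS// (leq_trans jn)// leq_addr.
set d := (n + m - j.+1)%N in ej *.
rewrite /= -/(sandwich M N j).
have -> : M j *m sandwich M N j *m N j - 1%:M =
    M j *m (sandwich M N j - 1%:M) *m N j + (M j *m N j - 1%:M).
  by rewrite mulmxBr mulmx1 mulmxBl addrA subrK.
apply: (le_trans (opnormD _ _)).
have g1 := h1 j jn; have g2 := h2 j jn; rewrite ej in IH g1 g2.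
set o := opnorm _ in g1 *.
apply: (@le_trans _ _ (opnorm (M j) * opnorm (N j) * opnorm (sandwich M N j - 1%:M) + o)).
  rewrite lerD2r; apply: (le_trans (opnormM _ _)).
  by rewrite mulrAC ler_wpM2r ?opnorm_ge0// opnormM.
have rd : 0 <= rho ^+ d by rewrite exprn_ge0// ltW.
have eS : expR (S j.+1) = expR (S j) * expR (c * rho ^+ d.+1).
  rewrite -expRD; congr expR; rewrite /S -/d ej.
  transitivity (c * rho ^+ d.+2 * (1 - rho)^-1 + c * rho ^+ d.+1 * ((1 - rho) * (1 - rho)^-1)).
    by rewrite !exprS; ring.
  by rewrite eir mulr1.
have x1 : 1 <= expR (S j.+1).
  by rewrite -[leLHS]expR0 ler_expR !mulr_ge0// exprn_ge0// ltW.
have hx : 1 + c * rho ^+ d.+1 <= expR (c * rho ^+ d.+1) := expR_ge1Dx _.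
have SE : 0 <= expR (S j) * E by rewrite mulr_ge0 ?expR_ge0.
have s1 : opnorm (M j) * opnorm (N j) * opnorm (sandwich M N j - 1%:M) <=
    theta * expR (S j.+1) * E * rho ^+ d.
  apply: (@le_trans _ _ (opnorm (M j) * opnorm (N j) * (expR (S j) * E * rho ^+ d.+1))).
    by rewrite ler_wpM2l// mulr_ge0 ?opnorm_ge0.
  rewrite exprS.
  have -> : opnorm (M j) * opnorm (N j) * (expR (S j) * E * (rho * rho ^+ d)) =
    (opnorm (M j) * opnorm (N j) * rho) * (expR (S j) * E * rho ^+ d) by ring.
  apply: (@le_trans _ _ (theta * expR (c * rho ^+ d.+1) * (expR (S j) * E * rho ^+ d))).
    rewrite ler_wpM2r ?mulr_ge0//.
    by apply: (le_trans g2); rewrite ler_wpM2l.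
  by rewrite eS le_eqVlt; apply/orP; left; apply/eqP; ring.
have s2 : o <= c * rho ^+ d.
  by apply: (le_trans g1); rewrite ler_wpM2l// exprS ler_piMl// ltW.
have s3 : c * rho ^+ d <= expR (S j.+1) * ((1 - theta) * E) * rho ^+ d.
  have eE : (1 - theta) * E = c by rewrite /E mulrCA eit mulr1.
  by rewrite ler_wpM2r// eE; exact: ler_peMl.
apply: (le_trans (lerD s1 s2)); lra.
Qed.

Lemma mulmx_add1_l (X Y : 'M[R]_k) : Y \in unitmx ->
  X = (1%:M + (X *m invmx Y - 1%:M)) *m Y.
Proof. by move=> uY; rewrite addrC subrK -mulmxA mulVmx// mulmx1. Qed.

Lemma mulmx_add1_r (X Y : 'M[R]_k) : Y \in unitmx ->
  X = Y *m (1%:M + (invmx Y *m X - 1%:M)).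
Proof. by move=> uY; rewrite addrC subrK mulmxA mulmxV// mul1mx. Qed.

Section Distortion.
Variables (rho H b theta : R) (B : Sigma -> 'M[R]_k).
Hypotheses (r01 : 0 < rho < 1) (t01 : 0 <= theta < 1) (H0 : 0 <= H) (b1 : 1 <= b).
Hypothesis HB : unif_bunched rho H b theta B.

Let r0 : 0 < rho. Proof. by case/andP: r01. Qed.
Let r1 : rho <= 1. Proof. by case/andP: r01 => _ /ltW. Qed.

Definition distC : R := expR (H * b * (1 - rho)^-1) * (H * b * (1 - theta)^-1).

Lemma distC_ge0 : 0 <= distC.
Proof.
have b0 : 0 <= b by apply: le_trans b1.
case/andP: r01 => _ r; case/andP: t01 => _ t.
by rewrite !mulr_ge0 ?expR_ge0// ?invr_ge0 ?subr_ge0 ltW.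
Qed.

(** The Hölder error is additive; [1 <= opnorm (B y) * b] makes it relative, so that the bunching at
    [y] applies. *)
Lemma opnorm_near x y m : agree x y m ->
  opnorm (B x) * opnorm (invmx (B y)) * rho <= theta * (1 + H * b * rho ^+ m).
Proof.
move=> xy; have hh := ub_holder HB xy.
have h1 : opnorm (B x) <= opnorm (B y) + H * rho ^+ m.
  have := opnormD (B x - B y) (B y); rewrite subrK => h; apply: (le_trans h).
  by rewrite addrC lerD2l.
have h2 := opnorm_unit_ge1 k0 (ub_unit HB y).
have h3 := ub_normV HB y; have h4 := ub_bunch HB y.
have rm : 0 <= H * rho ^+ m by rewrite mulr_ge0// exprn_ge0// ltW.
have o1 := opnorm_ge0 (invmx (B y)); have o2 := opnorm_ge0 (B y).
set x' := opnorm (B x) in h1 *; set y' := opnorm (B y) in h1 h2 h4 o2 *.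
set i := opnorm _ in h2 h3 h4 o1 *; set e := H * rho ^+ m in h1 rm *.
have -> : H * b * rho ^+ m = e * b by rewrite /e; ring.
have e1 : e <= y' * (e * b).
  have y'b : 1 <= y' * b by apply: (le_trans h2); rewrite ler_wpM2l.
  by have := ler_wpM2l rm y'b; lra.
have h5 : x' <= y' * (1 + e * b) by lra.
have ir : 0 <= i * rho by rewrite mulr_ge0// ltW.
have h6 := ler_wpM2r ir h5.
have eb : 0 <= 1 + e * b by rewrite addr_ge0// mulr_ge0//; lra.
have h7 := ler_wpM2r eb h4; lra.
Qed.

(** With a common past the two products differ by a factor on the left; [dist_s] is the counterpart
    for a common future, with the factor on the right. *)
Lemma dist_u n m x y : (forall i, i < n%:Z + m%:Z -> x i = y i) ->
  exists2 S, cocycle_pos B n y = (1%:M + S) *m cocycle_pos B n x &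
    opnorm S <= distC * rho ^+ m.
Proof.
move=> xy; exists (cocycle_pos B n y *m invmx (cocycle_pos B n x) - 1%:M).
  by apply: mulmx_add1_l; exact: (cocycle_pos_unit (ub_unit HB)).
pose M j := B (shiftz j%:Z y); pose N j := invmx (B (shiftz j%:Z x)).
have eG j : cocycle_pos B j y *m invmx (cocycle_pos B j x) = sandwich M N j.
  elim: j => [|j IH]; first by rewrite /= mul1mx invmx1.
  rewrite /= -IH invmx_mulmx; last first.
  - exact: (cocycle_pos_unit (ub_unit HB)).
  - exact: (ub_unit HB).
  by rewrite !mulmxA.
have ag j : (j < n)%N -> agree (shiftz j%:Z y) (shiftz j%:Z x) (n + m - j).
  by move=> jn i im /=; rewrite xy//; lia.
rewrite eG; apply: sandwich_close => //.
- by rewrite mulr_ge0// (le_trans ler01 b1).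
- move=> j jn; rewrite /M /N.
  have -> : B (shiftz j%:Z y) *m invmx (B (shiftz j%:Z x)) - 1%:M =
      (B (shiftz j%:Z y) - B (shiftz j%:Z x)) *m invmx (B (shiftz j%:Z x)).
    by rewrite mulmxBl mulmxV// (ub_unit HB).
  apply: (le_trans (opnormM _ _)); rewrite mulrAC ler_pM ?opnorm_ge0//.
    exact: (ub_holder HB (ag j jn)).
  exact: (ub_normV HB).
- by move=> j jn; apply: opnorm_near; exact: ag.
Qed.

Lemma dist_s n m x y : (forall i, - m%:Z <= i -> x i = y i) ->
  exists2 S, cocycle_pos B n y = cocycle_pos B n x *m (1%:M + S) &
    opnorm S <= distC * rho ^+ m.
Proof.
move=> xy; exists (invmx (cocycle_pos B n x) *m cocycle_pos B n y - 1%:M).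
  by apply: mulmx_add1_r; exact: (cocycle_pos_unit (ub_unit HB)).
pose M j := invmx (B (shiftz (n - j.+1)%:Z x)); pose N j := B (shiftz (n - j.+1)%:Z y).
have eG j : (j <= n)%N -> invmx (cocycle_pos B j (shiftz (n - j)%:Z x)) *m
    cocycle_pos B j (shiftz (n - j)%:Z y) = sandwich M N j.
  elim: j => [|j IH] jn; first by rewrite /= mulmx1 invmx1.
  rewrite -[in LHS](addn1 j) !cocycle_posD !cocycle_pos1 !shiftzD invmx_mulmx; last first.
  - exact: (ub_unit HB).
  - exact: (cocycle_pos_unit (ub_unit HB)).
  have -> : 1%:Z + (n - (j + 1))%:Z = (n - j)%:Z by lia.
  by rewrite /= -IH ?(ltnW jn)// addn1 !mulmxA.
have ag j : (j < n)%N -> agree (shiftz (n - j.+1)%:Z y) (shiftz (n - j.+1)%:Z x) (n + m - j).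
  by move=> jn i im /=; rewrite xy//; lia.
have := eG n (leqnn n); rewrite subnn !shiftz0 => ->.
apply: sandwich_close => //.
- by rewrite mulr_ge0// (le_trans ler01 b1).
- move=> j jn; rewrite /M /N; set z := shiftz _ x; set z' := shiftz _ y.
  have -> : invmx (B z) *m B z' - 1%:M = invmx (B z) *m (B z' - B z).
    by rewrite mulmxBr mulVmx// (ub_unit HB).
  apply: (le_trans (opnormM _ _)); rewrite mulrC mulrAC ler_pM ?opnorm_ge0//.
    exact: (ub_holder HB (ag j jn)).
  exact: (ub_normV HB).
- move=> j jn; rewrite [X in X * rho]mulrC; apply: opnorm_near; exact: ag.
Qed.

(** Passes through the point [w] with the past of [y] and the future of [x]: [dist_u] compares [y]
    with [w], and [dist_s] compares [w] with [x]. *)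
Lemma dist_window n m x y : (forall i, - m%:Z <= i < n%:Z + m%:Z -> x i = y i) ->
  exists S S', [/\ cocycle_pos B n y = (1%:M + S) *m cocycle_pos B n x *m (1%:M + S'),
    opnorm S <= distC * rho ^+ m & opnorm S' <= distC * rho ^+ m].
Proof.
move=> xy; have C0 : 0 <= distC * rho ^+ m by rewrite mulr_ge0 ?distC_ge0 ?exprn_ge0 ?(ltW r0).
(* For [n = m = 0] the window is empty and the past of [y] might not fit the future of [x]. *)
case: n xy => [|n] xy.
  by exists 0, 0; rewrite /= opnorm0 !addr0 !mulmx1.
have xy0 : Q (y (-1)) (x 0).
  by rewrite xy; [have := coordsP y (-1); rewrite addNr|lia].
have [w [wy wx]] := glue_exists xy0.
have [S e1 hS] := @dist_u n.+1 m w y ltac:(move=> i im; case: (ltP i 0) => i0;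
   [exact: wy|rewrite wx// xy//; clear -im i0; lia]).
have [S' e2 hS'] := @dist_s n.+1 m x w ltac:(move=> i im; case: (ltP i 0) => i0;
   [rewrite wy// xy//; clear -im i0; lia|rewrite wx//]).
by exists S, S'; rewrite e1 e2 mulmxA.
Qed.

Lemma opnorm_1D_le (S : 'M[R]_k) e : opnorm S <= e -> opnorm (1%:M + S) <= 1 + e.
Proof. by move=> h; apply: (le_trans (opnormD _ _)); rewrite lerD// opnorm1_le. Qed.

Lemma bounded_distortion n x y : word_of x n = word_of y n ->
  opnorm (cocycle_pos B n y) <= (1 + distC) ^+ 2 * opnorm (cocycle_pos B n x).
Proof.
move=> /word_of_eq h.
have [S [S' [-> hS hS']]] := @dist_window n 0 x y ltac:(by move=> i hi; apply: h; lia).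
rewrite expr0 mulr1 in hS hS'.
have o1 := opnorm_1D_le hS; have o2 := opnorm_1D_le hS'.
apply: (le_trans (opnormM _ _)); rewrite expr2 mulrAC ler_pM ?opnorm_ge0//.
by apply: (le_trans (opnormM _ _)); rewrite ler_pM ?opnorm_ge0.
Qed.

Lemma opnorm_cocycle_le n x : opnorm (cocycle_pos B n x) <= b ^+ n.
Proof.
elim: n => [|n IH]; first exact: opnorm1_le.
rewrite exprS; apply: (le_trans (opnormM _ _)).
by rewrite ler_pM ?opnorm_ge0// (ub_norm HB).
Qed.

Lemma opnorm_cocycleV_le n x : opnorm (invmx (cocycle_pos B n x)) <= b ^+ n.
Proof.
elim: n => [|n IH]; first by rewrite /= invmx1 opnorm1_le.
rewrite /= invmx_mulmx ?(ub_unit HB) ?(cocycle_pos_unit (ub_unit HB))//.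
rewrite exprSr; apply: (le_trans (opnormM _ _)).
by rewrite ler_pM ?opnorm_ge0// (ub_normV HB).
Qed.

Lemma bunched_cocycle n x :
  opnorm (cocycle_pos B n x) * opnorm (invmx (cocycle_pos B n x)) * rho ^+ n <= theta ^+ n.
Proof.
elim: n => [|n IH].
  by rewrite /= invmx1 !expr0 mulr1 mulr_ile1 ?opnorm_ge0 ?opnorm1_le.
have h := ub_bunch HB (shiftz n%:Z x).
have r := ltW r0; have rn := exprn_ge0 n r.
have o1 := opnormM (B (shiftz n%:Z x)) (cocycle_pos B n x).
have o2 := opnormM (invmx (cocycle_pos B n x)) (invmx (B (shiftz n%:Z x))).
rewrite /= invmx_mulmx ?(ub_unit HB) ?(cocycle_pos_unit (ub_unit HB))//.
apply: (@le_trans _ _ ((opnorm (B (shiftz n%:Z x)) * opnorm (invmx (B (shiftz n%:Z x))) * rho) *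
  (opnorm (cocycle_pos B n x) * opnorm (invmx (cocycle_pos B n x)) * rho ^+ n))).
  have -> : forall p q s t : R, (p * q * rho) * (s * t * rho ^+ n) = (p * s) * (t * q) * rho ^+ n.+1.
    by move=> p q s t; rewrite exprS; ring.
  rewrite ler_wpM2r ?exprn_ge0// ler_pM ?opnorm_ge0//.
by rewrite exprS ler_pM// !mulr_ge0 ?opnorm_ge0.
Qed.

Lemma opnorm_cocycle_ge n m x :
  opnorm (cocycle_pos B n x) <= b ^+ m * opnorm (cocycle_pos B (m + n) x).
Proof.
rewrite cocycle_posD; set X := cocycle_pos B n x; set Y := cocycle_pos B m _.
have e : X = invmx Y *m (Y *m X).
  by rewrite mulmxA mulVmx ?mul1mx// (cocycle_pos_unit (ub_unit HB)).
rewrite {1}e; apply: (le_trans (opnormM _ _)); rewrite ler_wpM2r ?opnorm_ge0//.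
exact: opnorm_cocycleV_le.
Qed.

Lemma opnorm_cocycle_ge_r n m x :
  opnorm (cocycle_pos B n (shiftz m%:Z x)) <= b ^+ m * opnorm (cocycle_pos B (n + m) x).
Proof.
rewrite cocycle_posD; set X := cocycle_pos B n _; set Y := cocycle_pos B m x.
have e : X = (X *m Y) *m invmx Y.
  by rewrite -mulmxA mulmxV ?mulmx1// (cocycle_pos_unit (ub_unit HB)).
rewrite {1}e; apply: (le_trans (opnormM _ _)); rewrite mulrC ler_wpM2r ?opnorm_ge0//.
exact: opnorm_cocycleV_le.
Qed.

End Distortion.
End Cocycle.

(** * Uniform constants near a fiber-bunched cocycle *)

Section UniformConstants.
Context {a : nat} {Q : 'M[bool]_a} {R : realType} {k : nat}.
Hypothesis k0 : (0 < k)%N.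
Variables (omega r : R).
Hypotheses (om : 0 < omega < 1) (rp : 0 < r).
Local Notation Sigma := (subshift Q).
Implicit Types (A B : Sigma -> 'M[R]_k).

Definition hrate : R := omega `^ r.

Let om0 : 0 < omega. Proof. by case/andP: om. Qed.

Lemma hrate_bounds : 0 < hrate < 1.
Proof.
rewrite powR_gt0//=; case/andP: om => _ o1; rewrite /hrate /powR gt_eqF//.
by rewrite -[ltRHS]expR0 ltr_expR pmulr_rlt0// ln_lt0// om0.
Qed.

Lemma hrateX m : (omega ^+ m) `^ r = hrate ^+ m.
Proof.
rewrite -powR_mulrn ?(ltW om0)// -powRrM mulrC powRrM powR_mulrn//.
by case/andP: hrate_bounds => /ltW.
Qed.

Lemma holder_bound_agree B C x y m : holder_bound omega r B C -> agree x y m ->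
  opnorm (B x - B y) <= C * hrate ^+ m.
Proof.
move=> [C0 h] xy; apply: (le_trans (h x y)); rewrite ler_wpM2l//.
rewrite -hrateX ge0_ler_powR ?(ltW rp)// ?nnegrE; last exact: (sdist_agree om).
  exact: (sdist_ge0 om).
by rewrite exprn_ge0// ltW.
Qed.

(** With [b * d = (1 - theta) / 4], clearing denominators in [(theta + b d) / (1 - b d) <= (1 +
    theta) / 2] leaves [(1 - theta) ^ 2 >= 0]. *)
Lemma bunch_perturb (M N : 'M[R]_k) (rho b theta d : R) :
  0 <= rho <= 1 -> 0 <= theta < 1 -> 1 <= b -> M \in unitmx -> N \in unitmx ->
  opnorm M <= b -> opnorm (invmx M) <= b ->
  opnorm M * opnorm (invmx M) * rho <= theta ->
  d = (1 - theta) / (4 * b) -> opnorm (N - M) <= d ->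
  [/\ opnorm N <= 2 * b, opnorm (invmx N) <= 2 * b &
      opnorm N * opnorm (invmx N) * rho <= (1 + theta) / 2].
Proof.
move=> /andP[rho0 rho1] /andP[t0 t1] b1 uM uN hM hMV hb ed hd.
have b0 : 0 < b by lra.
have bd : b * d = (1 - theta) / 4 by rewrite ed; field; rewrite gt_eqF.
have d0 : 0 < d by rewrite ed divr_gt0//; lra.
have d1 : d <= b * d by rewrite ler_peMl// ltW.
have h := opnorm_inv_le uM uN.
have oN : opnorm N <= opnorm M + d.
  by have := opnormD M (N - M); rewrite addrC subrK => h1; lra.
have o1 := opnorm_ge0 M; have o2 := opnorm_ge0 (invmx M).
have o3 := opnorm_ge0 N; have o4 := opnorm_ge0 (invmx N); have o5 := opnorm_ge0 (N - M).
set x := opnorm M in hM hb oN o1; set y := opnorm (invmx M) in hMV hb h o2.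
set x' := opnorm N in oN o3 *; set y' := opnorm (invmx N) in h o4 *.
set e := opnorm (N - M) in hd h o5.
have ye : y * e <= b * d by rewrite ler_pM.
have h1 : y' * (1 - b * d) <= y.
  by apply: le_trans h; rewrite ler_wpM2l//; lra.
have h34 : 3 / 4 * y' <= y.
  apply: le_trans h1; rewrite mulrC ler_wpM2l//; lra.
split; [lra|lra|].
have h2 : x' * y' * (1 - b * d) <= (x + d) * y.
  have : x' * (y' * (1 - b * d)) <= (x + d) * y by rewrite ler_pM// mulr_ge0//; lra.
  by rewrite mulrA.
have h3 : (x + d) * y * rho <= theta + b * d.
  have p1 : d * y <= b * d by rewrite mulrC ler_wpM2r// ltW.
  have p2 : d * y * rho <= d * y by rewrite ler_piMr// mulr_ge0// ltW.
  have -> : (x + d) * y * rho = x * y * rho + d * y * rho by ring.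
  lra.
have h4 := ler_wpM2r rho0 h2.
have h5 : (x' * y' * rho) * (1 - b * d) <= theta + b * d by lra.
have h6 : (1 - b * d) * (x' * y' * rho) <= (1 - b * d) * ((1 + theta) / 2).
  rewrite mulrC; apply: (le_trans h5); rewrite bd.
  have : 0 <= (1 - theta) * (1 - theta) by rewrite -expr2 sqr_ge0.
  lra.
by rewrite ler_pM2l in h6 => //; lra.
Qed.

(** Compactness turns the pointwise strict inequality into a uniform one; a single [n] bounds both
    norms and, through [1 - 1 / n.+1], the bunching product. *)
Lemma fiber_bunched_unif A : fiber_bunched omega r A ->
  exists H b theta, [/\ 0 <= H, 1 <= b, 0 <= theta < 1, holder_bound omega r A H &
    unif_bunched hrate H b theta A].
Proof.
move=> [uA [C hC] hb]; have /andP[h0 h1] := hrate_bounds.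
have C0 : 0 <= C by case: hC.
pose P x (n : nat) := [/\ opnorm (A x) <= n%:R, opnorm (invmx (A x)) <= n%:R &
  opnorm (A x) * opnorm (invmx (A x)) * hrate <= 1 - n.+1%:R^-1].
have [n hn] : exists n, forall y, P y n.
  apply: subshift_uniform => [x n n' nn [p1 p2 p3]|x].
    have e : n%:R <= n'%:R :> R by rewrite ler_nat.
    split; [exact: le_trans e|exact: le_trans e|].
    apply: (le_trans p3); rewrite lerD2l lerN2 lef_pV2 ?posrE ?ltr0n//.
    by rewrite ler_nat.
  pose th := opnorm (A x) * opnorm (invmx (A x)) * hrate.
  pose b := 1 + opnorm (A x) + opnorm (invmx (A x)).
  have o1 := opnorm_ge0 (A x); have o2 := opnorm_ge0 (invmx (A x)).
  have th01 : 0 <= th < 1.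
    by rewrite hb andbT !mulr_ge0// ltW.
  have b1 : 1 <= b by rewrite /b; lra.
  pose d := (1 - th) / (4 * b).
  have d0 : 0 < d by case/andP: th01 => _ ?; rewrite divr_gt0//; lra.
  have [m hm] : exists m, C * hrate ^+ m <= d.
    have C1 : 0 < C + 1 by lra.
    have [m hm] := omega_small hrate_bounds (divr_gt0 d0 C1).
    exists m; have : (C + 1) * hrate ^+ m <= d.
      by rewrite mulrC -ler_pdivlMr ?ltW//; lra.
    have hm0 : 0 <= hrate ^+ m by rewrite exprn_ge0// ltW.
    lra.
  have [n hn] := nat_above (2 * b + 1 / ((1 - th) / 2)).
  exists m, n => y xy.
  have hyx : opnorm (A y - A x) <= d.
    by apply: le_trans hm; exact: (holder_bound_agree hC (agree_sym xy)).
  have hr : 0 <= hrate <= 1 by rewrite !ltW.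
  have := bunch_perturb hr th01 b1 (uA x) (uA y) _ _ (lexx _) (erefl d) hyx.
  case; [rewrite /b; lra|rewrite /b; lra|].
  move=> q1 q2 q3; case/andP: th01 => th0 th1.
  have i0 : 0 < (1 - th) / 2 by lra.
  have j0 : 0 <= 1 / ((1 - th) / 2) by rewrite divr_ge0// ltW.
  split; [lra|lra|].
  apply: (le_trans q3).
  have : n.+1%:R^-1 <= (1 - th) / 2.
    rewrite -[leRHS]invrK lef_pV2 ?posrE ?ltr0n ?invr_gt0//.
    rewrite div1r in hn; rewrite -natr1; lra.
  by move: (n.+1%:R^-1) => y1 hn1; lra.
exists C, (n%:R + 1), (1 - n.+1%:R^-1).
have p1 : 0 < n.+1%:R^-1 :> R by rewrite invr_gt0 ltr0n.
have p2 : n.+1%:R^-1 <= 1 :> R by rewrite invf_le1 ?ltr0n// (ler_nat _ 1).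
split => //; first by rewrite lerDr.
  by rewrite subr_ge0 p2/= ltrBlDr ltrDl.
split => // [x|x|x|x y m].
- by have [? _ _] := hn x; lra.
- by have [_ ? _] := hn x; lra.
- by have [_ _ ?] := hn x.
- exact: holder_bound_agree.
Qed.

Lemma unif_bunched_near A H b theta : 0 <= H -> 1 <= b -> 0 <= theta < 1 ->
  unif_bunched hrate H b theta A ->
  exists2 d : R, 0 < d & forall B, (forall x, B x \in unitmx) ->
    (forall x, opnorm (B x - A x) <= d) ->
    (exists2 C, C <= H + 1 & holder_bound omega r B C) ->
    unif_bunched hrate (H + 1) (2 * b) ((1 + theta) / 2) B.
Proof.
move=> H0 b1 t01 hA; have /andP[h0 h1] := hrate_bounds.
exists ((1 - theta) / (4 * b)).
  by case/andP: t01 => _ ?; rewrite divr_gt0//; lra.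
move=> B uB hd [C CH hC].
have hr : 0 <= hrate <= 1 by rewrite !ltW.
have h x := bunch_perturb hr t01 b1 (ub_unit hA x) (uB x) (ub_norm hA x)
  (ub_normV hA x) (ub_bunch hA x) erefl (hd x).
split => // [x|x|x|x y m xy].
- by have [] := h x.
- by have [] := h x.
- by have [] := h x.
- apply: (le_trans (holder_bound_agree hC xy)).
  by rewrite ler_wpM2r// exprn_ge0// ltW.
Qed.

End UniformConstants.

(** * Quasi-multiplicativity of typical cocycles *)

Section Selection.
Context {R : realType} {k : nat}.
Hypothesis k0 : (0 < k)%N.
Implicit Types (P psi M : 'M[R]_k).

Definition mpow P (n : nat) : 'M[R]_k := iter n (mulmx P) 1%:M.

Lemma mpowD P n m : mpow P (n + m) = mpow P n *m mpow P m.
Proof. by elim: n => [|n IH]; rewrite ?mul1mx//= IH mulmxA. Qed.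

Lemma mpow_unit P n : P \in unitmx -> mpow P n \in unitmx.
Proof. by move=> uP; elim: n => [|n IH] /=; rewrite ?unitmx1// unitmx_mul uP. Qed.

Lemma mulmx_conj (U M V : 'M[R]_k) : U \in unitmx -> V \in unitmx ->
  invmx U *m (U *m M *m V) *m invmx V = M.
Proof. by move=> uU uV; rewrite !mulmxA mulVmx// mul1mx -mulmxA mulmxV// mulmx1. Qed.

Lemma enorm_max_entry (v : 'cV[R]_k) : exists i, enorm v <= k%:R * `|v i 0|.
Proof.
pose i0 := Ordinal k0; pose p := [arg max_(p > i0) `|v p 0|]%O.
have hp q : `|v q 0| <= `|v p 0| by rewrite /p; case: arg_maxP => // i _ h; exact: h.
exists p; apply: (le_trans (enorm_le_sum _)).
apply: (@le_trans _ _ (\sum_(i < k) `|v p 0|)); first exact: ler_sum.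
by rewrite sumr_const card_ord mulr_natl.
Qed.

Lemma eigen_mpow P V (lambda : 'rV[R]_k) n : P *m V = V *m diag_mx lambda ->
  mpow P n *m V = V *m diag_mx (\row_i lambda 0 i ^+ n).
Proof.
move=> e; elim: n => [|n IH].
  rewrite mul1mx -{1}[V]mulmx1; congr (_ *m _); apply/matrixP => i j.
  by rewrite !mxE expr0.
rewrite /= -mulmxA IH mulmxA e -mulmxA mulmx_diag; congr (_ *m diag_mx _).
by apply/rowP => i; rewrite !mxE exprS.
Qed.

Lemma Vandermonde_unit (lambda : 'rV[R]_k) : injective (lambda 0) ->
  Vandermonde k lambda \in unitmx.
Proof.
move=> inj; rewrite unitmxE det_Vandermonde unitfE.
apply/prodf_neq0 => i _; apply/prodf_neq0 => j ij.
by rewrite subr_eq0; apply: contraTneq ij => /inj ->; rewrite ltnn.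
Qed.

(** A relation [V u = 0] gives [V diag(lambda ^ n) u = 0] for all [n]; inverting the Vandermonde
    matrix isolates each coordinate of [u] times its eigenvector. *)
Lemma eigenbasis_unit P V (lambda : 'rV[R]_k) : P *m V = V *m diag_mx lambda ->
  injective (lambda 0) -> (forall i, col i V != 0) -> V \in unitmx.
Proof.
move=> e inj nz; rewrite -unitmx_tr -row_free_unit -kermx_eq0; apply/eqP.
apply/row_matrixP => r0; rewrite row0.
have : V *m (row r0 (kermx V^T))^T = 0.
  apply: trmx_inj; rewrite trmx_mul trmxK trmx0.
  by rewrite -row_mul mulmx_ker row0.
move: (row r0 _) => u uV.
have h1 n : V *m (diag_mx (\row_i lambda 0 i ^+ n) *m u^T) = 0.
  by rewrite mulmxA -(eigen_mpow _ e) -mulmxA uV mulmx0.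
have h2 : V *m diag_mx u *m (Vandermonde k lambda)^T = 0.
  apply/matrixP => i n; have := congr1 (fun X : 'cV_k => X i 0) (h1 n).
  rewrite mxE [X in _ = X]mxE => h; rewrite mxE [RHS]mxE -[RHS]h; apply: eq_bigr => j _.
  by rewrite mul_mx_diag mul_diag_mx !mxE; ring.
have h3 : V *m diag_mx u = 0.
  have uW : (Vandermonde k lambda)^T \in unitmx by rewrite unitmx_tr Vandermonde_unit.
  by rewrite -[LHS]mulmx1 -(mulmxV uW) mulmxA h2 mul0mx.
apply/rowP => i; rewrite [RHS]mxE; apply/eqP/negPn/negP => ui.
case/negP: (nz i); apply/eqP/colP => l.
have := congr1 (fun X : 'M[R]_k => X l i) h3; rewrite mul_mx_diag !mxE => /eqP.
by rewrite mulf_eq0 (negbTE ui) orbF => /eqP.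
Qed.

(* By twisting, [psi] has nonzero entries in an eigenbasis of [P]; as the eigenvalues
   are distinct, Vandermonde determinants prevent the bilinear form of
   [P ^ i psi P ^ j] from vanishing for all [i, j < k]. *)
Lemma typical_selection P psi (lambda : 'I_k -> R) (v : 'I_k -> 'cV[R]_k) :
  simple_spectrum P lambda v -> twisted psi v ->
  exists2 c0 : R, 0 < c0 & forall (X : 'rV[R]_k) (F : 'cV[R]_k), exists i j : 'I_k,
    c0 * (enorm X^T * enorm F) <=
    `|(X *m (mpow P i *m psi *m mpow P j) *m F) 0 0|.
Proof.
move=> [_ inj nz eig] tw.
pose l := \row_i lambda i; pose V := \matrix_(i, j) v j i 0.
have colV i : col i V = v i by apply/colP => r0; rewrite !mxE.
have linj : injective (l 0).
  by move=> i j; rewrite !mxE => h; apply: inj; rewrite /= h.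
have eV : P *m V = V *m diag_mx l.
  apply/matrixP => i j; rewrite mul_mx_diag !mxE.
  have := congr1 (fun X : 'cV_k => X i 0) (eig j); rewrite !mxE mulrC => <-.
  by apply: eq_bigr => m _; rewrite !mxE.
have uV : V \in unitmx.
  by apply: (eigenbasis_unit eV linj) => i; rewrite colV.
pose Psi := invmx V *m psi *m V.
have Psi0 j i : Psi j i != 0.
  apply/negP => /eqP h; case/negP: (tw i j).
  have -> : psi *m v i = \sum_m Psi m i *: v m.
    have -> : psi *m v i = V *m (col i Psi).
      by rewrite /Psi -colV !colE !mulmxA mulmxV// mul1mx.
    apply/colP => r0; rewrite !mxE summxE; apply: eq_bigr => m _.
    by rewrite !mxE mulrC.
  apply: rpred_sum => m _; have [->|mj] := eqVneq m j; first by rewrite h scale0r rpred0.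
  by apply: rpredZ; apply: memv_span; apply/mapP; exists m; rewrite // mem_filter mj mem_enum.
have [mu mu0 hmu] : exists2 mu : R, 0 < mu & forall j i, mu <= `|Psi j i|.
  pose i0 := Ordinal k0; pose p := [arg min_(p < (i0, i0)) `|Psi p.1 p.2|]%O.
  exists `|Psi p.1 p.2|; first by rewrite normr_gt0.
  by move=> j i; rewrite /p; case: arg_minP => // q _ h; exact: (h (j, i)).
pose W := Vandermonde k l.
have uW : W \in unitmx by exact: Vandermonde_unit.
have uWT : W^T \in unitmx by rewrite unitmx_tr.
pose w1 := opnorm (invmx W) + 1; pose w2 := opnorm (invmx W^T) + 1.
pose g1 := opnorm V + 1; pose g2 := opnorm (invmx V) + 1.
have w10 : 0 < w1 by rewrite /w1; have := opnorm_ge0 (invmx W); lra.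
have w20 : 0 < w2 by rewrite /w2; have := opnorm_ge0 (invmx W^T); lra.
have g10 : 0 < g1 by rewrite /g1; have := opnorm_ge0 V; lra.
have g20 : 0 < g2 by rewrite /g2; have := opnorm_ge0 (invmx V); lra.
have kr : 0 < k%:R :> R by rewrite ltr0n.
exists (mu / (k%:R ^+ 4 * w1 * w2 * g1 * g2)).
  by rewrite divr_gt0// !mulr_gt0// exprn_gt0.
move=> X F; pose cc := invmx V *m F; pose d := X *m V.
have [i0 hi0] := enorm_max_entry cc; have [j0 hj0] := enorm_max_entry d^T.
pose M := diag_mx d *m Psi *m diag_mx cc^T.
(* [Phi] collects the [k ^ 2] scalars to be tested. Inverting the Vandermonde factors recovers the
   entry [(j0, i0)] of [M], where the coordinates of [X] and [F] in the eigenbasis are largest. *)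
pose Phi := W *m M *m W^T.
have ePhi (i j : 'I_k) : Phi i j = (X *m (mpow P i *m psi *m mpow P j) *m F) 0 0.
  have -> : X *m (mpow P i *m psi *m mpow P j) *m F =
      d *m diag_mx (\row_m l 0 m ^+ i) *m Psi *m (diag_mx (\row_m l 0 m ^+ j) *m cc).
    have eF : F = V *m cc by rewrite mulmxA mulmxV// mul1mx.
    have eX : X = d *m invmx V by rewrite -mulmxA mulmxV// mulmx1.
    have ei : invmx V *m mpow P i = diag_mx (\row_m l 0 m ^+ i) *m invmx V.
      rewrite -[LHS]mulmx1 -(mulmxV uV) -mulmxA [mpow P i *m _]mulmxA (eigen_mpow _ eV).
      by rewrite !mulmxA mulVmx// mul1mx.
    rewrite {1}eX {1}eF /Psi !mulmxA -[d *m invmx V *m _]mulmxA ei.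
    by rewrite -[_ *m mpow P j *m V]mulmxA (eigen_mpow _ eV) !mulmxA.
  have e1 : row i W *m diag_mx d = d *m diag_mx (\row_m l 0 m ^+ i).
    by apply/rowP => m; rewrite !mul_mx_diag !mxE mulrC.
  have e2 : diag_mx cc^T *m col j W^T = diag_mx (\row_m l 0 m ^+ j) *m cc.
    by apply/colP => m; rewrite !mul_diag_mx !mxE mulrC.
  rewrite -e1 -e2 /Phi /M.
  have -> : forall Y Z : 'M[R]_k, (Y *m Z) i j = (row i Y *m col j Z) 0 0.
    by move=> Y Z; rewrite !mxE; apply: eq_bigr => m _; rewrite !mxE.
  by rewrite !row_mul !mulmxA.
have [i [j hij]] := opnorm_max_entry Phi k0.
exists i, j; rewrite -ePhi.
have eM : M j0 i0 = d 0 j0 * Psi j0 i0 * cc i0 0.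
  by rewrite /M mul_mx_diag mxE mul_diag_mx !mxE.
have hM : `|M j0 i0| <= w1 * (k%:R ^+ 2 * `|Phi i j|) * w2.
  have -> : M = invmx W *m Phi *m invmx W^T.
    by rewrite mulmx_conj.
  apply: (le_trans (opnorm_entry _ _ _)); apply: (le_trans (opnormM _ _)).
  rewrite ler_pM ?opnorm_ge0//; last by rewrite /w2 lerDl.
  apply: (le_trans (opnormM _ _)); rewrite ler_pM ?opnorm_ge0//.
  by rewrite /w1 lerDl.
have hX : enorm X^T <= g2 * (k%:R * `|d 0 j0|).
  have -> : X = d *m invmx V by rewrite -mulmxA mulmxV// mulmx1.
  apply: (le_trans (enorm_row_mul _ _)); rewrite ler_pM ?opnorm_ge0 ?enorm_ge0//.
    by rewrite /g2 lerDl.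
  by move: hj0; rewrite mxE.
have hF : enorm F <= g1 * (k%:R * `|cc i0 0|).
  have -> : F = V *m cc by rewrite mulmxA mulmxV// mul1mx.
  apply: (le_trans (enorm_mulmx _ _)); rewrite ler_pM ?opnorm_ge0 ?enorm_ge0//.
  by rewrite /g1 lerDl.
have hXF : enorm X^T * enorm F <= g2 * (k%:R * `|d 0 j0|) * (g1 * (k%:R * `|cc i0 0|)).
  by rewrite ler_pM ?enorm_ge0.
rewrite eM !normrM in hM.
have hm := hmu j0 i0.
have dc0 : 0 <= `|d 0 j0| * `|cc i0 0| by rewrite mulr_ge0.
have hdc : mu * (`|d 0 j0| * `|cc i0 0|) <= w1 * (k%:R ^+ 2 * `|Phi i j|) * w2.
  apply: le_trans hM.
  have -> : `|d 0 j0| * `|Psi j0 i0| * `|cc i0 0| = `|Psi j0 i0| * (`|d 0 j0| * `|cc i0 0|) by ring.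
  by rewrite ler_wpM2r.
set KK := _ * g2.
have KK0 : 0 < KK by rewrite /KK !mulr_gt0// exprn_gt0.
rewrite mulrAC ler_pdivrMr//.
have h1 := ler_wpM2l (ltW mu0) hXF.
apply: (le_trans h1).
have g0 : 0 <= g2 * g1 * k%:R ^+ 2 by rewrite !mulr_ge0 ?ltW// exprn_gt0.
have h2 := ler_wpM2l g0 hdc.
have -> : mu * (g2 * (k%:R * `|d 0 j0|) * (g1 * (k%:R * `|cc i0 0|))) =
  g2 * g1 * k%:R ^+ 2 * (mu * (`|d 0 j0| * `|cc i0 0|)) by ring.
by apply: (le_trans h2); rewrite le_eqVlt /KK; apply/orP; left; apply/eqP; ring.
Qed.

End Selection.

(** * Limits of matrices in operator norm *)

Section MatrixLimits.
Context {R : realType} {k : nat}.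
Implicit Types (u v : nat -> 'M[R]_k) (L M : 'M[R]_k).

Lemma mx_norm_le_opnorm M : `|M| <= opnorm M.
Proof.
rewrite [leLHS]mx_normrE; apply: bigmax_le; first exact: opnorm_ge0.
by move=> ij _; exact: opnorm_entry.
Qed.

Lemma opnorm_le_mx_norm M : opnorm M <= (k%:R * k%:R) * `|M|.
Proof.
apply: (le_trans (opnorm_le_sum M)).
apply: (@le_trans _ _ (\sum_(i < k) \sum_(j < k) `|M|)).
  apply: ler_sum => i _; apply: ler_sum => j _; rewrite [leRHS]mx_normrE.
  exact: (le_bigmax _ (fun ij => `|M ij.1 ij.2|) (i, j)).
by rewrite !sumr_const !card_ord -mulrnA -[leLHS]mulr_natl natrM.
Qed.

Definition opcvg u L : Prop :=
  forall e : R, 0 < e -> exists n0, forall n, (n0 <= n)%N -> opnorm (u n - L) <= e.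

Lemma opcvg_of_cvg u L : u n @[n --> \oo] --> L -> opcvg u L.
Proof.
move=> cu e e0.
have c0 : 0 < k%:R * k%:R + 1 :> R by rewrite ltr_wpDl// mulr_ge0.
have [n0 _ h] : \forall n \near \oo, `|L - u n| <= e / (k%:R * k%:R + 1).
  by move/cvgrPdist_le : cu; apply; rewrite divr_gt0.
exists n0 => n nn; have := h n nn; rewrite distrC ler_pdivlMr// => h1.
apply: (le_trans (opnorm_le_mx_norm _)); apply: le_trans h1.
by rewrite mulrC ler_wpM2l// lerDl.
Qed.

(** The holonomies are defined by [lim], which says nothing before convergence is known; a geometric
    Cauchy bound provides it. *)
Lemma cauchy_opcvg u (C theta : R) : 0 <= C -> 0 <= theta < 1 ->
  (forall n l, opnorm (u (n + l)%N - u n) <= C * theta ^+ n) ->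
  opcvg u (lim (u n @[n --> \oo])).
Proof.
move=> C0 /andP[t0 t1] h; apply: opcvg_of_cvg.
suff : cvgn u by [].
apply/cauchy_cvgP; apply: cauchy_exP => e e0.
have cg : geometric C theta n @[n --> \oo] --> (0 : R).
  by apply: cvg_geometric; rewrite ger0_norm.
have [n0 _ hn0] : \forall n \near \oo, geometric C theta n < e by exact: (cvgr_lt _ cg).
exists (u n0), n0 => // n /= nn; rewrite -ball_normE /=.
rewrite distrC; apply: (le_lt_trans (mx_norm_le_opnorm _)).
have := h n0 (n - n0)%N; rewrite subnKC// => h1.
exact: (le_lt_trans h1 (hn0 n0 (leqnn n0))).
Qed.

Lemma opcvg_ext u v L : (forall n, u n = v n) -> opcvg u L -> opcvg v L.
Proof. by move=> uv h e /h[n0 hn]; exists n0 => n /hn; rewrite uv. Qed.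

Lemma opcvg_shift u L m : opcvg (fun n => u (n + m)%N) L -> opcvg u L.
Proof.
move=> h e /h[n0 hn]; exists (n0 + m)%N => n nn.
by have := hn (n - m)%N ltac:(lia); rewrite subnK//; lia.
Qed.

Lemma opcvg_mul_const X Y u L : opcvg u L ->
  opcvg (fun n => X *m u n *m Y) (X *m L *m Y).
Proof.
move=> h e e0; have c0 : 0 < opnorm X * opnorm Y + 1.
  by rewrite ltr_wpDl// mulr_ge0// opnorm_ge0.
have [n0 hn] := h _ (divr_gt0 e0 c0); exists n0 => n /hn; rewrite ler_pdivlMr// => h1.
rewrite -mulmxBl -mulmxBr; apply: (le_trans (opnormM _ _)).
apply: (@le_trans _ _ (opnorm X * opnorm (u n - L) * opnorm Y)).
  by rewrite ler_wpM2r ?opnorm_ge0// opnormM.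
apply: le_trans h1; rewrite mulrAC mulrC ler_wpM2l ?opnorm_ge0//.
by rewrite lerDl.
Qed.

Lemma opcvg_mul u v L M (e : R) : opcvg u L -> opcvg v M -> 0 < e ->
  exists n0, forall n m, (n0 <= n)%N -> (n0 <= m)%N -> opnorm (u n *m v m - L *m M) <= e.
Proof.
move=> hu hv e0.
have oL := opnorm_ge0 L; have oM := opnorm_ge0 M.
pose d := Num.min 1 (e / (opnorm L + opnorm M + 1)).
have c0 : 0 < opnorm L + opnorm M + 1 by lra.
have d0 : 0 < d by rewrite lt_min ltr01 divr_gt0.
have d1 : d <= 1 by rewrite ge_min lexx.
have de : d * (opnorm L + opnorm M + 1) <= e.
  by rewrite -ler_pdivlMr// ge_min lexx orbT.
have [n1 h1] := hu d d0; have [n2 h2] := hv d d0.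
exists (maxn n1 n2) => n m; rewrite !geq_max => /andP[nn1 _] /andP[_ mn2].
have {}h1 := h1 _ nn1; have {}h2 := h2 _ mn2.
have -> : u n *m v m - L *m M =
    (u n - L) *m (v m - M) + ((u n - L) *m M + L *m (v m - M)).
  rewrite !mulmxBl !mulmxBr.
  move: (u n *m v m) (u n *m M) (L *m v m) (L *m M) => x y z w.
  by apply/matrixP => i j; rewrite !mxE; ring.
have o1 := opnorm_ge0 (u n - L); have o2 := opnorm_ge0 (v m - M).
have p1 : opnorm ((u n - L) *m (v m - M)) <= d * 1.
  by apply: (le_trans (opnormM _ _)); rewrite ler_pM// (le_trans h2).
have p2 : opnorm ((u n - L) *m M) <= d * opnorm M.
  by apply: (le_trans (opnormM _ _)); rewrite ler_wpM2r.
have p3 : opnorm (L *m (v m - M)) <= opnorm L * d.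
  by apply: (le_trans (opnormM _ _)); rewrite ler_wpM2l.
apply: (le_trans (opnormD _ _)); have := opnormD ((u n - L) *m M) (L *m (v m - M)).
move=> p4; apply: le_trans de.
have -> : d * (opnorm L + opnorm M + 1) = d * 1 + (d * opnorm M + opnorm L * d) by ring.
by apply: lerD => //; apply: le_trans p4 _; exact: lerD.
Qed.

End MatrixLimits.

(** * Holonomies as limits of cocycle quotients *)

Section Holonomy.
Context {a : nat} {Q : 'M[bool]_a} {R : realType} {k : nat}.
Hypothesis k0 : (0 < k)%N.
Local Notation Sigma := (subshift Q).
Variables (rho H b theta : R) (A : Sigma -> 'M[R]_k).
Hypotheses (r01 : 0 < rho < 1) (t01 : 0 <= theta < 1) (H0 : 0 <= H) (b1 : 1 <= b).
Hypothesis HA : unif_bunched rho H b theta A.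
Implicit Types x y z p : Sigma.

Let uA := ub_unit HA.
Let uC n x : cocycle_pos A n x \in unitmx := cocycle_pos_unit uA n x.
Let C := distC rho H b theta.
Let C0 : 0 <= C := distC_ge0 r01 t01 H0 b1.

(** Successive quotients differ by a distortion term [S] placed between a cocycle product and the
    inverse of a nearby one; the gain [rho ^ n] in [S] beats the norms of these outer factors by
    bunching. *)
Lemma bunched_product n x (X Y S : 'M[R]_k) :
  opnorm X <= (1 + C) * opnorm (cocycle_pos A n x) ->
  opnorm Y <= opnorm (invmx (cocycle_pos A n x)) ->
  opnorm S <= C * rho ^+ n ->
  opnorm Y * opnorm S * opnorm X <= (1 + C) * C * theta ^+ n.
Proof.
move=> hX hY hS; have hb := bunched_cocycle r01 HA n x.
apply: (@le_trans _ _ (opnorm (invmx (cocycle_pos A n x)) * (C * rho ^+ n) *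
   ((1 + C) * opnorm (cocycle_pos A n x)))).
  rewrite ler_pM ?mulr_ge0 ?opnorm_ge0//.
  by rewrite ler_pM ?opnorm_ge0.
have -> : opnorm (invmx (cocycle_pos A n x)) * (C * rho ^+ n) *
   ((1 + C) * opnorm (cocycle_pos A n x)) = ((1 + C) * C) *
   (opnorm (cocycle_pos A n x) * opnorm (invmx (cocycle_pos A n x)) * rho ^+ n) by ring.
by rewrite ler_wpM2l// mulr_ge0// addr_ge0.
Qed.

Lemma Hs_loc_cvg x y : (forall i, 0 <= i -> x i = y i) ->
  opcvg (fun n => invmx (cocycle_pos A n y) *m cocycle_pos A n x) (Hs_loc A y x).
Proof.
move=> xy; apply: (@cauchy_opcvg _ _ _ ((1 + C) * C) theta _ t01) => [|n l].
  by rewrite mulr_ge0// addr_ge0.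
have [S eS hS] := @dist_s _ _ _ _ k0 _ _ _ _ _ r01 t01 H0 b1 HA l n (shiftz n%:Z y) (shiftz n%:Z x)
  ltac:(by move=> i ni /=; rewrite xy//; lia).
have [S' eS' hS'] := @dist_s _ _ _ _ k0 _ _ _ _ _ r01 t01 H0 b1 HA n 0%N y x
  ltac:(by move=> i ni; rewrite xy//; lia).
rewrite expr0 mulr1 in hS'.
rewrite addnC !cocycle_posD invmx_mulmx// eS.
have -> : invmx (cocycle_pos A n y) *m invmx (cocycle_pos A l (shiftz n%:Z y)) *m
    (cocycle_pos A l (shiftz n%:Z y) *m (1%:M + S) *m cocycle_pos A n x) -
    invmx (cocycle_pos A n y) *m cocycle_pos A n x =
  invmx (cocycle_pos A n y) *m S *m cocycle_pos A n x.
  rewrite !mulmxA -[_ *m invmx _ *m cocycle_pos A l _]mulmxA mulVmx// mulmx1.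
  by rewrite mulmxDr mulmx1 mulmxDl addrC addKr.
apply: (le_trans (opnormM _ _)).
apply: (@le_trans _ _ (opnorm (invmx (cocycle_pos A n y)) * opnorm S * opnorm (cocycle_pos A n x))).
  by rewrite ler_wpM2r ?opnorm_ge0// opnormM.
apply: (bunched_product (x := y)) => //.
rewrite eS'; apply: (le_trans (opnormM _ _)); rewrite mulrC ler_wpM2r ?opnorm_ge0//.
exact: opnorm_1D_le.
Qed.

Lemma cocycle_oppE n x :
  cocycle A (- n%:Z) x = invmx (cocycle_pos A n (shiftz (- n%:Z) x)).
Proof.
case: n => [|n]; first by rewrite /= invmx1.
by rewrite -cocycle_negE.
Qed.

Lemma Hu_loc_cvg x y : (forall i, i < 0 -> x i = y i) ->
  opcvg (fun n => cocycle_pos A n (shiftz (- n%:Z) y) *m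
    invmx (cocycle_pos A n (shiftz (- n%:Z) x))) (Hu_loc A y x).
Proof.
move=> xy.
have e n : invmx (cocycle A (- n%:Z) y) *m cocycle A (- n%:Z) x =
    cocycle_pos A n (shiftz (- n%:Z) y) *m invmx (cocycle_pos A n (shiftz (- n%:Z) x)).
  by rewrite !cocycle_oppE invmxK.
apply: (opcvg_ext e).
apply: (@cauchy_opcvg _ _ _ ((1 + C) * C) theta _ t01) => [|n l].
  by rewrite mulr_ge0// addr_ge0.
rewrite !e; set y' := shiftz (- (n + l)%:Z) y; set x' := shiftz (- (n + l)%:Z) x.
have sy : shiftz l%:Z y' = shiftz (- n%:Z) y by rewrite /y' shiftzD; congr shiftz; lia.
have sx : shiftz l%:Z x' = shiftz (- n%:Z) x by rewrite /x' shiftzD; congr shiftz; lia.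
have [S eS hS] := @dist_u _ _ _ _ k0 _ _ _ _ _ r01 t01 H0 b1 HA l n x' y'
  ltac:(by move=> i ni /=; rewrite xy//; lia).
have [S' eS' hS'] := @dist_u _ _ _ _ k0 _ _ _ _ _ r01 t01 H0 b1 HA n 0%N
  (shiftz (- n%:Z) x) (shiftz (- n%:Z) y)
  ltac:(by move=> i ni; rewrite /= xy//; lia).
rewrite expr0 mulr1 in hS'.
rewrite !cocycle_posD invmx_mulmx// eS sx sy.
have -> : cocycle_pos A n (shiftz (- n%:Z) y) *m ((1%:M + S) *m cocycle_pos A l x') *m
    (invmx (cocycle_pos A l x') *m invmx (cocycle_pos A n (shiftz (- n%:Z) x))) -
    cocycle_pos A n (shiftz (- n%:Z) y) *m invmx (cocycle_pos A n (shiftz (- n%:Z) x)) =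
  cocycle_pos A n (shiftz (- n%:Z) y) *m S *m invmx (cocycle_pos A n (shiftz (- n%:Z) x)).
  rewrite !mulmxA -[_ *m cocycle_pos A l x' *m _]mulmxA mulmxV// mulmx1.
  by rewrite mulmxDr mulmx1 mulmxDl addrC addKr.
apply: (le_trans (opnormM _ _)); rewrite mulrC.
apply: (@le_trans _ _ (opnorm (invmx (cocycle_pos A n (shiftz (- n%:Z) x))) * opnorm S *
   opnorm (cocycle_pos A n (shiftz (- n%:Z) y)))).
  by rewrite -mulrA ler_wpM2l ?opnorm_ge0// mulrC opnormM.
apply: (bunched_product (x := shiftz (- n%:Z) x)) => //.
rewrite eS'; apply: (le_trans (opnormM _ _)); rewrite ler_wpM2r ?opnorm_ge0//.
exact: opnorm_1D_le.
Qed.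

(** For the chosen time [m], the quotients after [m] are the local ones between fixed outer factors;
    so the limit does not depend on that choice. *)
Lemma Hs_cvg p z : Ws p z ->
  opcvg (fun n => invmx (cocycle_pos A n p) *m cocycle_pos A n z) (Hs A p z).
Proof.
move=> pz; rewrite /Hs; set m := xget _ _.
have hm : Wsloc (shiftz m%:Z z) (shiftz m%:Z p).
  apply: (@xgetPex _ 0%N [set n | Wsloc (shiftz n%:Z z) (shiftz n%:Z p)]).
  by case: pz => n hn; exists n => i i0; rewrite hn.
apply: (opcvg_shift (m := m)).
have h : opcvg _ _ := @Hs_loc_cvg (shiftz m%:Z z) (shiftz m%:Z p) (fun i i0 => esym (hm i i0)).
apply: opcvg_ext (opcvg_mul_const (invmx (cocycle A m%:Z p)) (cocycle A m%:Z z) h) => n /=.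
by rewrite !cocycle_posD invmx_mulmx// !mulmxA.
Qed.

Lemma Hu_cvg p z : Wu p z ->
  opcvg (fun n => cocycle_pos A n (shiftz (- n%:Z) z) *m
    invmx (cocycle_pos A n (shiftz (- n%:Z) p))) (Hu A z p).
Proof.
move=> pz; rewrite /Hu; set m := xget _ _.
have hm : Wuloc (shiftz (- m%:Z) p) (shiftz (- m%:Z) z).
  by apply: (@xgetPex _ 0%N [set n | Wuloc (shiftz (- n%:Z) p) (shiftz (- n%:Z) z)]).
apply: (opcvg_shift (m := m)).
have h : opcvg _ _ := @Hu_loc_cvg (shiftz (- m%:Z) p) (shiftz (- m%:Z) z) (fun i i0 => esym (hm i i0)).
apply: opcvg_ext (opcvg_mul_const (invmx (cocycle A (- m%:Z) z)) (cocycle A (- m%:Z) p) h) => n /=.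
rewrite !cocycle_oppE invmxK addnC !cocycle_posD !shiftzD invmx_mulmx// !mulmxA.
have -> : - n%:Z + - m%:Z = - (m + n)%:Z by lia.
by have -> : n%:Z + - (m + n)%:Z = - m%:Z by lia.
Qed.

End Holonomy.

(** * Norms on cylinders *)

Section WordNorm.
Context {a : nat} {Q : 'M[bool]_a} {R : realType} {k : nat}.
Hypothesis k0 : (0 < k)%N.
Local Notation Sigma := (subshift Q).

(* On a word outside the language this is [sup set0 = 0]. *)
Definition wnorm (B : Sigma -> 'M[R]_k) (w : seq 'I_a) : R :=
  sup [set opnorm (cocycle_pos B (size w) x) | x in [set x | word_of x (size w) = w]].

Variables (rho H b theta : R) (B : Sigma -> 'M[R]_k).
Hypotheses (r01 : 0 < rho < 1) (t01 : 0 <= theta < 1) (H0 : 0 <= H) (b1 : 1 <= b).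
Hypothesis HB : unif_bunched rho H b theta B.
Let C := distC rho H b theta.
Let C0 : 0 <= C := distC_ge0 r01 t01 H0 b1.

Lemma wnorm_ge x n : opnorm (cocycle_pos B n x) <= wnorm B (word_of x n).
Proof.
apply: ub_le_sup.
  by exists (b ^+ n) => _ [y _ <-]; rewrite size_word_of; exact: opnorm_cocycle_le HB _ _.
by exists x; rewrite /= size_word_of.
Qed.

Lemma wnorm_le (x : Sigma) n (c : R) :
  (forall y : Sigma, word_of y n = word_of x n -> opnorm (cocycle_pos B n y) <= c) ->
  wnorm B (word_of x n) <= c.
Proof.
move=> h; apply: ge_sup.
  by exists (opnorm (cocycle_pos B n x)), x; rewrite /= size_word_of.
by move=> _ [y /= hy <-]; rewrite size_word_of in hy *; exact: h.
Qed.

Lemma wnorm_distortion x n :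
  wnorm B (word_of x n) <= (1 + C) ^+ 2 * opnorm (cocycle_pos B n x).
Proof.
by apply: wnorm_le => y hy; exact: (bounded_distortion k0 r01 t01 H0 b1 HB (esym hy)).
Qed.

Lemma wnorm_gt0 (x : Sigma) n : 0 < wnorm B (word_of x n).
Proof.
apply: lt_le_trans (wnorm_ge x n); apply: (opnorm_unit_gt0 k0).
exact: cocycle_pos_unit (ub_unit HB) _ _.
Qed.

(** Bound for the change of [ln (wnorm B)] per letter. The distortion constant is absorbed in it,
    since at least one letter is present when distortion is lost; the empty word is treated
    apart. *)
Definition wlip : R := ln b + 2 * ln (1 + C).

Lemma wlip_ge0 : 0 <= wlip.
Proof. by rewrite addr_ge0 ?mulr_ge0 ?ln_ge0// lerDl. Qed.

Lemma wlip_const_ge0 n : 0 <= (1 + C) ^+ 2 * b ^+ n.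
Proof. by apply: mulr_ge0; [exact: sqr_ge0|apply: exprn_ge0; exact: le_trans b1]. Qed.

Lemma expR_wlip n : expR (wlip * n.+1%:R) >= (1 + C) ^+ 2 * b ^+ n.+1.
Proof.
have b0 : 0 < b := lt_le_trans ltr01 b1.
have C1 : 0 < 1 + C by rewrite ltr_wpDr.
rewrite -[X in X * _]lnK ?posrE ?exprn_gt0// -[X in _ * X]lnK ?posrE ?exprn_gt0//.
rewrite -expRD ler_expR !lnXn// /wlip mulrDl -![ln _ *+ _]mulr_natl.
rewrite addrC [_ * ln b]mulrC lerD2l ler_peMr ?(ler_nat _ 1)//.
by rewrite mulr_ge0// ln_ge0// lerDl.
Qed.

Lemma wnorm_sub u v : lang Q (u ++ v) -> wnorm B (u ++ v) <= wnorm B u * wnorm B v.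
Proof.
move=> /langP[x hx]; have [xu xv] := word_of_catP hx.
rewrite -hx; apply: wnorm_le => y; rewrite hx => hy.
have [yu yv] := word_of_catP hy.
rewrite size_cat addnC cocycle_posD; apply: (le_trans (opnormM _ _)).
rewrite mulrC ler_pM ?opnorm_ge0//.
  by rewrite -[X in wnorm B X]yu; exact: wnorm_ge.
by rewrite -[X in wnorm B X]yv; exact: wnorm_ge.
Qed.

Lemma wnorm_subl u v : lang Q (u ++ v) ->
  wnorm B u <= expR (wlip * (size v)%:R) * wnorm B (u ++ v).
Proof.
case: v => [|c v] /langP[x hx]; first by rewrite cats0 mulr0 expR0 mul1r.
have [xu xv] := word_of_catP hx.
rewrite -{1}xu; apply: (le_trans (wnorm_distortion _ _)).
have h := opnorm_cocycle_ge HB (size u) (size (c :: v)) x.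
apply: (@le_trans _ _ ((1 + C) ^+ 2 * (b ^+ (size (c :: v)) *
    opnorm (cocycle_pos B (size (u ++ c :: v)) x)))).
  by rewrite ler_wpM2l ?sqr_ge0// size_cat addnC.
rewrite mulrA ler_pM ?opnorm_ge0 ?wlip_const_ge0//.
  exact: expR_wlip.
by rewrite -{2}hx; exact: wnorm_ge.
Qed.

Lemma wnorm_subr u v : lang Q (u ++ v) ->
  wnorm B v <= expR (wlip * (size u)%:R) * wnorm B (u ++ v).
Proof.
case: u => [|c u] /langP[x hx]; first by rewrite mulr0 expR0 mul1r.
have [xu xv] := word_of_catP hx.
rewrite -{1}xv; apply: (le_trans (wnorm_distortion _ _)).
have h := opnorm_cocycle_ge_r HB (size v) (size (c :: u)) x.
apply: (@le_trans _ _ ((1 + C) ^+ 2 * (b ^+ (size (c :: u)) *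
    opnorm (cocycle_pos B (size ((c :: u) ++ v)) x)))).
  by rewrite ler_wpM2l ?sqr_ge0// size_cat addnC.
rewrite mulrA ler_pM ?opnorm_ge0 ?wlip_const_ge0//.
  exact: expR_wlip.
by rewrite -{2}hx; exact: wnorm_ge.
Qed.

Lemma wnorm_nil (x : Sigma) : wnorm B [::] = 1.
Proof.
apply: le_anti; apply/andP; split.
  have := @wnorm_le x 0 1; apply => y _; exact: opnorm1_le.
by have := wnorm_ge x 0; rewrite opnorm1.
Qed.

Lemma wnorm_bound u : lang Q u -> wnorm B u <= expR (wlip * (size u)%:R).
Proof.
move=> /langP[x hx]; rewrite -{1}hx; apply: wnorm_le => y _.
apply: (le_trans (opnorm_cocycle_le HB _ _)).
case: (size u) => [|n]; first by rewrite mulr0 expR0.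
apply: le_trans (expR_wlip n).
by rewrite ler_peMl ?exprn_ge0 ?(le_trans ler01 b1)// exprn_ege1// lerDl.
Qed.

(** All axioms but the join follow from submultiplicativity and bounded distortion. The point [x0]
    puts the empty word in the language. *)
Lemma qm_system_of_join (c : R) K (x0 : Sigma) : 0 < c ->
  (forall u v, lang Q u -> lang Q v -> exists s : seq 'I_a,
    [/\ (size s <= K)%N, lang Q (u ++ s ++ v) &
      c * (wnorm B u * wnorm B v) <= wnorm B (u ++ s ++ v)]) ->
  qm_system (lang Q) (wnorm B) wlip c K.
Proof.
move=> c0 hj; split => //.
- exact: wlip_ge0.
- by have := lang_word_of x0 0.
- exact: wnorm_nil x0.
- exact: lang_catl.
- exact: lang_catr.
- exact: lang_extr.
- exact: lang_extl.
- by move=> u /langP[x <-]; exact: wnorm_gt0.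
- exact: wnorm_sub.
- exact: wnorm_subl.
- exact: wnorm_subr.
- exact: wnorm_bound.
Qed.

End WordNorm.

(** * Stability of the selection *)

Section Perturbation.
Context {R : realType} {k : nat}.
Implicit Types (P psi S : 'M[R]_k).

(** The exponents [i, j] are chosen before the perturbations: the inserted orbit, and with it the
    error terms, will depend on them. Only powers below [k] occur, so [g] bounds them all and the
    total error is at most [eta * E]. *)
Lemma selection_perturb P psi (c0 : R) : 0 < c0 ->
  (forall (X : 'rV[R]_k) (F : 'cV[R]_k), exists i j : 'I_k,
    c0 * (enorm X^T * enorm F) <= `|(X *m (mpow P i *m psi *m mpow P j) *m F) 0 0|) ->
  exists2 eta : R, 0 < eta & forall (X : 'rV[R]_k) (F : 'cV[R]_k), exists i j : 'I_k,
    forall S1 S2 psi', opnorm S1 <= eta -> opnorm S2 <= eta -> opnorm (psi' - psi) <= eta ->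
    c0 / 2 * (enorm X^T * enorm F) <=
    `|(X *m ((1%:M + S1) *m (mpow P i *m psi' *m mpow P j) *m (1%:M + S2)) *m F) 0 0|.
Proof.
move=> c00 hsel.
pose g := 1 + \sum_(i < k) opnorm (mpow P i).
have hg (i : 'I_k) : opnorm (mpow P i) <= g.
  rewrite /g (bigD1 i)//= addrCA lerDl addr_ge0// sumr_ge0// => j _; exact: opnorm_ge0.
have g1 : 1 <= g by rewrite lerDl sumr_ge0// => i _; exact: opnorm_ge0.
pose E := g ^+ 2 * (1 + 3 * (opnorm psi + 1)).
have o := opnorm_ge0 psi.
have g2 : 0 < g ^+ 2 by rewrite exprn_gt0//; lra.
have E0 : 0 < E by rewrite mulr_gt0//; lra.
pose eta := Num.min 1 (c0 / 2 / E).
have eta1 : eta <= 1 by rewrite ge_min lexx.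
have etaE : eta * E <= c0 / 2 by rewrite -ler_pdivlMr// ge_min lexx orbT.
have c20 : 0 < c0 / 2 by lra.
have eta0 : 0 < eta by rewrite lt_min ltr01 divr_gt0.
exists eta => // X F; have [i [j hij]] := hsel X F; exists i, j => S1 S2 psi' h1 h2 h3.
set T := mpow P i *m psi *m mpow P j in hij.
set T' := mpow P i *m psi' *m mpow P j.
have sand (M : 'M[R]_k) (e : R) : opnorm M <= e ->
    opnorm (mpow P i *m M *m mpow P j) <= g ^+ 2 * e.
  move=> hM; apply: (le_trans (opnormM _ _)); rewrite expr2 mulrAC ler_pM ?opnorm_ge0//.
  by apply: (le_trans (opnormM _ _)); rewrite ler_pM ?opnorm_ge0.
have hT : opnorm (T' - T) <= g ^+ 2 * eta.
  by rewrite /T' /T -mulmxBl -mulmxBr; exact: sand.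
have hT' : opnorm T' <= g ^+ 2 * (opnorm psi + 1).
  apply: sand; have := opnormD psi (psi' - psi); rewrite addrC subrK => h; lra.
have e1 : (1%:M + S1) *m T' *m (1%:M + S2) = T +
    ((T' - T) + (S1 *m T' + (T' *m S2 + S1 *m T' *m S2))).
  rewrite mulmxDl mul1mx !mulmxDr !mulmx1 mulmxDl.
  move: (S1 *m T') (T' *m S2) (S1 *m T' *m S2) => x y z'.
  by apply/matrixP => l m; rewrite !mxE; ring.
set Err := (T' - T) + _ in e1.
have hErr : opnorm Err <= c0 / 2.
  apply: le_trans etaE.
  have t0 := opnorm_ge0 T'; have s1 := opnorm_ge0 S1; have s2 := opnorm_ge0 S2.
  have p1 : opnorm (S1 *m T') <= eta * (g ^+ 2 * (opnorm psi + 1)).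
    by apply: (le_trans (opnormM _ _)); rewrite ler_pM.
  have p2 : opnorm (T' *m S2) <= (g ^+ 2 * (opnorm psi + 1)) * eta.
    by apply: (le_trans (opnormM _ _)); rewrite ler_pM.
  have p3 : opnorm (S1 *m T' *m S2) <= (eta * (g ^+ 2 * (opnorm psi + 1))) * 1.
    apply: (le_trans (opnormM _ _)); rewrite ler_pM ?opnorm_ge0//; lra.
  rewrite /Err; apply: (le_trans (opnormD _ _)).
  have q1 := opnormD (S1 *m T') (T' *m S2 + S1 *m T' *m S2).
  have q2 := opnormD (T' *m S2) (S1 *m T' *m S2).
  have -> : eta * E = g ^+ 2 * eta + (eta * (g ^+ 2 * (opnorm psi + 1)) +
    ((g ^+ 2 * (opnorm psi + 1)) * eta + (eta * (g ^+ 2 * (opnorm psi + 1))) * 1)).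
    by rewrite /E; ring.
  rewrite lerD//; apply: (le_trans q1); rewrite lerD//; apply: (le_trans q2); exact: lerD.
rewrite -/T' e1 mulmxDr mulmxDl [X in `|X|]mxE.
have h4 := row_mul_le X Err F.
have XF : 0 <= enorm X^T * enorm F by rewrite mulr_ge0 ?enorm_ge0.
have h5 : enorm X^T * opnorm Err * enorm F <= c0 / 2 * (enorm X^T * enorm F).
  by rewrite mulrAC mulrC ler_wpM2r.
have h6 := lerB_normD ((X *m T *m F) 0 0) ((X *m Err *m F) 0 0).
move: hij h4 h5 h6; set z1 := `|(X *m T *m F) 0 0|; set z2 := `|(X *m Err *m F) 0 0|.
set z3 := `|_ + _| => hij h4 h5 h6; lra.
Qed.

Lemma conj_small (U S : 'M[R]_k) (e K : R) : opnorm U * opnorm (invmx U) * e <= K ->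
  opnorm S <= e -> opnorm (U *m S *m invmx U) <= K.
Proof.
move=> hK hS; apply: le_trans hK; apply: (le_trans (opnormM _ _)).
rewrite mulrAC ler_wpM2r ?opnorm_ge0//; apply: (le_trans (opnormM _ _)).
by rewrite ler_wpM2l ?opnorm_ge0.
Qed.

Lemma add1_mul (S1 S2 : 'M[R]_k) (C e : R) : 0 <= C -> 0 <= e <= 1 ->
  opnorm S1 <= C * e -> opnorm S2 <= C * e ->
  exists2 S, (1%:M + S1) *m (1%:M + S2) = 1%:M + S & opnorm S <= (2 * C + C ^+ 2) * e.
Proof.
move=> C0 /andP[e0 e1] h1 h2; exists (S1 + S2 + S1 *m S2).
  rewrite mulmxDl mul1mx mulmxDr mulmx1.
  by rewrite [RHS]addrA [1%:M + (S1 + S2)]addrA -!addrA; congr (_ + _); rewrite addrCA.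
apply: (le_trans (opnormD _ _)).
have p1 := opnormD S1 S2.
have p2 : opnorm (S1 *m S2) <= C * e * (C * 1).
  apply: (le_trans (opnormM _ _)); rewrite ler_pM ?opnorm_ge0//.
  by apply: (le_trans h2); rewrite ler_wpM2l.
have -> : (2 * C + C ^+ 2) * e = (C * e + C * e) + C * e * (C * 1) by ring.
by rewrite lerD//; apply: (le_trans p1); rewrite lerD.
Qed.

End Perturbation.

(** * Connecting words through the homoclinic orbit *)

Section QuasiMultiplicativity.
Context {a : nat} {Q : 'M[bool]_a} {R : realType} {k : nat}.
Hypothesis k0 : (0 < k)%N.
Local Notation Sigma := (subshift Q).
Variables (rho H b theta : R) (A : Sigma -> 'M[R]_k).
Hypotheses (r01 : 0 < rho < 1) (t01 : 0 <= theta < 1) (H0 : 0 <= H) (b1 : 1 <= b).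
Hypothesis HA : unif_bunched rho H b theta A.
Variables (p z : Sigma) (per : nat).
Hypotheses (per0 : (0 < per)%N) (pp : shiftz per%:Z p = p).
Hypotheses (zs : Ws p z) (zu : Wu p z).
Let P := cocycle_pos A per p.
Let uA := ub_unit HA.
Let uC n x : cocycle_pos A n x \in unitmx := cocycle_pos_unit uA n x.
Let psi := Hs A p z *m Hu A z p.

Lemma periodic_coord m i : p (i + (m * per)%:Z) = p i.
Proof.
elim: m => [|m IH]; first by rewrite mul0n addr0.
rewrite -IH mulSn -[in RHS]pp /=; congr (p _); lia.
Qed.

Lemma periodic_coordB m i : p (i - (m * per)%:Z) = p i.
Proof. by rewrite -[LHS](periodic_coord m) subrK. Qed.

Lemma periodic_shift m : shiftz (- (m * per)%:Z) p = p.
Proof. by apply: subshift_ext => i /=; exact: periodic_coordB. Qed.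

Lemma periodic_shiftD m : shiftz (m * per)%:Z p = p.
Proof. by apply: subshift_ext => i /=; exact: periodic_coord. Qed.

Lemma periodic_cocycle m : cocycle_pos A (m * per) p = mpow P m.
Proof.
elim: m => [|m IH]; first by rewrite mul0n.
by rewrite mulSn cocycle_posD periodic_shiftD IH.
Qed.

Lemma homoclinic_agree : exists n1 : nat,
  (forall i, n1%:Z <= i -> z i = p i) /\ (forall i, i < - n1%:Z -> z i = p i).
Proof.
have [n hn] := zs; have [m hm] := zu.
exists (maxn n m); split => i hi.
  by have := hn (i - n%:Z) ltac:(lia); rewrite /= subrK.
by have := hm (i + m%:Z) ltac:(lia); rewrite /= addrK.
Qed.

(** Stripped of the powers of [P], the cocycle along the homoclinic orbit is an approximation of the
    stable holonomy times one of the unstable holonomy; longer times keep it as close, so [M0]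
    serves all [i] and [j]. *)
Lemma middle_limit (eta : R) : 0 < eta -> exists M0 : nat, forall M i j : nat, (M0 <= M)%N ->
  exists2 psi', cocycle_pos A ((M + i) * per + (M + j) * per) (shiftz (- ((M + j) * per)%:Z) z) =
     mpow P (M + i) *m psi' *m mpow P (M + j) & opnorm (psi' - psi) <= eta.
Proof.
move=> eta0.
have hs := Hs_cvg k0 r01 t01 H0 b1 HA zs.
have hu := Hu_cvg k0 r01 t01 H0 b1 HA zu.
have [n0 hn0] := opcvg_mul hs hu eta0.
exists n0 => M i j n0M.
have h := hn0 ((M + i) * per)%N ((M + j) * per)%N
  ltac:(by rewrite -[n0]muln1 leq_mul// (leq_trans n0M)// leq_addr)
  ltac:(by rewrite -[n0]muln1 leq_mul// (leq_trans n0M)// leq_addr).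
rewrite periodic_shift !periodic_cocycle in h.
exists ((invmx (mpow P (M + i)) *m cocycle_pos A ((M + i) * per) z) *m
  (cocycle_pos A ((M + j) * per) (shiftz (- ((M + j) * per)%:Z) z) *m invmx (mpow P (M + j)))) => //.
have uP m : mpow P m \in unitmx by apply: mpow_unit; exact: uC.
rewrite cocycle_posD shiftzD subrr shiftz0 !mulmxA mulmxV// mul1mx -[RHS]mulmxA mulVmx// mulmx1.
by [].
Qed.

Lemma cocycle_diff (B : Sigma -> 'M[R]_k) (g d : R) n x : 1 <= g -> 0 <= d ->
  (forall y, opnorm (A y) <= g) -> (forall y, opnorm (B y) <= g) ->
  (forall y, opnorm (B y - A y) <= d) ->
  opnorm (cocycle_pos B n x - cocycle_pos A n x) <= n%:R * g ^+ n * d.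
Proof.
move=> g1 d0 hA hB hd; have g0 : 0 <= g by lra.
have hA' m : opnorm (cocycle_pos A m x) <= g ^+ m.
  elim: m => [|m IH]; first exact: opnorm1_le.
  by rewrite exprS; apply: (le_trans (opnormM _ _)); rewrite ler_pM ?opnorm_ge0.
elim: n => [|n IH]; first by rewrite subrr opnorm0 !mul0r.
rewrite /= (_ : _ - _ = B (shiftz n%:Z x) *m (cocycle_pos B n x - cocycle_pos A n x) +
   (B (shiftz n%:Z x) - A (shiftz n%:Z x)) *m cocycle_pos A n x); last first.
  by rewrite mulmxBr mulmxBl addrA subrK.
apply: (le_trans (opnormD _ _)).
have p1 : opnorm (B (shiftz n%:Z x) *m (cocycle_pos B n x - cocycle_pos A n x)) <=
    g * (n%:R * g ^+ n * d).
  by apply: (le_trans (opnormM _ _)); rewrite ler_pM ?opnorm_ge0.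
have p2 : opnorm ((B (shiftz n%:Z x) - A (shiftz n%:Z x)) *m cocycle_pos A n x) <= d * g ^+ n.
  by apply: (le_trans (opnormM _ _)); rewrite ler_pM ?opnorm_ge0.
have gn : 0 <= g ^+ n by rewrite exprn_ge0.
have p3 : d * g ^+ n <= g * g ^+ n * d by rewrite mulrC ler_wpM2r// ler_peMl.
rewrite -natr1 exprS.
have -> : (n%:R + 1) * (g * g ^+ n) * d = g * (n%:R * g ^+ n * d) + g * g ^+ n * d by ring.
by rewrite lerD// (le_trans p2).
Qed.

Variable n0 : nat.
Hypothesis hconn : forall x y : Sigma, exists w : Sigma,
  (forall i, i < 0 -> w i = x i) /\ (forall i, 0 <= i -> w (i + n0%:Z) = y i).

(* The orbit segment shadowing, from time 0, [alpha] periods of [p], then the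
   homoclinic excursion of [z], then [beta] periods of [p]. *)
Lemma excursion (n1 alpha beta : nat) (xl xr : Sigma) :
  (forall i, n1%:Z <= i -> z i = p i) -> (forall i, i < - n1%:Z -> z i = p i) ->
  (n1 < alpha * per)%N -> (n1 < beta * per)%N ->
  (forall i, 0 <= i -> xl i = p i) -> (forall i, i < 0 -> xr i = p i) ->
  exists y : Sigma, [/\ forall i, i < (alpha * per)%:Z - n1%:Z -> y i = xl i,
    forall i, 0 <= i < ((alpha + beta) * per)%:Z -> y i = z (i - (alpha * per)%:Z) &
    forall i, ((alpha + beta) * per)%:Z - (beta * per)%:Z + n1%:Z <= i ->
      y i = xr (i - ((alpha + beta) * per)%:Z)].
Proof.
move=> zp1 zp2 na nb xlp xrp.
have c1 : Q (xl (-1)) (shiftz (- (alpha * per)%:Z) z 0).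
  rewrite /= zp2; last by lia.
  by rewrite periodic_coordB -(xlp 0)//; have := coordsP xl (-1); rewrite addNr.
have [y1 [y1l y1z]] := glue_exists c1.
have eab : ((alpha + beta) * per)%:Z = (alpha * per)%:Z + (beta * per)%:Z by rewrite mulnDl.
have c2 : Q (shiftz ((alpha + beta) * per)%:Z y1 (-1)) (xr 0).
  rewrite /= y1z /=; last by lia.
  rewrite (_ : _ - _ = -1 + (beta * per)%:Z); last by lia.
  rewrite zp1; last by lia.
  rewrite periodic_coord -(xrp (-1))//.
  by have := coordsP xr (-1); rewrite addNr.
have [y2 [y2l y2r]] := glue_exists c2.
exists (shiftz (- ((alpha + beta) * per)%:Z) y2); split => i hi /=.
- rewrite y2l /=; last by lia.
  rewrite subrK; case: (ltP i 0) => i0; first exact: y1l.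
  by rewrite y1z//= zp2 ?periodic_coordB ?xlp//; lia.
- by rewrite y2l /= ?subrK ?y1z//; lia.
- case: (ltP (i - ((alpha + beta) * per)%:Z) 0) => i0; last by rewrite y2r.
  rewrite y2l//= subrK y1z /=; last by lia.
  rewrite zp1; last by lia.
  by rewrite periodic_coordB xrp// periodic_coordB.
Qed.

Lemma col_mulmx (X Y : 'M[R]_k) j : col j (X *m Y) = X *m col j Y.
Proof. by rewrite !colE mulmxA. Qed.

Lemma row_mul_split (X : 'rV[R]_k) (F : 'cV[R]_k) (U V M N : 'M[R]_k) :
  (X *m (U *m N *m V) *m F) 0 0 =
  (X *m (U *m M *m V) *m F) 0 0 + (X *m (U *m (N - M) *m V) *m F) 0 0.
Proof.
have {1}-> : N = M + (N - M) by rewrite addrC subrK.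
by rewrite mulmxDr mulmxDl mulmxDr mulmxDl mxE.
Qed.

(** Errors next to the outer products are moved inside [U], at the price of a conjugation that
    bunching keeps small. *)
Lemma sandwich_conj (U T S1 S2 : 'M[R]_k) : U \in unitmx ->
  (1%:M + S1) *m (U *m T *m U) *m (1%:M + S2) =
  U *m ((1%:M + invmx U *m S1 *m U) *m T *m (1%:M + U *m S2 *m invmx U)) *m U.
Proof.
move=> uU.
have e1 : (1%:M + S1) *m U = U *m (1%:M + invmx U *m S1 *m U).
  by rewrite mulmxDl mul1mx mulmxDr mulmx1 !mulmxA mulmxV// mul1mx.
have e2 : U *m (1%:M + S2) = (1%:M + U *m S2 *m invmx U) *m U.
  by rewrite mulmxDr mulmx1 mulmxDl mul1mx -[_ *m invmx U *m U]mulmxA mulVmx// mulmx1.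
by rewrite !mulmxA e1 -[_ *m U *m (1%:M + S2)]mulmxA e2 !mulmxA.
Qed.

Lemma lower_numeric (T1 T2 fX fF eX eF Qi c0 G : R) : 0 <= fX -> 0 <= fF -> 0 <= eX ->
  0 <= eF -> 0 <= Qi -> 0 <= G -> 0 < c0 ->
  c0 / 2 * (eX * eF) <= `|T1| -> `|T2| <= fX * G * fF ->
  fX <= Qi * eX -> fF <= Qi * eF -> G * (Qi ^+ 2 + 1) <= c0 / 4 ->
  c0 / 4 / (Qi ^+ 2 + 1) * (fX * fF) <= `|T1 + T2|.
Proof.
move=> fX0 fF0 eX0 eF0 Q0 G0 c00 h1 h2 h3 h4 h5.
have Q2 : 0 < Qi ^+ 2 + 1 by rewrite ltr_wpDl// sqr_ge0.
have ff : fX * fF <= (Qi ^+ 2 + 1) * (eX * eF).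
  apply: (@le_trans _ _ ((Qi * eX) * (Qi * eF))); first by rewrite ler_pM.
  have -> : (Qi * eX) * (Qi * eF) = Qi ^+ 2 * (eX * eF) by ring.
  by rewrite ler_wpM2r ?mulr_ge0// lerDl.
have h6 : `|T2| <= c0 / 4 * (eX * eF).
  apply: (le_trans h2); rewrite mulrAC mulrC.
  apply: (le_trans (ler_wpM2l G0 ff)); by rewrite [G * _]mulrA ler_wpM2r// mulr_ge0.
have h7 := lerB_normD T1 T2.
have h8 : c0 / 4 / (Qi ^+ 2 + 1) * (fX * fF) <= c0 / 4 * (eX * eF).
  have c4 : 0 <= c0 / 4 by rewrite divr_ge0// ltW.
  rewrite mulrAC ler_pdivrMr//; apply: (le_trans (ler_wpM2l c4 ff)).
  by rewrite le_eqVlt; apply/orP; left; apply/eqP; ring.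
move: (eX * eF) (fX * fF) h1 h6 h8 => x y h1 h6 h8; lra.
Qed.

Lemma small_power (t e : R) : 0 <= t < 1 -> 0 < e ->
  exists m : nat, forall n, (m <= n)%N -> t ^+ n <= e.
Proof.
move=> /andP[t0 t1] e0; pose t' := (t + 1) / 2.
have t'01 : 0 < t' < 1 by rewrite /t'; apply/andP; split; lra.
have [m hm] := omega_small t'01 e0; exists m => n mn.
case/andP: t'01 => t'0 t'1.
apply: (@le_trans _ _ (t' ^+ n)); first by rewrite lerXn2r ?nnegrE// /t'; lra.
by apply: le_trans (ltW hm); rewrite ler_wiXn2l// ltW.
Qed.

(** The outermost [M] periods on each side go with [u] and [w], in products compared only with
    products of [B] itself along nearby orbits. Of the following periods, [M] on each side give the
    conjugating matrix [U = P ^ M]. Only the middle block, of bounded length, compares [B] with [A];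
    hence [c], [d] and [K] do not depend on [u], [w] or [B]. *)
Lemma quasi_multiplicative_near (lambda : 'I_k -> R) (v : 'I_k -> 'cV[R]_k) (H' b' theta' : R) :
  simple_spectrum P lambda v -> twisted psi v ->
  0 <= H' -> 1 <= b' -> 0 <= theta' < 1 ->
  exists (c d : R) (K : nat), [/\ 0 < c, 0 < d & forall B : Sigma -> 'M[R]_k,
    unif_bunched rho H' b' theta' B -> (forall x, opnorm (B x - A x) <= d) ->
    forall u w, lang Q u -> lang Q w -> exists s : seq 'I_a,
      [/\ (size s <= K)%N, lang Q (u ++ s ++ w) &
        c * (wnorm B u * wnorm B w) <= wnorm B (u ++ s ++ w)]].
Proof.
move=> spec tw H'0 b'1 t'01.
have [c0 c00 hsel] := typical_selection k0 spec tw.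
have [eta eta0 hpert] := selection_perturb c00 hsel.
have [M0 hM0] := middle_limit eta0.
have [n1 [zp1 zp2]] := homoclinic_agree.
have [r0 r1] : 0 < rho /\ rho <= 1 by case/andP: r01 => ? /ltW.
pose CA := distC rho H b theta; have CA0 : 0 <= CA by exact: distC_ge0.
pose CB := distC rho H' b' theta'; have CB0 : 0 <= CB by exact: distC_ge0.
pose C := CA + CB; have C0 : 0 <= C by rewrite addr_ge0.
pose K1 := 2 * C + C ^+ 2 + 1.
have K10 : 0 < K1 by rewrite /K1 ltr_wpDl// addr_ge0 ?sqr_ge0// mulr_ge0.
have rn0 : 0 < rho ^+ n1 by rewrite exprn_gt0.
(* Bunching gives [opnorm U * opnorm (invmx U) * rho ^ mp <= theta ^ mp], whereas the errors are of
   order [rho ^ (mp - n1)]; so [theta ^ mp] has to beat [rho ^ n1] too. *)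
have [m0 hm0] := small_power t01 (divr_gt0 (mulr_gt0 eta0 rn0) K10).
have [M [M0M n1M m0M]] : exists M, [/\ (M0 <= M)%N, (n1 < M)%N & (m0 <= M)%N].
  exists (M0 + n1.+1 + m0)%N; split; rewrite ?leq_addl//.
    by rewrite -addnA leq_addr.
  by rewrite addnAC leq_addl.
have [mp emp] : exists mp, mp = (M * per)%N by exists (M * per)%N.
have Mmp : (M <= mp)%N by rewrite -[M]muln1 emp leq_mul.
have n1mp : (n1 < mp)%N by exact: leq_trans Mmp.
pose e := rho ^+ (mp - n1).
have e01 : 0 <= e <= 1 by rewrite exprn_ge0 ?exprn_ile1// ltW.
pose U := mpow P M.
have uU : U \in unitmx by apply: mpow_unit; exact: uC.
have eU : cocycle_pos A mp p = U by rewrite emp periodic_cocycle.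
have hU : opnorm U * opnorm (invmx U) * ((2 * C + C ^+ 2) * e) <= eta.
  have h := bunched_cocycle r01 HA mp p; rewrite eU in h.
  have eh : rho ^+ mp = e * rho ^+ n1 by rewrite /e -exprD subnK// ltnW.
  have h2 := hm0 mp (leq_trans m0M Mmp).
  rewrite eh mulrA in h; have h3 := le_trans h h2.
  rewrite ler_pdivlMr// in h3.
  have h4 : opnorm U * opnorm (invmx U) * e * K1 <= eta.
    rewrite -(ler_pM2r rn0); apply: le_trans h3.
    by rewrite le_eqVlt; apply/orP; left; apply/eqP; ring.
  apply: le_trans h4; rewrite [X in _ * X]mulrC mulrA ler_wpM2l ?lerDl//.
  by case/andP: e01 => ? _; rewrite !mulr_ge0 ?opnorm_ge0.
pose Qi := opnorm (invmx U); have Qi0 : 0 <= Qi by exact: opnorm_ge0.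
have Q2 : 0 < Qi ^+ 2 + 1 by rewrite ltr_wpDl// sqr_ge0.
pose g := b + b'.
have b0 : 0 < b := lt_le_trans ltr01 b1.
have b'0 : 0 < b' := lt_le_trans ltr01 b'1.
have g1 : 1 <= g by rewrite /g (le_trans b1)// lerDl ltW.
have g0 : 0 <= g := le_trans ler01 g1.
pose tm := ((M + k) * per + (M + k) * per)%N.
pose E := (1 + C) ^+ 2 * (tm%:R * g ^+ tm).
have E0 : 0 <= E by rewrite mulr_ge0 ?sqr_ge0// mulr_ge0// exprn_ge0.
(* Chosen after [M]: the difference of [B] and [A] over at most [tm] steps, enlarged by the passage
   from [Xi *m U] and [U *m F] to [Xi] and [F], must stay below half of the main term. *)
pose d := c0 / 4 / ((E + 1) * (Qi ^+ 2 + 1)).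
have E1 : 0 < E + 1 by rewrite ltr_wpDl.
have d0 : 0 < d by rewrite divr_gt0 ?mulr_gt0.
have dE : (E * d) * (Qi ^+ 2 + 1) <= c0 / 4.
  have h1 : d * ((E + 1) * (Qi ^+ 2 + 1)) = c0 / 4 by rewrite divfK// gt_eqF// mulr_gt0.
  have h2 : 0 <= d * (Qi ^+ 2 + 1) by rewrite mulr_ge0 ?(ltW d0) ?(ltW Q2).
  have h3 : (E * d) * (Qi ^+ 2 + 1) = d * ((E + 1) * (Qi ^+ 2 + 1)) - d * (Qi ^+ 2 + 1) by ring.
  by rewrite h3 h1 lerBlDr lerDl.
pose kr := k%:R ^+ 2 : R; have kr0 : 0 < kr by rewrite exprn_gt0// ltr0n.
pose G2 := (1 + CB) ^+ 2 * b' ^+ (mp + n0) : R.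
have G20 : 0 < G2 by rewrite mulr_gt0 ?exprn_gt0// ltr_wpDr.
pose c1 := c0 / 4 / (Qi ^+ 2 + 1).
have c10 : 0 < c1 by rewrite !divr_gt0.
pose c := c1 / ((kr * G2) ^+ 2).
exists c, d, (n0 + ((M + (M + k)) + (M + (M + k))) * per + n0)%N.
split; [by rewrite divr_gt0// exprn_gt0// mulr_gt0|by []|].
move=> B HB hBA u w /langP[x hx] /langP[x' hx'].
set n := size u in hx; set m := size w in hx'.
have [w1 [w1x w1p]] := hconn (shiftz n%:Z x) p.
have [xr [xrp xrx]] := hconn p x'.
(* From time [0] on, [xl] follows [p]; before it come the gap of length [n0] and [u]. Symmetrically,
   [xr] follows [p] until time [0], and then come a gap and [w]. *)
pose xl := shiftz n0%:Z w1.
have xlp i : 0 <= i -> xl i = p i by move=> i0; exact: w1p.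
pose xl0 := shiftz (- (n0 + n)%:Z) xl.
pose BL := cocycle_pos B (mp + (n0 + n)) xl0.
pose xr0 := shiftz (- mp%:Z) xr.
pose BR := cocycle_pos B (m + (n0 + mp)) xr0.
have [i1 [j1 hBL]] := opnorm_max_entry BL k0.
have [i2 [j2 hBR]] := opnorm_max_entry BR k0.
(* The column and the row of the largest entries carry the norms of the outer products up to
   [k ^ 2]; the whole product is tested on its entry [(i2, j1)]. *)
pose F := col j1 BL; pose Xi := row i2 BR.
have [i [j hij]] := hpert (Xi *m U) (U *m F).
have mj : (n1 < (M + (M + j)) * per)%N.
  by rewrite mulnDl -emp; apply: (leq_trans n1mp); rewrite leq_addr.
have mi : (n1 < (M + (M + i)) * per)%N.
  by rewrite mulnDl -emp; apply: (leq_trans n1mp); rewrite leq_addr.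
have [y [yl yz yr]] := excursion zp1 zp2 mj mi xlp xrp.
have [jp ejp] : exists jp, jp = ((M + j) * per)%N by exists ((M + j) * per)%N.
have [ip eip] : exists ip, ip = ((M + i) * per)%N by exists ((M + i) * per)%N.
have [tau etau] : exists tau, tau = (ip + jp)%N by exists (ip + jp)%N.
have eab : ((M + (M + j) + (M + (M + i))) * per = mp + tau + mp)%N.
  by rewrite etau ejp eip emp; clear; lia.
have ea : ((M + (M + j)) * per = mp + jp)%N by rewrite mulnDl ejp emp.
have eb : ((M + (M + i)) * per = mp + ip)%N by rewrite mulnDl eip emp.
have lej : (mp <= jp)%N by rewrite ejp emp mulnDl leq_addr.
have lei : (mp <= ip)%N by rewrite eip emp mulnDl leq_addr.
rewrite eab in yz yr; rewrite ea in yl yz; rewrite eb in yr.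
pose y0 := shiftz (- (n0 + n)%:Z) y.
have [s3 e3 hs3] := @dist_u _ _ _ _ k0 _ _ _ _ _ r01 t'01 H'0 b'1 HB
  (mp + (n0 + n)) (mp - n1) xl0 y0
  ltac:(by move=> l hl; rewrite /xl0 /y0 /=; apply/esym; apply: yl; clear -hl lej n1mp; lia).
have [s1 e1 hs1] := @dist_s _ _ _ _ k0 _ _ _ _ _ r01 t'01 H'0 b'1 HB
  (m + (n0 + mp)) (mp - n1) xr0 (shiftz (tau + mp)%:Z y)
  ltac:(by move=> l hl; rewrite /xr0 /= yr; [congr (xr _)|]; clear -hl lei n1mp etau; lia).
have [s [s' [ew hs hs']]] := @dist_window _ _ _ _ k0 _ _ _ _ _ r01 t01 H0 b1 HA
  tau mp (shiftz (- jp%:Z) z) (shiftz mp%:Z y)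
  ltac:(by move=> l hl; rewrite /= yz; [congr (z _)|]; clear -hl etau; lia).
have [psi' emid hpsi'] := hM0 M i j M0M.
rewrite -eip -ejp -etau in emid.
have ee : rho ^+ mp <= e by rewrite /e ler_wiXn2l// ?leq_subr// ltW.
have hC1 (S : 'M[R]_k) : opnorm S <= CB * e -> opnorm S <= C * e.
  move=> hS; apply: (le_trans hS); rewrite ler_wpM2r ?lerDr//; by case/andP: e01.
have hC2 (S : 'M[R]_k) : opnorm S <= CA * rho ^+ mp -> opnorm S <= C * e.
  move=> hS; apply: (le_trans hS); rewrite ler_pM ?lerDl ?exprn_ge0// ltW//.
have {}hs3 := hC1 _ hs3; have {}hs1 := hC1 _ hs1.
have {}hs := hC2 _ hs; have {}hs' := hC2 _ hs'.
have [sL eL hL] := add1_mul C0 e01 hs1 hs.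
have [sR eR hR] := add1_mul C0 e01 hs' hs3.
pose Amid := cocycle_pos A tau (shiftz mp%:Z y).
pose Bmid := cocycle_pos B tau (shiftz mp%:Z y).
pose T' := mpow P i *m psi' *m mpow P j.
have eA : Amid = (1%:M + s) *m (U *m T' *m U) *m (1%:M + s').
  rewrite /Amid ew emid; congr (_ *m _ *m _).
  by rewrite [(M + j)%N]addnC !mpowD /T' /U !mulmxA.
have etot : cocycle_pos B ((m + (n0 + mp)) + (tau + (mp + (n0 + n)))) y0 =
    BR *m (1%:M + s1) *m Bmid *m ((1%:M + s3) *m BL).
  rewrite (cocycle_posD B (m + (n0 + mp))) (cocycle_posD B tau) e3 -/BL mulmxA; congr (_ *m _ *m _).
    rewrite -e1; congr (cocycle_pos _ _ _); rewrite /y0 shiftzD; congr shiftz; clear; lia.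
  rewrite /Bmid; congr (cocycle_pos _ _ _); rewrite /y0 shiftzD; congr shiftz; clear; lia.
have eT : (cocycle_pos B ((m + (n0 + mp)) + (tau + (mp + (n0 + n)))) y0) i2 j1 =
    (Xi *m ((1%:M + s1) *m Amid *m (1%:M + s3)) *m F) 0 0 +
    (Xi *m ((1%:M + s1) *m (Bmid - Amid) *m (1%:M + s3)) *m F) 0 0.
  rewrite -row_mul_split etot.
  have -> : forall X Y : 'M[R]_k, (X *m Y) i2 j1 = (row i2 X *m col j1 Y) 0 0.
    by move=> X Y; rewrite !mxE; apply: eq_bigr => l _; rewrite !mxE.
  by rewrite !row_mul col_mulmx /Xi /F !mulmxA.
(* Here the distortion errors pass inside [U], where [eta] bounds them and the selection made for
   [Xi *m U] and [U *m F] applies. *)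
have hT1 : c0 / 2 * (enorm (Xi *m U)^T * enorm (U *m F)) <=
    `|(Xi *m ((1%:M + s1) *m Amid *m (1%:M + s3)) *m F) 0 0|.
  have -> : Xi *m ((1%:M + s1) *m Amid *m (1%:M + s3)) *m F = Xi *m U *m
      ((1%:M + invmx U *m sL *m U) *m T' *m (1%:M + U *m sR *m invmx U)) *m (U *m F).
    have -> : (1%:M + s1) *m Amid *m (1%:M + s3) =
        (1%:M + sL) *m (U *m T' *m U) *m (1%:M + sR).
      by rewrite eA -eL -eR !mulmxA.
    by rewrite sandwich_conj// !mulmxA.
  apply: hij => //.
    have := @conj_small _ _ (invmx U) sL _ eta _ hL; rewrite invmxK; apply.
    by rewrite [opnorm (invmx U) * _]mulrC.
  exact: (conj_small hU hR).
have hs1' : opnorm (1%:M + s1) <= 1 + C.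
  by apply: opnorm_1D_le; apply: (le_trans hs1); case/andP: e01 => _ e1'; rewrite ler_piMr.
have hs3' : opnorm (1%:M + s3) <= 1 + C.
  by apply: opnorm_1D_le; apply: (le_trans hs3); case/andP: e01 => _ e1'; rewrite ler_piMr.
have hdiff : opnorm (Bmid - Amid) <= tm%:R * g ^+ tm * d.
  have h := @cocycle_diff B g d tau (shiftz mp%:Z y) g1 (ltW d0) _ _ hBA.
  have {}h : opnorm (Bmid - Amid) <= tau%:R * g ^+ tau * d.
    apply: h => l; first by rewrite (le_trans (ub_norm HA l))// /g lerDl ltW.
    by rewrite (le_trans (ub_norm HB l))// /g lerDr ltW.
  apply: (le_trans h); rewrite ler_wpM2r ?(ltW d0)//.
  have tt : (tau <= tm)%N.
    by rewrite etau eip ejp /tm leq_add// leq_mul2r leq_add2l (ltnW (ltn_ord _)) orbT.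
  by rewrite ler_pM ?ler_nat ?exprn_ge0// ler_weXn2l.
have hT2 : `|(Xi *m ((1%:M + s1) *m (Bmid - Amid) *m (1%:M + s3)) *m F) 0 0| <=
    enorm Xi^T * (E * d) * enorm F.
  apply: (le_trans (row_mul_le _ _ _)); rewrite ler_wpM2r ?enorm_ge0// ler_wpM2l ?enorm_ge0//.
  apply: (le_trans (opnormM _ _)); rewrite /E.
  have -> : (1 + C) ^+ 2 * (tm%:R * g ^+ tm) * d = (1 + C) * (tm%:R * g ^+ tm * d) * (1 + C) by ring.
  rewrite ler_pM ?opnorm_ge0//; apply: (le_trans (opnormM _ _)).
  by rewrite ler_pM ?opnorm_ge0.
have hX : enorm Xi^T <= Qi * enorm (Xi *m U)^T.
  have {1}-> : Xi = (Xi *m U) *m invmx U by rewrite -mulmxA mulmxV// mulmx1.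
  exact: enorm_row_mul.
have hF : enorm F <= Qi * enorm (U *m F).
  have {1}-> : F = invmx U *m (U *m F) by rewrite mulmxA mulVmx// mul1mx.
  exact: enorm_mulmx.
have Ed0 : 0 <= E * d by rewrite mulr_ge0// ltW.
have := lower_numeric (enorm_ge0 _) (enorm_ge0 _) (enorm_ge0 _) (enorm_ge0 _) Qi0 Ed0 c00
  hT1 hT2 hX hF dE.
rewrite -eT -/c1 => hmain.
have [kap ekap] : exists kap, kap = (n0 + (mp + tau + mp) + n0)%N by eexists.
have elen : ((m + (n0 + mp)) + (tau + (mp + (n0 + n))) = n + (kap + m))%N by rewrite ekap; clear; lia.
rewrite elen in hmain.
pose sw := word_of (shiftz n%:Z y0) kap.
have eu : word_of y0 n = u.
  rewrite -hx; apply/word_of_eq => l hl; rewrite /y0 /= yl; last by clear -hl n1mp; lia.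
  rewrite /xl /= w1x; last by clear -hl; lia.
  by rewrite /=; congr (x _); clear; lia.
have ewv : word_of (shiftz kap%:Z (shiftz n%:Z y0)) m = w.
  rewrite -hx'; apply/word_of_eq => l hl; rewrite /y0 /= yr; last by clear -hl ekap lei n1mp etau; lia.
  rewrite (_ : _ - _ = l + n0%:Z); last by clear -ekap; lia.
  by apply: xrx; clear -hl; lia.
have etw : word_of y0 (n + (kap + m)) = u ++ sw ++ w.
  by rewrite word_of_cat eu word_of_cat ewv.
exists sw; split.
- rewrite size_word_of ekap -addnA -[X in (_ <= X)%N]addnA leq_add2l leq_add2r.
  rewrite -eab leq_mul2r; apply/orP; right.
  by have := ltn_ord i; have := ltn_ord j; clear; lia.
- by rewrite -etw; exact: lang_word_of.
have hfin : c1 * (enorm Xi^T * enorm F) <= wnorm B (u ++ sw ++ w).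
  rewrite -etw; apply: (le_trans hmain); apply: (le_trans (opnorm_entry _ _ _)).
  exact: (wnorm_ge HB).
apply: le_trans hfin.
have hu : wnorm B u <= (kr * G2) * enorm F.
  have exl : word_of xl0 n = u.
    rewrite -hx; apply/word_of_eq => l hl; rewrite /xl0 /xl /= w1x; last by clear -hl; lia.
    by rewrite /=; congr (x _); clear; lia.
  rewrite -exl; apply: (le_trans (wnorm_distortion k0 r01 t'01 H'0 b'1 HB xl0 n)).
  rewrite -/CB; have h1 := opnorm_cocycle_ge HB n (mp + n0) xl0.
  rewrite -addnA -/BL in h1.
  have h2 : opnorm BL <= kr * enorm F.
    apply: (le_trans hBL); rewrite ler_wpM2l ?(ltW kr0)//; exact: enorm_col_entry.
  have -> : kr * G2 * enorm F = (1 + CB) ^+ 2 * (b' ^+ (mp + n0) * (kr * enorm F)).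
    by rewrite /G2; ring.
  rewrite ler_wpM2l ?sqr_ge0//; apply: (le_trans h1); by rewrite ler_wpM2l// exprn_ge0 ?(ltW b'0).
have hw : wnorm B w <= (kr * G2) * enorm Xi^T.
  have exr : word_of (shiftz (n0 + mp)%:Z xr0) m = w.
    rewrite -hx'; apply/word_of_eq => l hl; rewrite /xr0 /=.
    rewrite (_ : _ - _ = l + n0%:Z); last by clear; lia.
    by apply: xrx; clear -hl; lia.
  rewrite -exr; apply: (le_trans (wnorm_distortion k0 r01 t'01 H'0 b'1 HB _ m)).
  rewrite -/CB; have hr1 := opnorm_cocycle_ge_r HB m (n0 + mp) xr0.
  rewrite -/BR in hr1.
  have hr2 : opnorm BR <= kr * enorm Xi^T.
    apply: (le_trans hBR); rewrite ler_wpM2l ?(ltW kr0)//; exact: enorm_row_entry.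
  have -> : kr * G2 * enorm Xi^T = (1 + CB) ^+ 2 * (b' ^+ (mp + n0) * (kr * enorm Xi^T)).
    by rewrite /G2; ring.
  rewrite ler_wpM2l ?sqr_ge0//; apply: (le_trans hr1); by rewrite [(n0 + mp)%N]addnC ler_wpM2l// exprn_ge0 ?(ltW b'0).
have kG : 0 < (kr * G2) ^+ 2 by rewrite exprn_gt0// mulr_gt0.
have huw : wnorm B u * wnorm B w <= (kr * G2) ^+ 2 * (enorm Xi^T * enorm F).
  have -> : (kr * G2) ^+ 2 * (enorm Xi^T * enorm F) =
    (kr * G2 * enorm F) * (kr * G2 * enorm Xi^T) by ring.
  have u0 : 0 <= wnorm B u by rewrite -eu ltW// (wnorm_gt0 k0 HB).
  have w0 : 0 <= wnorm B w by rewrite -ewv ltW// (wnorm_gt0 k0 HB).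
  by rewrite ler_pM.
rewrite /c mulrAC ler_pdivrMr//.
have -> : c1 * (enorm Xi^T * enorm F) * (kr * G2) ^+ 2 =
  c1 * ((kr * G2) ^+ 2 * (enorm Xi^T * enorm F)) by ring.
by rewrite ler_wpM2l// ltW.
Qed.

End QuasiMultiplicativity.

(** * Uniformity in the cocycle *)

Section QmLimit.
Context {R : realType} {T : finType} (L : pred (seq T)) (D c : R) (K : nat).
Variables (N_ : nat -> seq T -> R) (N : seq T -> R).
Hypothesis HS_ : \forall l \near \oo, qm_system L (N_ l) D c K.
Hypothesis HS : qm_system L N D c K.
Hypothesis hN : forall w, L w -> N_ l w @[l --> \oo] --> N w.

Lemma qsum_cvg (q : R) n : @qsum R T L (N_ l) q n @[l --> \oo] --> @qsum R T L N q n.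
Proof.
rewrite /qsum; elim: (words n) => [|w s IH].
  rewrite big_nil; under eq_fun do rewrite big_nil; exact: cvg_cst.
rewrite big_cons; under eq_fun do rewrite big_cons.
apply: cvgD IH; rewrite /qweight.
case: (boolP (L w)) => Lw; last exact: cvg_cst.
have h : q * ln (N_ l w) @[l --> \oo] --> q * ln (N w).
  apply: cvgM; first exact: cvg_cst.
  exact: (cvg_comp _ _ (hN Lw) (continuous_ln (qm_gt0 HS Lw))).
exact: (cvg_comp _ _ h (@continuous_expR R _)).
Qed.

(** The error [qerr q] is common to all these weights, so one length [n.+1] large against it reduces
    the claim to the convergence of a finite sum. *)
Lemma qpressure_cvg (q : R) : 0 <= q ->
  @qpressure R T L (N_ l) D c K q @[l --> \oo] --> @qpressure R T L N D c K q.
Proof.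
move=> q0; apply/cvgrPdist_le => e e0.
pose E := @qerr R T D c K q.
have E0 : 0 <= E := qerr_ge0 HS q0.
have [n hn] := nat_above ((2 * E + 1) / e).
have n0 : 2 * E + 1 <= n.+1%:R * e.
  rewrite -ler_pdivrMr//; apply: le_trans hn _; by rewrite ler_nat.
have h : ln (@qsum R T L (N_ l) q n.+1) @[l --> \oo] --> ln (@qsum R T L N q n.+1).
  have hq := @qsum_cvg q n.+1.
  have hl : {for @qsum R T L N q n.+1, continuous (@ln R)}.
    exact: continuous_ln (qsum_gt0 HS q n.+1).
  exact: (cvg_comp _ _ hq hl).
have h1 : \forall l \near \oo, `|ln (@qsum R T L N q n.+1) - ln (@qsum R T L (N_ l) q n.+1)| <= 1.
  by move/cvgrPdist_le : h => /(_ 1 ltr01).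
apply: filterS2 HS_ h1 => l HSl hl.
have a1 := qpressureP HS n.+1 q0; have a2 := qpressureP HSl n.+1 q0.
have m0 : 0 < n.+1%:R :> R by rewrite ltr0n.
move: a1 a2 hl n0 m0; rewrite -/E.
move: (n.+1%:R) (qpressure q) (qpressure q) (ln (qsum q n.+1)) (ln (qsum q n.+1)) => m p1 p2 s1 s2.
clear -e0; move=> a1 a2 hl n0 m0.
rewrite -(ler_pM2l m0) -{1}(gtr0_norm m0) -normrM mulrBr.
move: (m * p1) (m * p2) a1 a2 n0 => x y; rewrite !ler_norml => /andP[? ?] /andP[? ?] ?.
by move: hl; rewrite ler_norml => /andP[? ?]; apply/andP; split; lra.
Qed.

End QmLimit.

(** * Cocycles with uniform constants *)

Section GoodCocycle.
Context {a : nat} {Q : 'M[bool]_a} {R : realType} {k : nat}.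
Hypothesis k0 : (0 < k)%N.
Local Notation Sigma := (subshift Q).
Implicit Types (A B : Sigma -> 'M[R]_k) (x : Sigma).

(** Interface between cocycles and words: [kappa] bounds the distortion on cylinders, and the
    estimates of pressure and entropy see the cocycle only through these facts. *)
Record good_cocycle (D c kappa : R) (K : nat) (B : Sigma -> 'M[R]_k) : Prop := GoodCocycle {
  gc_qm : qm_system (lang Q) (wnorm B) D c K;
  gc_kappa : 0 < kappa;
  gc_ge : forall (x : Sigma) n, opnorm (cocycle_pos B n x) <= wnorm B (word_of x n);
  gc_le : forall (x : Sigma) n,
    wnorm B (word_of x n) <= kappa * opnorm (cocycle_pos B n x)
}.

Lemma gc_gt0 D c kappa K B : good_cocycle D c kappa K B ->
  forall (x : Sigma) n, 0 < opnorm (cocycle_pos B n x).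
Proof.
move=> G x n; have := qm_gt0 (gc_qm G) (lang_word_of x n).
by move=> h; have := lt_le_trans h (gc_le G x n); rewrite pmulr_rgt0 ?(gc_kappa G).
Qed.

Lemma gc_ln D c kappa K B : good_cocycle D c kappa K B ->
  forall (x : Sigma) n,
    `|ln (opnorm (cocycle_pos B n x)) - ln (wnorm B (word_of x n))| <= `|ln kappa|.
Proof.
move=> G x n; have o0 := gc_gt0 G x n.
have w0 := qm_gt0 (gc_qm G) (lang_word_of x n).
have h1 : ln (opnorm (cocycle_pos B n x)) <= ln (wnorm B (word_of x n)).
  by rewrite ler_ln ?posrE//; exact: gc_ge G x n.
have h2 : ln (wnorm B (word_of x n)) <= ln kappa + ln (opnorm (cocycle_pos B n x)).
  rewrite -lnM ?posrE ?(gc_kappa G)// ler_ln ?posrE ?mulr_gt0 ?(gc_kappa G)//.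
  exact: gc_le G x n.
rewrite distrC ger0_norm ?subr_ge0//; apply: le_trans (ler_norm _).
by rewrite lerBlDr.
Qed.

Lemma typical_good_near (omega r : R) A : 0 < omega < 1 -> 0 < r ->
  @topologically_mixing a Q R omega -> typical omega r A ->
  exists (D c kappa delta g : R) (K : nat), [/\ 0 < delta, 0 <= g &
    forall B, (forall x, B x \in unitmx) -> (forall x, opnorm (B x - A x) <= delta) ->
    (exists2 C, C <= 1 & holder_bound omega r (fun x => B x - A x) C) ->
    good_cocycle D c kappa K B /\ (forall x, opnorm (B x) <= g)].
Proof.
move=> om rp mix [fb [p [z [per [[[per0 pp _] zs zu _] [lambda [v [spec tw _]]]]]]]].
have [H [b [theta [H0 b1 t01 hA HA]]]] := fiber_bunched_unif om rp fb.
have [d1 d10 near1] := unif_bunched_near om rp H0 b1 t01 HA.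
have [n0 hconn] := connect_exists om mix.
have H'0 : 0 <= H + 1 by lra.
have b'1 : 1 <= 2 * b by lra.
have t'01 : 0 <= (1 + theta) / 2 < 1 by case/andP: t01 => ? ?; apply/andP; split; lra.
have r01 := hrate_bounds om rp.
have [c [d2 [K [c0 d20 near2]]]] :=
  quasi_multiplicative_near k0 r01 t01 H0 b1 HA per0 pp zs zu hconn spec tw H'0 b'1 t'01.
exists (wlip (hrate omega r) (H + 1) (2 * b) ((1 + theta) / 2)), c,
  ((1 + distC (hrate omega r) (H + 1) (2 * b) ((1 + theta) / 2)) ^+ 2),
  (Num.min d1 d2), (2 * b), K.
split; [by rewrite lt_min d10|lra|].
move=> B uB hB [C C1 [C0 hC]].
have HB : unif_bunched (hrate omega r) (H + 1) (2 * b) ((1 + theta) / 2) B.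
  apply: near1 => // [x|]; first by apply: le_trans (hB x) _; rewrite ge_min lexx.
  exists (C + H); first by rewrite addrC lerD2l.
  case: hA => _ hA; split; first by rewrite addr_ge0.
  move=> x y; rewrite mulrDl.
  have -> : B x - B y = (B x - A x - (B y - A y)) + (A x - A y).
    by apply/matrixP => i j; rewrite !mxE; ring.
  by apply: le_trans (opnormD _ _) _; apply: lerD.
split; last exact: ub_norm HB.
split.
- apply: (qm_system_of_join k0 r01 t'01 H'0 b'1 HB p c0).
  apply: near2 => // x; by apply: le_trans (hB x) _; rewrite ge_min lexx orbT.
- by rewrite exprn_gt0// ltr_pwDl// (distC_ge0 r01 t'01 H'0 b'1).
- by move=> x n; exact: (wnorm_ge HB).
- by move=> x n; exact: (wnorm_distortion k0 r01 t'01 H'0 b'1 HB).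
Qed.

(** At a fixed length the suprema over a cylinder are as close as the products at each point; the
    base [1 + g] is at least [1], as [cocycle_diff] requires. *)
Lemma wnorm_diff D c kappa K D' c' kappa' K' A B (g d : R) :
  good_cocycle D c kappa K A -> good_cocycle D' c' kappa' K' B ->
  0 <= g -> (forall x, opnorm (A x) <= g) -> (forall x, opnorm (B x) <= g) ->
  (forall x, opnorm (B x - A x) <= d) -> 0 <= d ->
  forall w, lang Q w -> `|wnorm B w - wnorm A w| <= (size w)%:R * (1 + g) ^+ (size w) * d.
Proof.
move=> GA GB g0 hA hB hd d0 w /langP[x <-]; rewrite size_word_of; set n := size w.
have g1 : 1 <= 1 + g by rewrite lerDl.
have gg (C : Sigma -> 'M[R]_k) y : opnorm (C y) <= g -> opnorm (C y) <= 1 + g by move=> h; lra.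
have df (y : Sigma) := cocycle_diff n y g1 d0 (fun y => gg A y (hA y))
  (fun y => gg B y (hB y)) hd.
set e := n%:R * _ * d in df *.
have dn (y : Sigma) : `|opnorm (cocycle_pos B n y) - opnorm (cocycle_pos A n y)| <= e.
  exact: le_trans (opnorm_dist _ _) (df y).
rewrite ler_norml; apply/andP; split.
  rewrite lerBrDr addrC lerBlDr; apply: wnorm_le => y exy.
  have := gc_ge GB y n; have := dn y; rewrite exy ler_norml => /andP[h1 h2] h3.
  by clear -h1 h2 h3; lra.
rewrite lerBlDr; apply: wnorm_le => y exy.
have := gc_ge GA y n; have := dn y; rewrite exy ler_norml => /andP[h1 h2] h3.
by clear -h1 h2 h3; lra.
Qed.

Lemma holder_const_lt (omega r : R) B (e : R) :
  (exists C, holder_bound omega r B C) -> holder_const omega r B < e ->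
  exists2 C, C < e & holder_bound omega r B C.
Proof.
move=> [C0 hC0] hlt.
have [] := @inf_lt R [set C | holder_bound omega r B C] e _ hlt.
  by exists C0.
by move=> C hC Ce; exists C.
Qed.

(** [Dr] is a supremum plus an infimum, which control nothing unless the sets are suitably bounded;
    fiber bunching provides this. The infimum may not be attained, hence the strict inequalities. *)
Lemma sup_le_Dr (omega r : R) A B : 0 < omega < 1 -> 0 < r ->
  fiber_bunched omega r A -> fiber_bunched omega r B ->
  (forall x, opnorm (B x - A x) <= Dr omega r B A) /\ forall e : R, Dr omega r B A < e ->
    exists2 C, C < e & holder_bound omega r (fun x => B x - A x) C.
Proof.
move=> om rp fA fB.
have [HA [bA [tA [HA0 bA1 tA01 hA ubA]]]] := fiber_bunched_unif om rp fA.
have [HB [bB [tB [HB0 bB1 tB01 hB ubB]]]] := fiber_bunched_unif om rp fB.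
set S := [set opnorm (B x - A x) | x in [set: Sigma]].
have hS : has_ubound S.
  exists (bB + bA) => _ [x _ <-]; apply: le_trans (opnormB _ _) _.
  by apply: lerD; [exact: ub_norm ubB x|exact: ub_norm ubA x].
have hH : holder_bound omega r (fun x => B x - A x) (HB + HA).
  case: hA => _ hA; case: hB => _ hB; split; first by rewrite addr_ge0.
  move=> x y; have -> : B x - A x - (B y - A y) = (B x - B y) - (A x - A y).
    by apply/matrixP => i j; rewrite !mxE; ring.
  rewrite mulrDl; apply: le_trans (opnormB _ _) _; exact: lerD.
have c0 : 0 <= holder_const omega r (fun x => B x - A x).
  apply: lb_le_inf; first by exists (HB + HA).
  by move=> C [].
have s_le x : opnorm (B x - A x) <= sup S by apply: ub_le_sup => //; exists x.
split=> [x|e he].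
  by rewrite /Dr -/S; have := s_le x; move: (sup S) (holder_const _ _ _) c0 => s h ? ?; lra.
apply: holder_const_lt; first by exists (HB + HA).
(* For empty [Sigma] the supremum is [sup set0 = 0], which is still nonnegative. *)
have [[x _]|ne] := pselect (exists x : Sigma, True); last first.
  apply: le_lt_trans he; rewrite /Dr lerDr -/S.
  suff -> : S = set0 by rewrite sup0.
  by rewrite -subset0 => s [y _ _]; case: ne; exists y.
have h := le_trans (opnorm_ge0 _) (s_le x).
by apply: le_lt_trans he; rewrite /Dr lerDr.
Qed.

Lemma holder_bound0 (omega r : R) : @holder_bound a Q R k omega r (fun=> 0) 0.
Proof. by split=> // x y; rewrite subr0 opnorm0 mul0r. Qed.

Lemma good_family (omega r : R) A (A_ : nat -> Sigma -> 'M[R]_k) :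
  0 < omega < 1 -> 0 < r -> @topologically_mixing a Q R omega ->
  typical omega r A -> (forall l, fiber_bunched omega r (A_ l)) ->
  Dr omega r (A_ l) A @[l --> \oo] --> 0 ->
  exists (D c kappa : R) (K : nat), [/\ good_cocycle D c kappa K A,
    \forall l \near \oo, good_cocycle D c kappa K (A_ l) &
    forall w, lang Q w -> wnorm (A_ l) w @[l --> \oo] --> wnorm A w].
Proof.
move=> om rp mix tyA fb_ hD; have fA : fiber_bunched omega r A by case: tyA.
have [D [c [kappa [delta [g [K [d0 g0 near]]]]]]] := typical_good_near om rp mix tyA.
have hsup l := sup_le_Dr om rp fA (fb_ l).
have D0 l x : 0 <= Dr omega r (A_ l) A := le_trans (opnorm_ge0 _) ((hsup l).1 x).
have [GA gA] : good_cocycle D c kappa K A /\ forall x, opnorm (A x) <= g.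
  apply: near => [x|x|]; first by case: fA.
    by rewrite subrr opnorm0 ltW.
  exists 0 => //; rewrite (_ : (fun x => A x - A x) = fun=> 0); first exact: holder_bound0.
  by apply/funext => x; rewrite subrr.
have nearl : \forall l \near \oo,
    good_cocycle D c kappa K (A_ l) /\ forall x, opnorm (A_ l x) <= g.
  have h1 : \forall l \near \oo, Dr omega r (A_ l) A < Num.min delta 1.
    by apply: (cvgr_lt _ hD); rewrite lt_min d0 ltr01.
  apply: filterS h1 => l; rewrite lt_min => /andP[h1 h2].
  apply: near => [x|x|]; first by case: (fb_ l).
    exact: le_trans ((hsup l).1 x) (ltW h1).
  by have [C C1 hC] := (hsup l).2 1 h2; exists C => //; exact: ltW.
exists D, c, kappa, K; split=> //; first by apply: filterS nearl => l [].
move=> w Lw; have [x _] := langP Lw.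
set M := (size w)%:R * (1 + g) ^+ size w.
apply/cvgrPdist_lt => e e0.
have h : M * Dr omega r (A_ l) A @[l --> \oo] --> 0.
  by rewrite -(mulr0 M); apply: cvgM => //; exact: cvg_cst.
apply: filterS2 nearl (cvgr_lt _ h _ e0) => l [Gl gl] hl.
rewrite distrC; apply: le_lt_trans hl.
exact: (wnorm_diff GA Gl g0 gA gl (hsup l).1 (D0 l x) Lw).
Qed.

End GoodCocycle.

Lemma cvg_div_nat (R : realType) (f : nat -> R) (l C : R) :
  (forall n : nat, `|f n - n%:R * l| <= C) -> n%:R^-1 * f n @[n --> \oo] --> l.
Proof.
move=> hf; apply/cvgrPdist_le => e e0; have [N hN] := nat_above (C / e).
exists N.+1 => // n /= Nn; have n0 : 0 < n%:R :> R by rewrite ltr0n; lia.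
rewrite -(ler_pM2l n0) -{1}(gtr0_norm n0) -normrM mulrBr mulVKf ?gt_eqF// distrC.
apply: le_trans (hf n) _; rewrite -ler_pdivrMr//; apply: le_trans hN _.
by rewrite ler_nat ltnW.
Qed.

(** * Pressure and entropy *)

Section Bowen.
Context {a : nat} {Q : 'M[bool]_a} {R : realType} {omega : R}.
Hypothesis om : 0 < omega < 1.
Local Notation Sigma := (subshift Q).
Implicit Types (x y : Sigma).

Lemma sdist_le_bowen n x y (j : nat) : (j < n)%N ->
  sdist omega (shiftz j%:Z x) (shiftz j%:Z y) <= bowen_dist omega n x y.
Proof.
move=> jn; exact: (le_bigmax _ (fun j : 'I_n =>
  sdist omega (shiftz (j : nat)%:Z x) (shiftz (j : nat)%:Z y)) (Ordinal jn)).
Qed.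

Lemma bowen_dist_word n x y : bowen_dist omega n x y < 1 -> word_of x n = word_of y n.
Proof.
move=> h; apply/word_of_eq => i /andP[i0 inn].
have := le_lt_trans (@sdist_le_bowen n x y (absz i) ltac:(lia)) h.
rewrite -(expr0 omega) => /(agree_of_sdist om)/(_ 0 ltac:(lia)) /=.
by rewrite add0r (_ : `|i|%N%:Z = i)//; lia.
Qed.

(** The metric is two-sided, so closeness over [n] steps involves [m] further letters on each
    side. *)
Lemma bowen_dist_close n m x y :
  word_of (shiftz (- m%:Z) x) (n + (m + m)) = word_of (shiftz (- m%:Z) y) (n + (m + m)) ->
  bowen_dist omega n x y <= omega ^+ m.
Proof.
move=> h; have om0 : 0 <= omega by case/andP: om => /ltW.
apply: bigmax_le => [|j _]; first exact: exprn_ge0.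
apply: (sdist_agree om) => i im /=; have jn := ltn_ord j.
have := (word_of_eq _ _ _).2 h (i + (j : nat)%:Z + m%:Z) ltac:(lia).
by rewrite /= addrK.
Qed.

End Bowen.

Lemma sum_sub_seq (R : realType) (I : eqType) (s t : seq I) (F : I -> R) :
  uniq s -> uniq t -> {subset s <= t} -> (forall i, 0 <= F i) ->
  \sum_(i <- s) F i <= \sum_(i <- t) F i.
Proof.
move=> us ut st F0; rewrite [leRHS](bigID (fun i => i \in s)) /= -[leLHS]addr0.
rewrite lerD ?sumr_ge0// -[X in _ <= X]big_filter le_eqVlt; apply/orP; left; apply/eqP.
apply: perm_big; apply: uniq_perm => //; first by rewrite filter_uniq.
by move=> i; rewrite mem_filter; case: (boolP (i \in s)) => [/st ->|].
Qed.

Lemma sum_le_words (R : realType) (T : finType) (I : eqType) (s : seq I) (f : I -> seq T)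
    (F : seq T -> R) n :
  uniq s -> {in s &, injective f} -> (forall i, i \in s -> size (f i) = n) ->
  (forall w, 0 <= F w) -> \sum_(i <- s) F (f i) <= \sum_(w <- words n) F w.
Proof.
move=> us fi fs F0; rewrite -(big_map f xpredT F).
apply: sum_sub_seq => //; [by rewrite map_inj_in_uniq|exact: uniq_words|].
by move=> _ /mapP[i /fs si ->]; rewrite mem_words si.
Qed.

Lemma sum_middle (R : realType) (T : finType) (F : seq T -> R) n m :
  \sum_(w <- words (n + (m + m))) F (take n (drop m w)) =
  ((#|T| ^ m) ^ 2)%:R * \sum_(w <- words n) F w.
Proof.
rewrite addnCA big_words_cat.
under eq_big_seq => u /size_words su.
  rewrite big_words_cat.
  under eq_big_seq => v /size_words sv.
    under eq_bigr do rewrite drop_size_cat// take_size_cat//.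
    rewrite big_const_seq count_predT card_words iter_addr_0.
    over.
  over.
rewrite big_const_seq count_predT card_words iter_addr_0 /= sumrMnl -mulrnA mulnn.
by rewrite mulr_natl.
Qed.

Lemma word_of_middle a (Q : 'M[bool]_a) (x : subshift Q) n m :
  take n (drop m (word_of (shiftz (- m%:Z) x) (n + (m + m)))) = word_of x n.
Proof.
rewrite addnCA word_of_cat drop_size_cat ?size_word_of// shiftzD subrr shiftz0.
by rewrite word_of_cat take_size_cat ?size_word_of.
Qed.

Lemma esum_seq_le (R : realType) (T : choiceType) (S : set T) (f : T -> R) (M : R) :
  (forall s, uniq s -> (forall x, x \in s -> S x) -> \sum_(x <- s) f x <= M) ->
  (\esum_(x in S) (f x)%:E <= M%:E)%E.
Proof.
move=> h; apply: ge_ereal_sup => _ [X [fX XS] <-].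
rewrite fsbig_finite// sumEFin lee_fin; apply: h; first exact: finmap.fset_uniq.
by move=> x; rewrite in_fset_set// inE => /XS.
Qed.

Lemma seq_le_esum (R : realType) (T : choiceType) (S : set T) (f : T -> R) (s : seq T) :
  uniq s -> (forall x, x \in s -> S x) ->
  ((\sum_(x <- s) f x)%:E <= \esum_(x in S) (f x)%:E)%E.
Proof.
move=> us sS; apply: esum_ge; exists [set` s]; first by split=> //; exact: finite_seq.
by rewrite -fsbig_seq// sumEFin.
Qed.

(** * Pressure as the growth of sums over words *)

Section Pressure.
Context {a : nat} {Q : 'M[bool]_a} {R : realType} {k : nat} {omega : R}.
Hypothesis om : 0 < omega < 1.
Local Notation Sigma := (subshift Q).
Implicit Types (x y : Sigma).
Variables (D c kappa : R) (K : nat) (B : Sigma -> 'M[R]_k).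
Hypothesis GB : good_cocycle D c kappa K B.
Let HS := gc_qm GB.
Local Notation Z := (@qsum R 'I_a (lang Q) (wnorm B)).
Local Notation wt := (@qweight R 'I_a (lang Q) (wnorm B)).
Local Notation P := (@qpressure R 'I_a (lang Q) (wnorm B) D c K).

Lemma powR_cocycle q n x : 0 <= q ->
  opnorm (cocycle B n%:Z x) `^ q <= wt q (word_of x n).
Proof.
move=> q0; rewrite /qweight lang_word_of /=; have h0 := gc_gt0 GB x n.
rewrite /powR gt_eqF// ler_expR ler_wpM2l// ler_ln ?posrE//; first exact: gc_ge GB x n.
exact: lt_le_trans h0 (gc_ge GB x n).
Qed.

Lemma powR_cocycle_ge q n x : 0 <= q ->
  expR (- (q * ln kappa)) * wt q (word_of x n) <= opnorm (cocycle B n%:Z x) `^ q.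
Proof.
move=> q0; rewrite /qweight lang_word_of /=; have h0 := gc_gt0 GB x n.
have w0 := qm_gt0 HS (lang_word_of x n).
rewrite /powR gt_eqF// -expRD ler_expR -mulrN -mulrDr ler_wpM2l//.
rewrite addrC lerBlDr addrC -lnM ?posrE ?(gc_kappa GB)//.
by rewrite ler_ln ?posrE ?mulr_gt0 ?(gc_kappa GB)//; exact: gc_le GB x n.
Qed.

(** One point for each word of length [n] forms a separated set, since points with distinct words
    are at [bowen_dist] at least [1]. *)
Lemma pressure_sum_ge q n (e : R) : 0 <= q -> e < 1 ->
  ((expR (- (q * ln kappa)) * Z q n)%:E <= pressure_sum omega B q n e)%E.
Proof.
move=> q0 e1.
have [x0 _] := langP (qm_nil HS).
pose rep (w : seq 'I_a) : Sigma := xget x0 [set x | word_of x (size w) = w].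
have repP w : lang Q w -> word_of (rep w) (size w) = w.
  by move=> /langP h; exact: (xgetPex x0 h).
pose s := [seq rep w | w <- words n & lang Q w].
have us : uniq s.
  rewrite map_inj_in_uniq ?filter_uniq ?uniq_words// => w w'.
  rewrite !mem_filter => /andP[Lw /size_words sw] /andP[Lw' /size_words sw'] e0.
  by rewrite -(repP _ Lw) -(repP _ Lw') e0 sw sw'.
apply: (@le_trans _ _ (\esum_(x in [set` s]) (opnorm (cocycle B n%:Z x) `^ q)%:E)%E); last first.
  apply: ereal_sup_ubound; exists [set` s] => //= x y.
  move=> /mapP[w + ->] /mapP[w' + ->]; rewrite !mem_filter.
  move=> /andP[Lw /size_words sw] /andP[Lw' /size_words sw'] ne.
  apply: (lt_le_trans e1); rewrite leNgt; apply/negP => /(bowen_dist_word om) h.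
  by apply: ne; rewrite -(repP _ Lw) -(repP _ Lw') sw sw' h.
apply: (le_trans _ (seq_le_esum _ us (fun _ h => h))); rewrite lee_fin.
rewrite /s big_map big_filter /qsum mulr_sumr [leLHS](bigID (lang Q)) /=.
rewrite [X in _ + X]big1 ?addr0; last first.
  by move=> w /negbTE Lw; rewrite /qweight Lw mulr0.
rewrite big_seq_cond [leRHS]big_seq_cond; apply: ler_sum => w /andP[/size_words sw Lw].
have {1}-> : w = word_of (rep w) n by rewrite -[in RHS]sw repP.
exact: powR_cocycle_ge.
Qed.

(** A separated set injects into the words with margins of [m] letters; forgetting the margins costs
    a factor independent of [n]. *)
Lemma pressure_sum_le q n m (e : R) : 0 <= q -> omega ^+ m < e ->
  (pressure_sum omega B q n e <= (((#|'I_a| ^ m) ^ 2)%:R * Z q n)%:E)%E.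
Proof.
move=> q0 me; apply: ge_ereal_sup => _ [E /= sepE <-].
apply: esum_seq_le => s us sE.
pose f (x : Sigma) := word_of (shiftz (- m%:Z) x) (n + (m + m)).
have fi : {in s &, injective f}.
  move=> x y xs ys fxy; apply: contrapT => xy.
  have := sepE _ _ (sE _ xs) (sE _ ys) xy; apply/negP; rewrite -leNgt.
  exact: le_trans (bowen_dist_close om fxy) (ltW me).
have le1 : \sum_(x <- s) opnorm (cocycle B n%:Z x) `^ q <=
    \sum_(x <- s) wt q (take n (drop m (f x))).
  by apply: ler_sum => x _; rewrite word_of_middle; exact: powR_cocycle.
apply: (le_trans le1).
rewrite -(sum_middle (wt q)).
apply: (sum_le_words (F := fun w => wt q (take n (drop m w))) us fi).
- by move=> x _; rewrite size_word_of.
- by move=> w; exact: qweight_ge0.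
Qed.

(** Both bounds differ from [qsum] by factors independent of [n], so every scale below [1] gives the
    same limit, and the limit in [e] becomes that of a constant. *)
Lemma ln_pressure_sum_cvg q (e : R) : 0 <= q -> 0 < e < 1 ->
  ((n%:R^-1)%:E * lne (pressure_sum omega B q n e))%E @[n --> \oo] --> (P q)%:E.
Proof.
move=> q0 /andP[e0 e1]; have [m hm] := omega_small om e0.
pose M : R := ((#|'I_a| ^ m) ^ 2)%:R.
have M0 : 0 < M by rewrite ltr0n !expn_gt0 (card_alphabet_gt0 HS).
pose C := `|ln M| + `|q * ln kappa| + @qerr R 'I_a D c K q.
have main n : exists2 r : R, pressure_sum omega B q n e = (expR r)%:E & `|r - n%:R * P q| <= C.
  have lo := pressure_sum_ge n q0 e1; have up := pressure_sum_le n q0 hm.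
  have z0 := qsum_gt0 HS q n; have zP := qpressureP HS n q0.
  have [s hs] : exists s, pressure_sum omega B q n e = s%:E.
    move: lo up; case: (pressure_sum _ _ _ _ _) => [s _ _|_|]; first by exists s.
      by rewrite leye_eq.
    by rewrite leeNy_eq.
  move: lo up; rewrite hs !lee_fin => lo up.
  have s0 : 0 < s by apply: lt_le_trans lo; rewrite mulr_gt0 ?expR_gt0.
  exists (ln s); first by rewrite lnK ?posrE.
  move: lo up; rewrite -ler_ln ?posrE// ?mulr_gt0 ?expR_gt0// lnM ?posrE ?expR_gt0// expRK.
  rewrite -[s <= _]ler_ln ?posrE// ?mulr_gt0// lnM ?posrE// -/M.
  rewrite /C; move: zP (ler_norm (ln M)) (ler_norm (q * ln kappa)) (ler_norm (- (q * ln kappa))).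
  move: (normr_ge0 (ln M)); rewrite normrN.
  move: (n%:R * P q) (qerr q) (ln (Z q n)) (ln s) (ln M) (q * ln kappa) `|ln M| `|q * ln kappa|.
  clear; move=> x1 x2 x3 x4 x5 x6 x7 x8 h1; rewrite !ler_norml.
  move=> /andP[h2 h3] h4 h5 h6 h7 h8; apply/andP; split; lra.
have [rr hr] := choice (fun n => let: ex_intro2 r h1 h2 := main n in
  ex_intro (fun r => _ /\ _) r (conj h1 h2)).
have -> : (fun n => ((n%:R^-1)%:E * lne (pressure_sum omega B q n e))%E) =
    (fun n => (n%:R^-1 * rr n)%:E).
  apply/funext => n; rewrite (hr n).1 lne_EFin ?expR_gt0// expRK; exact: EFinM.
apply: cvg_EFin; first by apply: nearW.
exact: cvg_div_nat (fun n => (hr n).2).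
Qed.

Lemma pressureE q : 0 <= q -> pressure omega B q = P q.
Proof.
move=> q0; rewrite /pressure /pressure_ereal.
suff -> : lim (limn_esup (fun n : nat =>
    (n%:R^-1)%:E * lne (pressure_sum omega B q n e))%E @[e --> 0^'+]) = (P q)%:E by [].
apply: cvg_lim => //.
have h : \forall e \near 0^'+, limn_esup (fun n : nat =>
    ((n%:R^-1)%:E * lne (pressure_sum omega B q n e))%E) = (P q)%:E.
  near=> e; have e01 : 0 < e < 1.
    by apply/andP; split; near: e; [exact: nbhs_right_gt|exact: nbhs_right_lt].
  exact: (cvg_limn_einf_sup (ln_pressure_sum_cvg q0 e01)).2.
exact: cvg_near_cst.
Unshelve. all: by end_near.
Qed.

End Pressure.

(** * Bowen entropy by covers *)

Section TopologicalEntropy.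
Context {a : nat} {Q : 'M[bool]_a} {R : realType} {omega : R}.
Local Notation Sigma := (subshift Q).
Implicit Types (x y : Sigma) (Y : set Sigma).

Lemma bowen_sum_N_ge0 Y s N (e : R) : (0 <= bowen_sum_N omega Y s N e)%E.
Proof.
apply: le_ereal_inf_tmp => _ [D [n [x [_ ->]]]].
by apply: esum_ge0 => i _; rewrite lee_fin expR_ge0.
Qed.

Lemma bowen_sum_sup Y s (e : R) :
  bowen_sum omega Y s e = ereal_sup (range (fun N => bowen_sum_N omega Y s N e)).
Proof.
apply: cvg_lim => //; apply: ereal_nondecreasing_cvgn => N N' NN'.
apply: ereal_inf_le_tmp => _ [D [n [x [[nN cov] ->]]]].
by exists D, n, x; split=> //; split=> // i Di; exact: leq_trans NN' (nN i Di).
Qed.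

Lemma bowen_sum_eq0 Y s (e : R) : bowen_sum omega Y s e = 0%E <->
  forall N (eta : R), 0 < eta -> exists D n (x : nat -> Sigma), bowen_cover omega Y N e D n x /\
    (\esum_(i in D) (expR (- s * (n i)%:R))%:E <= eta%:E)%E.
Proof.
rewrite bowen_sum_sup; split=> [h N eta eta0|h].
  have h0 : (bowen_sum_N omega Y s N e < eta%:E)%E.
    apply: le_lt_trans (_ : 0 < _)%E; last by rewrite lte_fin.
    by rewrite -h; apply: ereal_sup_ubound; exists N.
  have [_ [D [n [x [cov ->]]]] hlt] := ereal_inf_lt h0.
  by exists D, n, x; split => //; exact: ltW.
apply/eqP; rewrite eq_le; apply/andP; split; last first.
  by apply: le_trans (bowen_sum_N_ge0 Y s 0 e) _; apply: ereal_sup_ubound; exists 0%N.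
apply: ge_ereal_sup => _ [N _ <-]; apply/lee_addgt0Pr => eta eta0; rewrite add0e.
have [D [n [x [cov hle]]]] := h N eta eta0.
by apply: ge_ereal_inf; exists (\esum_(i in D) (expR (- s * (n i)%:R))%:E)%E => //; exists D, n, x.
Qed.

Lemma htop_eps_noninc Y (e e' : R) : e <= e' ->
  (htop_eps omega Y e' <= htop_eps omega Y e)%E.
Proof.
move=> ee'; apply: ereal_inf_le_tmp => _ [s /= hs <-]; exists s => //.
apply/bowen_sum_eq0 => N eta eta0; have [D [n [x [[nN cov] hle]]]] := (bowen_sum_eq0 _ _ _).1 hs N eta eta0.
exists D, n, x; split=> //; split=> // y /cov[i Di hi]; exists i => //.
exact: lt_le_trans hi ee'.
Qed.

Lemma htop_sup Y : htop omega Y = ereal_sup (htop_eps omega Y @` [set` `]0, 1[]).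
Proof.
apply: cvg_lim => //; apply: nonincreasing_at_right_cvge; first by rewrite bnd_simp.
by move=> e e' _ _ ee'; exact: htop_eps_noninc.
Qed.

Lemma htop_le Y (h : R) :
  (forall e s : R, 0 < e < 1 -> h < s -> forall N (eta : R), 0 < eta ->
    exists D n (x : nat -> Sigma), bowen_cover omega Y N e D n x /\
    (\esum_(i in D) (expR (- s * (n i)%:R))%:E <= eta%:E)%E) ->
  (htop omega Y <= h%:E)%E.
Proof.
move=> hc; rewrite htop_sup; apply: ge_ereal_sup => _ [e /= e01 <-].
apply/lee_addgt0Pr => d d0; rewrite -EFinD; apply: ge_ereal_inf; exists (h + d)%:E => //.
exists (h + d) => //; apply/bowen_sum_eq0; apply: hc; last by rewrite ltrDl.
by move: e01; rewrite in_itv.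
Qed.

(** [htop_eps] does not increase with the scale, so a lower bound at a single scale is enough. *)
Lemma htop_ge Y (h e : R) : 0 < e < 1 ->
  (forall s : R, s < h -> exists N (eta : R), 0 < eta /\
    forall D n (x : nat -> Sigma), bowen_cover omega Y N e D n x ->
    (eta%:E <= \esum_(i in D) (expR (- s * (n i)%:R))%:E)%E) ->
  (h%:E <= htop omega Y)%E.
Proof.
move=> e01 hc; rewrite htop_sup.
apply: (@le_trans _ _ (htop_eps omega Y e)); last first.
  by apply: ereal_sup_ubound; exists e => //=; rewrite in_itv.
apply: le_ereal_inf_tmp => _ [s /= hs <-]; rewrite lee_fin leNgt; apply/negP => sh.
have [N [eta [eta0 hN]]] := hc s sh.
have e20 : 0 < eta / 2 by rewrite divr_gt0.
have [D [n [x [cov hle]]]] := (bowen_sum_eq0 _ _ _).1 hs N (eta / 2) e20.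
have := le_trans (hN D n x cov) hle; rewrite lee_fin => h1.
by clear -eta0 h1; lra.
Qed.

End TopologicalEntropy.

Lemma geometric_tail (R : realType) (x : R) N n : 0 <= x < 1 ->
  \sum_(i <- iota N n) x ^+ i <= x ^+ N * (1 - x)^-1.
Proof.
move=> /andP[x0 x1]; have d0 : 0 < 1 - x by rewrite subr_gt0.
rewrite ler_pdivlMr// mulrC.
have -> : (1 - x) * \sum_(i <- iota N n) x ^+ i = x ^+ N - x ^+ (N + n).
  elim: n N => [|n IH] N /=; first by rewrite big_nil addn0 mulr0 subrr.
  by rewrite big_cons mulrDr IH addSnnS exprS; ring.
by rewrite gerBl exprn_ge0.
Qed.

(** * Upper bound for the entropy of level sets *)

Section EntropyUpper.
Context {a : nat} {Q : 'M[bool]_a} {R : realType} {k : nat} {omega : R}.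
Hypothesis om : 0 < omega < 1.
Local Notation Sigma := (subshift Q).
Implicit Types (x y : Sigma).
Variables (D c kappa : R) (K : nat) (B : Sigma -> 'M[R]_k).
Hypothesis GB : good_cocycle D c kappa K B.
Let HS := gc_qm GB.
Local Notation wt := (@qweight R 'I_a (lang Q) (wnorm B)).
Local Notation P := (@qpressure R 'I_a (lang Q) (wnorm B) D c K).

(** Markov inequality: the middle of each of these words contributes at least [expR (q * (n * b))]
    to [qsum]; the margins cost a constant factor. *)
Lemma heavy_words_sum q b m n : 0 <= q ->
  \sum_(w <- words (n + (m + m)) | lang Q w &&
      (n%:R * b <= ln (wnorm B (take n (drop m w))))) (1 : R) <=
  ((#|'I_a| ^ m) ^ 2)%:R * expR (n%:R * P q + @qerr R 'I_a D c K q - q * (n%:R * b)).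
Proof.
move=> q0; rewrite expRD mulrA -ler_pdivrMr ?expR_gt0// -expRN opprK.
apply: (@le_trans _ _ (\sum_(w <- words (n + (m + m))) wt q (take n (drop m w)))).
  rewrite mulr_suml [leRHS](bigID (fun w => lang Q w &&
    (n%:R * b <= ln (wnorm B (take n (drop m w)))))) /= -[leLHS]addr0.
  apply: lerD; last by apply: sumr_ge0 => w _; exact: qweight_ge0.
  rewrite big_seq_cond [leRHS]big_seq_cond; apply: ler_sum.
  move=> w /andP[/size_words sw /andP[Lw hw]].
  have Lm : lang Q (take n (drop m w)).
    move: Lw; rewrite -[w in lang Q w](cat_take_drop m) => /lang_catr.
    by rewrite -{1}(cat_take_drop n (drop m w)) => /lang_catl.
  by rewrite mul1r /qweight Lm ler_expR ler_wpM2l.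
rewrite sum_middle ler_wpM2l ?ler0n//.
exact: qsum_upper.
Qed.

Lemma htop_level_le q alpha : 0 < q ->
  (htop omega (level_set B alpha) <= (P q - q * alpha)%:E)%E.
Proof.
move=> q0; apply: htop_le => e s /andP[e0 e1] hs N eta eta0.
have [m hm] := omega_small om e0.
(* The excess of [s] is split in two: one half pays for lowering [alpha] to [b = alpha - gam / q],
   the other gives the geometric decay [x = expR (- gam)]. *)
have [gam egam] : exists g, g = (s - (P q - q * alpha)) / 2 by eexists.
have gam0 : 0 < gam by rewrite egam divr_gt0// subr_gt0.
have [b eb] : exists b, b = alpha - gam / q by eexists.
have [x ex] : exists x : R, x = expR (- gam) by eexists.
have x01 : 0 <= x < 1 by rewrite ex expR_ge0 /= expR_lt1 oppr_lt0.
pose cond n w := lang Q w && (n%:R * b <= ln (wnorm B (take n (drop m w)))).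
pose C : R := ((#|'I_a| ^ m) ^ 2)%:R * expR (@qerr R 'I_a D c K q).
have C0 : 0 < C by rewrite mulr_gt0 ?expR_gt0// ltr0n !expn_gt0 (card_alphabet_gt0 HS).
have key n : \sum_(w <- words (n + (m + m)) | cond n w) expR (- s * n%:R) <= C * x ^+ n.
  rewrite -(mulr1 (expR (- s * n%:R))) -mulr_sumr.
  apply: (le_trans (ler_wpM2l (expR_ge0 _) (heavy_words_sum b m n (ltW q0)))).
  rewrite mulrCA /C -mulrA ler_wpM2l// -expRD ex -expRM_natr -expRD ler_expR.
  have hq : q * b = q * alpha - gam by rewrite eb mulrBr mulrCA divff ?gt_eqF// mulr1.
  rewrite [q * (n%:R * b)]mulrCA hq egam.
  rewrite le_eqVlt; apply/orP; left; apply/eqP; by field.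
have e20 : 0 < eta * (1 - x) / C by rewrite !mulr_gt0 ?invr_gt0// subr_gt0; case/andP: x01.
have [N0 hN0] := small_power x01 e20.
pose N1 := maxn N N0.
have [x0 _] := langP (qm_nil HS).
pose rep (w : seq 'I_a) : Sigma := xget x0 [set x | word_of x (size w) = w].
have repP w : lang Q w -> word_of (rep w) (size w) = w.
  by move=> /langP h; exact: (xgetPex x0 h).
(* Pairs of a length and a word are numbered through [pickle], since covers are indexed by natural
   numbers; the condition [i = pickle (dec i)] in [Di] makes [dec] injective there. *)
pose dec i : nat * seq 'I_a := odflt (0%N, [::]) (unpickle i).
pose good (p : nat * seq 'I_a) := [&& N1 <= p.1, p.2 \in words (p.1 + (m + m)) & cond p.1 p.2]%N.
pose Di := [set i | i = pickle (dec i) /\ good (dec i)].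
exists Di, (fun i => (dec i).1), (fun i => shiftz m%:Z (rep (dec i).2)); split; first split.
- by move=> i [_ /and3P[h _ _]]; exact: leq_trans (leq_maxl _ _) h.
- move=> y /= hy.
  have [n [/= n0 Nn hn]] : exists n : nat,
      [/\ (0 < n)%N, (N1 <= n)%N & b < n%:R^-1 * ln (opnorm (cocycle_pos B n y))].
    have hb : b < alpha by rewrite eb gtrBl divr_gt0.
    have [n0 _ h] := cvgr_gt _ hy _ hb.
    exists (maxn n0 N1.+1); split; last by apply: h => /=; exact: leq_maxl.
      by rewrite leq_max orbT.
    by rewrite leq_max leqnSn orbT.
  pose w := word_of (shiftz (- m%:Z) y) (n + (m + m)).
  have gw : good (n, w).
    rewrite /good /= Nn mem_words size_word_of eqxx /cond lang_word_of word_of_middle /=.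
    have o0 := gc_gt0 GB y n.
    apply: (@le_trans _ _ (ln (opnorm (cocycle_pos B n y)))).
      by rewrite -(ler_pM2l (_ : 0 < n%:R^-1)) ?invr_gt0 ?ltr0n// mulKf ?(ltW hn)// pnatr_eq0 -lt0n.
    by rewrite ler_ln ?posrE// ?(lt_le_trans o0) ?(gc_ge GB).
  exists (pickle (n, w)); rewrite /= /Di /dec /= pickleK //=.
  apply: le_lt_trans hm; apply: (bowen_dist_close om).
  rewrite shiftzD addrC subrr shiftz0.
  by have := repP _ (lang_word_of (shiftz (- m%:Z) y) (n + (m + m))); rewrite size_word_of.
apply: esum_seq_le => l ul hl.
pose F (p : nat * seq 'I_a) := expR (- s * p.1%:R).
pose L := (\max_(i <- l) (dec i).1).+1.
pose t := [seq (n, w) | n <- iota N1 L, w <- [seq w <- words (n + (m + m)) | cond n w]].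
apply: (@le_trans _ _ (\sum_(p <- t) F p)).
  rewrite -(big_map dec xpredT F); apply: sum_sub_seq.
  - rewrite map_inj_in_uniq// => i j /hl[-> _] /hl[-> _]; rewrite /dec !pickleK /=.
    by move=> ->.
  - apply: allpairs_uniq_dep; first exact: iota_uniq.
      by move=> n _; rewrite filter_uniq// uniq_words.
    by move=> [n w] [n' w'] _ _ /= [-> ->].
  - move=> _ /mapP[i il ->]; have [_ /and3P[h1 h2 h3]] := hl i il.
    rewrite [dec i]surjective_pairing; apply/allpairsPdep.
    exists (dec i).1, (dec i).2; split=> //; last by rewrite mem_filter h3.
    rewrite mem_iota h1 /= /L addnS ltnS; apply: leq_trans (leq_addl _ _).
    exact: (@leq_bigmax_seq _ l xpredT (fun i => (dec i).1) i il isT).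
  - by move=> p; exact: expR_ge0.
rewrite big_allpairs_dep.
apply: (@le_trans _ _ (\sum_(n <- iota N1 L) C * x ^+ n)).
  by apply: ler_sum => n _; rewrite big_filter; exact: key.
rewrite -mulr_sumr mulrC; apply: (le_trans (ler_wpM2r (ltW C0) (geometric_tail N1 L x01))).
have := hN0 N1 (leq_maxr _ _).
have d0 : 0 < 1 - x by rewrite subr_gt0; case/andP: x01.
by rewrite ler_pdivlMr// -ler_pdivrMr// mulrAC.
Qed.

End EntropyUpper.

(** * Lower bound for the entropy of level sets *)

Section DependentChoice.
Context {R : realType}.

Lemma exists_seq_step (X Y : Type) (x0 : X) (step : X -> Y -> X) (P : nat -> X -> Prop)
    (S : nat -> Y -> Prop) :
  P 0 x0 -> (forall n x, P n x -> exists2 y, S n y & P n.+1 (step x y)) ->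
  exists u : nat -> X, u 0%N = x0 /\
    forall n, P n (u n) /\ exists2 y, S n y & u n.+1 = step (u n) y.
Proof.
move=> P0 hP; have [y0 _ _] := hP _ _ P0.
have h1 (p : nat * X) : exists y, P p.1 p.2 -> S p.1 y /\ P p.1.+1 (step p.2 y).
  have [h|h] := pselect (P p.1 p.2); last by exists y0.
  by have [y h1 h2] := hP _ _ h; exists y.
have [f hf] := choice h1.
pose u := fix u n := if n is m.+1 then step (u m) (f (m, u m)) else x0.
have Pu n : P n (u n) by elim: n => [//|n IH] /=; exact: (hf (n, u n) IH).2.
by exists u; split=> // n; split=> //; exists (f (n, u n)); first exact: (hf (n, u n) (Pu n)).1.
Qed.

Lemma exists_le_of_sum (I : eqType) (s : seq I) (G : I -> \bar R) (X : \bar R) :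
  s != [::] -> X \is a fin_num -> (\sum_(v <- s) G v <= \sum_(v <- s) X)%E ->
  exists2 v, v \in s & (G v <= X)%E.
Proof.
move=> s0 fX hs; apply: contrapT => hn.
have lt1 v : v \in s -> (X < G v)%E.
  by move=> vs; rewrite ltNge; apply/negP => h; apply: hn; exists v.
move: hs; apply/negP; rewrite -ltNge.
case: s s0 lt1 {hn} => // v0 s _; elim: s v0 => [|v s IH] v0 lt1.
  by rewrite !big_seq1; apply: lt1; rewrite mem_head.
rewrite big_cons [ltRHS]big_cons; apply: lteD; first by apply: lt1; rewrite mem_head.
by apply: IH => w ws; apply: lt1; rewrite in_cons ws orbT.
Qed.

Lemma sum_bounded_above (f : nat -> R) :
  (exists n1, forall n, (n1 <= n)%N -> f n <= 0) ->
  exists M, forall n, \sum_(j < n) f j <= M.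
Proof.
move=> [n1 h]; exists (\sum_(j < n1) `|f j|) => n.
have [nn|nn] := leqP n1 n.
  rewrite -(subnKC nn) big_split_ord /= -[leRHS]addr0; apply: lerD.
    by apply: ler_sum => j _; exact: ler_norm.
  by apply: sumr_le0 => j _; apply: h; exact: leq_addr.
rewrite -(subnKC (ltnW nn)) big_split_ord /= -[leLHS]addr0; apply: lerD.
  by apply: ler_sum => j _; exact: ler_norm.
by apply: sumr_ge0.
Qed.

(** The threshold [M i] of each precision is arbitrary, so at length [n] the largest [i < n] with
    [M i <= n] is used: it tends to infinity and is eventually admissible. *)
Lemma diagonal_parameter (P : nat -> nat -> Prop) :
  (forall i, exists n0, forall n, (n0 <= n)%N -> P i n) ->
  exists f : nat -> nat, (forall i, exists n1, forall n, (n1 <= n)%N -> (i <= f n)%N) /\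
    exists n1, forall n, (n1 <= n)%N -> P (f n) n.
Proof.
move=> h; have [M hM] := choice h.
pose f n := (\max_(i < n | (M i <= n)%N) i)%N.
exists f; split.
  move=> i; exists (maxn i.+1 (M i)) => n; rewrite geq_max => /andP[i_n Mn].
  exact: (@leq_bigmax_cond _ (fun j : 'I_n => (M j <= n)%N) (fun j : 'I_n => nat_of_ord j)
    (Ordinal i_n)).
exists (maxn 1 (M 0%N)) => n; rewrite geq_max => /andP[n0 Mn].
have c0 : (0 < #|[pred i : 'I_n | (M i <= n)%N]|)%N.
  by apply/card_gt0P; exists (Ordinal n0).
have [i + e] := eq_bigmax_cond (fun i : 'I_n => nat_of_ord i) c0.
by rewrite /f e => hi; apply: hM.
Qed.

End DependentChoice.

Lemma norm_dist4 (R : realType) (x u v y z w e1 e2 e3 e4 : R) :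
  `|x - u - v| <= e1 -> `|u - y| <= e2 -> `|v - z| <= e3 -> `|w| <= e4 ->
  `|x - (y + (z + w))| <= e1 + e2 + e3 + e4.
Proof.
rewrite !ler_norml => /andP[? ?] /andP[? ?] /andP[? ?] /andP[? ?].
by apply/andP; split; lra.
Qed.

(** * Moran sets of concatenated words *)

Section Moran.
Context {R : realType} {T : finType}.
Context {L : pred (seq T)} {N : seq T -> R} {D c : R} {K : nat}.
Hypothesis HS : qm_system L N D c K.
Variables (alpha h : R) (eps : nat -> R) (W : nat -> seq (seq T)) (j0 : nat).

(** Lengths grow by one: blocks become long against the connecting words, yet stay short against the
    time already elapsed. *)
Let l j := (j0 + j).+1.

Hypothesis hW : forall j w, w \in W j ->
  [/\ size w = l j, L w & `|ln (N w) - (l j)%:R * alpha| <= eps j * (l j)%:R].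
Hypothesis uW : forall j, uniq (W j).
Hypothesis cW : forall j, expR ((l j)%:R * (h - eps j)) <= (size (W j))%:R.
Hypothesis eps0 : forall e : R, 0 < e -> exists n1, forall n, (n1 <= n)%N -> eps n <= e.

Definition block_time j := (\sum_(i < j) (l i + K))%N.

Lemma block_timeS j : block_time j.+1 = (block_time j + (l j + K))%N.
Proof. by rewrite /block_time big_ord_recr. Qed.

Lemma block_time_le i j : (i <= j)%N -> (block_time i <= block_time j)%N.
Proof.
move=> ij; rewrite -(subnKC ij); elim: (j - i)%N => [|d IH]; first by rewrite addn0.
by rewrite addnS block_timeS; apply: leq_trans IH _; exact: leq_addr.
Qed.

Lemma block_level n : exists j, (block_time j <= n < block_time j.+1)%N.
Proof.
have ge j : (j <= block_time j)%N.
  by elim: j => // j IH; rewrite block_timeS /l; lia.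
elim: n => [|n [j /andP[h1 h2]]].
  by exists 0%N; rewrite block_timeS /l /block_time big_ord0; lia.
have [h3|h3] := leqP (block_time j.+1) n.+1.
  by exists j.+1; rewrite h3 block_timeS /l; lia.
by exists j; rewrite h3; lia.
Qed.

(** As [eps i] becomes small and [l i] grows, all but finitely many terms are at most [d * l i]. *)
Lemma block_error (C d : R) : 0 < d ->
  exists M, forall j, \sum_(i < j) (eps i * (l i)%:R + C) <= d * (\sum_(i < j) (l i)%:R) + M.
Proof.
move=> d0; have [|M hM] := @sum_bounded_above R (fun i => eps i * (l i)%:R + C - d * (l i)%:R).
  have d20 : 0 < d / 2 by rewrite divr_gt0.
  have [n1 hn1] := eps0 d20; have [n2 hn2] := nat_above (C / (d / 2)).
  exists (maxn n1 n2) => n; rewrite geq_max => /andP[h1 h2].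
  have l0 : 0 <= (l n)%:R :> R by rewrite ler0n.
  have h3 : C <= d / 2 * (l n)%:R.
    rewrite -ler_pdivrMl// mulrC; apply: le_trans hn2 _; rewrite ler_nat /l; lia.
  have h4 := ler_wpM2r l0 (hn1 n h1).
  have -> : d * (l n)%:R = d / 2 * (l n)%:R + d / 2 * (l n)%:R by field.
  by rewrite subr_le0; exact: lerD.
exists M => j; have := hM j.
by rewrite sumrB -mulr_sumr lerBlDl.
Qed.

(** Joins have a fixed total length, so the time after [j] blocks does not depend on the blocks
    chosen. *)
Lemma join_step : exists step : seq T -> seq T -> seq T, forall u v, L u -> L v ->
  exists s r, [/\ (size s <= K)%N, (size s + size r = K)%N, step u v = u ++ s ++ v ++ r,
    L (step u v) & `|ln (N (step u v)) - ln (N u) - ln (N v)| <= D * K%:R + `|D * K%:R - ln c|].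
Proof.
have h1 (p : seq T * seq T) : exists t, L p.1 -> L p.2 -> exists s r,
   [/\ (size s <= K)%N, (size s + size r = K)%N, t = p.1 ++ s ++ p.2 ++ r,
    L t & `|ln (N t) - ln (N p.1) - ln (N p.2)| <= D * K%:R + `|D * K%:R - ln c|].
  case: p => u v /=.
  have [/andP[Lu Lv]|/negP nL] := boolP (L u && L v); last first.
    by exists [::] => Lu Lv; case: nL; rewrite Lu.
  have [s [r [sK srK Lt hN]]] := join_right HS Lu Lv.
  exists (u ++ s ++ v ++ r) => _ _; exists s, r; split=> //.
  have L1 := qm_factr HS Lt; have L2 := qm_factr HS L1.
  have b1 := lnN_cat HS Lt; have b2 := lnN_cat HS L1; have b3 := lnN_cat HS L2.
  have b4 := lnN_le HS (qm_factl HS L1); have b5 := lnN_le HS (qm_factr HS L2).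
  have eK : D * K%:R = D * (size s)%:R + D * (size r)%:R by rewrite -mulrDr -natrD srK.
  move: hN b1 b2 b3 b4 b5 eK (ler_norm (D * K%:R - ln c)) (mulr_ge0 (qm_D HS) (ler0n R K))
    (normr_ge0 (D * K%:R - ln c)).
  move: (ln (N (u ++ s ++ v ++ r))) (ln (N u)) (ln (N v)) (ln (N (s ++ v ++ r))).
  move: (ln (N (v ++ r))) (ln (N s)) (ln (N r)) (D * (size s)%:R) (D * (size r)%:R) (D * K%:R) (ln c) `|D * K%:R - ln c|.
  move=> x1 x2 x3 x4 x5 x6 x7 x8 x9 x10 x11 x12 h1 h2 h3 h4 h5 h6 h7 h8 h9 h10.
  by clear -h1 h2 h3 h4 h5 h6 h7 h8 h9 h10; rewrite ler_norml; apply/andP; split; lra.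
have [f hf] := choice h1.
by exists (fun u v => f (u, v)) => u v; exact: (hf (u, v)).
Qed.

(** One of the two words is a prefix of the other. *)
Definition prefix_compat (u w : seq T) : bool := take (size w) u == take (size u) w.

Lemma prefix_compat_cat u w t : (size u <= size w)%N ->
  prefix_compat u (w ++ t) = prefix_compat u w.
Proof.
move=> uw; have e1 : take (size (w ++ t)) u = u.
  by rewrite take_oversize// size_cat (leq_trans uw)// leq_addr.
by rewrite /prefix_compat e1 takel_cat// [take (size w) u]take_oversize.
Qed.

Lemma prefix_compat_self u v : (size v <= size u)%N ->
  prefix_compat u v = (take (size v) u == v).
Proof. by move=> vu; rewrite /prefix_compat [take (size u) v]take_oversize. Qed.

Variable step : seq T -> seq T -> seq T.
Hypothesis stepP : forall u v, L u -> L v -> exists s r,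
  [/\ (size s <= K)%N, (size s + size r = K)%N, step u v = u ++ s ++ v ++ r,
    L (step u v) & `|ln (N (step u v)) - ln (N u) - ln (N v)| <= D * K%:R + `|D * K%:R - ln c|].

Lemma size_step j u v : L u -> v \in W j -> size (step u v) = (size u + (l j + K))%N.
Proof.
move=> Lu /hW[sv Lv _]; have [s [r [_ sr -> _ _]]] := stepP Lu Lv.
by rewrite !size_cat sv -sr; lia.
Qed.

Lemma L_step j u v : L u -> v \in W j -> L (step u v).
Proof. by move=> Lu /hW[_ Lv _]; have [s [r [_ _ _ ? _]]] := stepP Lu Lv. Qed.

(* Given the length of the connecting word, [t] determines the block [v]; hence
   the factor [K.+1]. *)
Lemma count_compat_step j u t : L u -> (size u + (l j + K) <= size t)%N ->
  (\sum_(v <- W j) prefix_compat t (step u v) <= K.+1 * prefix_compat t u)%N.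
Proof.
move=> Lu st; have [hu|hu] := boolP (prefix_compat t u); last first.
  rewrite muln0 leqn0 big1_seq// => v /= vW; apply/eqP; rewrite eqb0.
  have s1 : (size (step u v) <= size t)%N by rewrite (size_step Lu vW).
  have s2 : (size u <= size t)%N := leq_trans (leq_addr _ _) st.
  apply: contra hu; rewrite (prefix_compat_self s1) (prefix_compat_self s2).
  have [_ Lv _] := hW vW; have [s [r [_ _ -> _ _]]] := stepP Lu Lv.
  move=> /eqP e; rewrite -[in X in _ == X](take_size_cat (s ++ v ++ r) (erefl (size u))) -e.
  by rewrite take_takel// size_cat leq_addr.
rewrite muln1 -big_mkcond /= sum1_count -size_filter.
apply: (@leq_trans (size [seq take (l j) (drop (size u + i) t) | i <- iota 0 K.+1])).
  apply: uniq_leq_size; first by rewrite filter_uniq.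
  move=> v; rewrite mem_filter => /andP[+ vW].
  have s1 : (size (step u v) <= size t)%N by rewrite (size_step Lu vW).
  rewrite (prefix_compat_self s1); have [sv Lv _] := hW vW; have [s [r [sK sr es _ _]]] := stepP Lu Lv.
  rewrite es => /eqP e; apply/mapP; exists (size s); first by rewrite mem_iota ltnS.
  have -> : t = (u ++ s ++ v ++ r) ++ drop (size (u ++ s ++ v ++ r)) t.
    by rewrite -[in LHS](cat_take_drop (size (u ++ s ++ v ++ r)) t) e.
  by rewrite -!catA catA drop_size_cat ?size_cat// take_size_cat.
by rewrite size_map size_iota.
Qed.

(* [block_mass j] bounds the probability that [j] uniformly drawn blocks produce a
   given prefix.  For a word [t] of level [m], [hit_mass] is then a supermartingale
   in [j], equal to [wt / block_mass m] once [t] has been followed up to its end; so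
   some sequence of blocks follows no word of a family of small total weight. *)
Definition block_mass j : R := \prod_(i < j) (K.+1%:R / (size (W i))%:R).

Lemma size_W_gt0 j : 0 < (size (W j))%:R :> R.
Proof. exact: lt_le_trans (expR_gt0 _) (cW j). Qed.

Lemma block_mass_gt0 j : 0 < block_mass j.
Proof. by apply: prodr_gt0 => i _; rewrite divr_gt0 ?size_W_gt0. Qed.

Lemma block_massS j : block_mass j.+1 = block_mass j * (K.+1%:R / (size (W j))%:R).
Proof. by rewrite /block_mass big_ord_recr. Qed.

Definition hit_mass j (wt : R) m (t u : seq T) : R :=
  (prefix_compat t u)%:R * (wt / block_mass (minn j m)).

Lemma hit_mass_ge0 j wt m t u : 0 <= wt -> 0 <= hit_mass j wt m t u.
Proof. by move=> w0; rewrite mulr_ge0// divr_ge0// ltW ?block_mass_gt0. Qed.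

Lemma hit_mass_step j wt m t u : 0 <= wt -> L u -> size u = block_time j ->
  size t = block_time m ->
  \sum_(v <- W j) hit_mass j.+1 wt m t (step u v) <= \sum_(v <- W j) hit_mass j wt m t u.
Proof.
(* Once the level of [t] is reached, compatibility is decided by the prefix and the mass is frozen;
   before it, [count_compat_step] matches the factor [K.+1 / size (W j)] of [block_mass]. *)
move=> w0 Lu su st; have [mj|jm] := leqP m j.
  rewrite big_seq [leRHS]big_seq; apply: ler_sum => v vW.
  rewrite /hit_mass (minn_idPr (leqW mj)) (minn_idPr mj).
  have [_ Lv _] := hW vW; have [s [r [_ _ -> _ _]]] := stepP Lu Lv.
  by rewrite prefix_compat_cat// st su block_time_le.
rewrite /hit_mass (minn_idPl jm) (minn_idPl (ltnW jm)) -mulr_suml -natr_sum.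
have := @count_compat_step j u t Lu _.
rewrite su st -block_timeS block_time_le// => /(_ isT).
rewrite -(ler_nat R) natrM => hc.
have p0 := block_mass_gt0 j; have s0 := size_W_gt0 j.
apply: le_trans (ler_wpM2r _ hc) _; first by rewrite divr_ge0// ltW ?block_mass_gt0.
rewrite big_const_seq count_predT iter_addr_0 block_massS le_eqVlt; apply/orP; left; apply/eqP.
rewrite -mulr_natr; field; rewrite ?gt_eqF ?ltr0n// -(ltr0n R)//.
Qed.

(** Averaging over the blocks at each step keeps the total hit mass below [eta] along some sequence;
    a word that this sequence followed to its end would by itself carry mass at least [eta]. *)
Lemma avoiding_path (X : set nat) (wt : nat -> R) (lv : nat -> nat) (t : nat -> seq T)
    (eta : R) :
  (forall i, 0 <= wt i) -> (forall i, size (t i) = block_time (lv i)) ->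
  (\esum_(i in X) (wt i)%:E < eta%:E)%E ->
  (forall i, X i -> eta <= wt i / block_mass (lv i)) ->
  exists U : nat -> seq T, U 0%N = [::] /\ forall j,
    [/\ L (U j), size (U j) = block_time j, exists2 v, v \in W j & U j.+1 = step (U j) v &
        forall i, X i -> t i != U (lv i)].
Proof.
move=> w0 st small hmass.
pose Om j u := (\esum_(i in X) (hit_mass j (wt i) (lv i) (t i) u)%:E)%E.
pose P j u := [/\ L u, size u = block_time j & (Om j u < eta%:E)%E].
have P0 : P 0%N [::].
  split; [exact: qm_nil HS|by rewrite /block_time big_ord0|].
  apply: le_lt_trans small; apply: le_esum => i _.
  by rewrite lee_fin /hit_mass /prefix_compat take0 eqxx mul1r min0n /block_mass big_ord0 divr1.
have Om0 j u : (0 <= Om j u)%E.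
  by apply: esum_ge0 => i _; rewrite lee_fin; exact: hit_mass_ge0.
have hstep j u : P j u -> exists2 v, v \in W j & P j.+1 (step u v).
  move=> [Lu su hu].
  have nW : W j != [::] by rewrite -size_eq0 -lt0n -(ltr0n R) size_W_gt0.
  have fin : Om j u \is a fin_num.
    by rewrite ge0_fin_numE// (lt_trans hu)// ltry.
  have hsum : (\sum_(v <- W j) Om j.+1 (step u v) <= \sum_(v <- W j) Om j u)%E.
    rewrite -!esum_sum; last 2 first.
      by move=> i v _ _; rewrite lee_fin; exact: hit_mass_ge0.
      by move=> i v _ _; rewrite lee_fin; exact: hit_mass_ge0.
    apply: le_esum => i _; rewrite !sumEFin lee_fin; exact: hit_mass_step.
  have [v vW hv] := exists_le_of_sum nW fin hsum.
  exists v => //; split; [exact: L_step vW| |exact: le_lt_trans hv hu].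
  by rewrite (size_step Lu vW) su block_timeS.
have [U [U0 hU]] := exists_seq_step P0 hstep.
exists U; split=> // j; have [[Lj sj _] [v vW e]] := hU j.
split=> //; first by exists v.
move=> i Xi; apply/eqP => ti.
have [[_ _ hi] _] := hU (lv i).
move: hi; apply/negP; rewrite -leNgt.
apply: (@le_trans _ _ (\sum_(x <- [:: i]) (hit_mass (lv i) (wt x) (lv x) (t x) (U (lv i)))%:E)%E).
  rewrite big_seq1 lee_fin -ti /hit_mass /prefix_compat eqxx mul1r minnn.
  exact: hmass.
rewrite sumEFin; apply: (@seq_le_esum R nat X
  (fun x => hit_mass (lv i) (wt x) (lv x) (t x) (U (lv i)))) => //.
by move=> x; rewrite inE => /eqP ->.
Qed.

Lemma path_deviation (U : nat -> seq T) : U 0%N = [::] ->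
  (forall j, L (U j) /\ exists2 v, v \in W j & U j.+1 = step (U j) v) ->
  forall j, `|ln (N (U j)) - (block_time j)%:R * alpha| <=
    \sum_(i < j) (eps i * (l i)%:R + (D * K%:R + `|D * K%:R - ln c| + K%:R * `|alpha|)).
Proof.
move=> U0 hU; elim=> [|j IH].
  by rewrite U0 (qm_N1 HS) ln1 /block_time !big_ord0 mul0r subrr normr0.
have [Lj [v vW ->]] := hU j; have [sv Lv hv] := hW vW.
have [s [r [_ _ _ _ hs]]] := stepP Lj Lv.
rewrite big_ord_recr /= block_timeS !natrD 2!mulrDl.
have Ka : `|K%:R * alpha| <= K%:R * `|alpha| by rewrite normrM normr_nat.
apply: le_trans (norm_dist4 hs IH hv Ka) _.
by apply: eq_ler; ring.
Qed.

Lemma block_time_sum j : (block_time j)%:R = \sum_(i < j) (l i)%:R + j%:R * K%:R :> R.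
Proof.
by rewrite -natrM -natr_sum -natrD /block_time big_split /= sum_nat_const card_ord.
Qed.

(** An unfinished block is no longer than the first block with its gap plus [j] letters; this costs
    a constant for each block passed, which [block_error] absorbs. *)
Lemma path_deviation_word (U : nat -> seq T) : U 0%N = [::] ->
  (forall j, [/\ L (U j), size (U j) = block_time j & exists2 v, v \in W j & U j.+1 = step (U j) v]) ->
  forall d : R, 0 < d -> exists M, forall j v, L (U j ++ v) -> (size v <= l j + K)%N ->
    `|ln (N (U j ++ v)) - (size (U j ++ v))%:R * alpha| <= d * (size (U j ++ v))%:R + M.
Proof.
move=> U0 hU d d0.
have [C eC] : exists C, C = D * K%:R + `|D * K%:R - ln c| + K%:R * `|alpha| by eexists.
have [C' eC'] : exists C', C' = D + `|alpha| by eexists.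
have [M hM] := block_error (C + C') d0.
exists (M + C' * (l 0 + K)%:R) => j v Lv sv.
have [Lj sj _] := hU j.
have dev := path_deviation U0 (fun j => let: And3 h1 _ h2 := hU j in conj h1 h2) j.
have C'0 : 0 <= C' by rewrite eC' addr_ge0 ?(qm_D HS).
have e1 : `|ln (N (U j ++ v)) - ln (N (U j))| <= D * (size v)%:R.
  have h1 := lnN_cat HS Lv; have h2 := lnN_subl HS Lv.
  have h3 := lnN_le HS (qm_factr HS Lv).
  by rewrite ler_norml; apply/andP; split; lra.
have sv' : (size v)%:R <= (l 0 + K)%:R + j%:R :> R.
  by rewrite -natrD ler_nat; move: sv; rewrite /l; clear; lia.
have e2 : C' * (size v)%:R <= C' * (l 0 + K)%:R + C' * j%:R by rewrite -mulrDr ler_wpM2l.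
have e3 : `|(size v)%:R * alpha| = `|alpha| * (size v)%:R by rewrite normrM normr_nat mulrC.
have e4 : \sum_(i < j) (eps i * (l i)%:R + (C + C')) =
    \sum_(i < j) (eps i * (l i)%:R + C) + j%:R * C'.
  rewrite mulr_natl -[X in _ *+ X](card_ord j) -sumr_const -big_split /=.
  by apply: eq_bigr => i _; rewrite addrA.
have e5 : d * (\sum_(i < j) (l i)%:R) <= d * (size (U j ++ v))%:R.
  rewrite ler_wpM2l ?(ltW d0)// size_cat sj natrD block_time_sum -addrA lerDl.
  by rewrite addr_ge0// mulr_ge0.
have := hM j; rewrite e4; move: dev; rewrite -eC -sj size_cat natrD mulrDl => dev hMj.
move: e5; rewrite size_cat natrD => e5.
have h1 := ler_normD (ln (N (U j ++ v)) - ln (N (U j))) (ln (N (U j)) - (size (U j))%:R * alpha).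
have h2 := ler_normB (ln (N (U j ++ v)) - ln (N (U j)) + (ln (N (U j)) - (size (U j))%:R * alpha))
  ((size v)%:R * alpha).
rewrite addrA subrK -[_ - _ - _ * alpha]addrA -opprD in h2.
rewrite addrA subrK in h1.
apply: (le_trans h2); move: h1 e1 e2 e3 dev hMj e5; rewrite eC'.
move: (\sum_(i < j) _) (\sum_(i < j) _) => x y; clear => h1 e1 e2 e3 dev hMj e5.
lra.
Qed.

(** The slack [h - s] absorbs all terms of lower order: the errors [eps], the factor [K.+1], the
    gaps, and the unfinished block up to time [n], which costs [|s|] per block passed. *)
Lemma block_mass_le (s : R) : s < h -> exists M, forall j n,
  (block_time j <= n < block_time j.+1)%N -> ln (block_mass j) <= M - s * n%:R.
Proof.
move=> sh; have d0 : 0 < h - s by rewrite subr_gt0.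
have [M hM] := block_error (ln K.+1%:R + s * K%:R + `|s|) d0.
exists (M + `|s| * (l 0 + K)%:R) => j n /andP[n1 n2].
have lnp : ln (block_mass j) <= \sum_(i < j) (ln K.+1%:R - (l i)%:R * (h - eps i)).
  elim: j {n1 n2} => [|j IH]; first by rewrite /block_mass !big_ord0 ln1.
  rewrite block_massS big_ord_recr /= lnM ?posrE ?block_mass_gt0 ?divr_gt0 ?size_W_gt0//.
  apply: lerD IH _; rewrite ln_div ?posrE ?size_W_gt0// lerD2l lerN2.
  by rewrite -[leLHS]expRK ler_ln ?posrE ?expR_gt0 ?size_W_gt0.
apply: (le_trans lnp); have := hM j.
have -> : \sum_(i < j) (ln K.+1%:R - (l i)%:R * (h - eps i)) =
    \sum_(i < j) (eps i * (l i)%:R + (ln K.+1%:R + s * K%:R + `|s|)) -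
    j%:R * (s * K%:R + `|s|) - h * \sum_(i < j) (l i)%:R.
  have -> : j%:R * (s * K%:R + `|s|) = \sum_(i < j) (s * K%:R + `|s|).
    by rewrite sumr_const card_ord mulr_natl.
  rewrite mulr_sumr -!sumrB.
  by apply: eq_bigr => i _; ring.
have hn : (n%:R : R) - (block_time j)%:R <= (l 0 + K)%:R + j%:R.
  rewrite lerBlDr -!natrD ler_nat; move: n2; rewrite block_timeS /l; clear; lia.
have hn0 : 0 <= (n%:R : R) - (block_time j)%:R by rewrite subr_ge0 ler_nat.
have hs : s * (n%:R - (block_time j)%:R) <= `|s| * ((l 0 + K)%:R + j%:R).
  exact: le_trans (ler_wpM2r hn0 (ler_norm s)) (ler_wpM2l (normr_ge0 s) hn).
move: hs; rewrite block_time_sum; move: (\sum_(i < j) _) (\sum_(i < j) _) => x y.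
move: (l 0 + K)%:R j%:R K%:R n%:R `|s| => a1 a2 a3 a4 a5 h1 h2.
by move: h1 h2; move: (h) (s) (M) => h' s' M' h1 h2; lra.
Qed.

End Moran.

(** * Mass distribution argument *)

Section EntropyLower.
Context {a : nat} {Q : 'M[bool]_a} {R : realType} {k : nat} {omega : R}.
Hypothesis om : 0 < omega < 1.
Local Notation Sigma := (subshift Q).
Implicit Types (x y z : Sigma).

Lemma word_of_le x y m n : (m <= n)%N -> word_of x n = word_of y n ->
  word_of x m = word_of y m.
Proof.
move=> mn /word_of_eq h; apply/word_of_eq => i /andP[i0 im]; apply: h.
by rewrite i0 /=; apply: lt_le_trans im _; rewrite lez_nat.
Qed.

Lemma limit_of_words (U : nat -> seq 'I_a) :
  (forall j, lang Q (U j)) -> (forall j, exists w, U j.+1 = U j ++ w) ->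
  exists z : Sigma, forall j, word_of z (size (U j)) = U j.
Proof.
move=> LU hU.
have pre j d : exists w, U (j + d)%N = U j ++ w.
  elim: d => [|d [w IH]]; first by exists [::]; rewrite addn0 cats0.
  by have [w' e] := hU (j + d)%N; exists (w ++ w'); rewrite addnS e IH catA.
have [u hu] := choice (fun j => langP (LU j)).
have [z hz] := subshift_cluster u; exists z => j.
have [n' jn' ag] := hz (size (U j)) j.
have [w e] := pre j (n' - j)%N; rewrite subnKC// in e.
have := hu n'; rewrite e => /word_of_catP[h _].
rewrite -[RHS]h; apply/word_of_eq => i /andP[i0 isz]; apply: ag.
by rewrite ger0_norm.
Qed.

Variables (D c kappa : R) (K : nat) (B : Sigma -> 'M[R]_k).
Hypothesis GB : good_cocycle D c kappa K B.
Let HS := gc_qm GB.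

(** By contradiction: against a cover of too small weight, a sequence of blocks that avoids every
    word of the cover yields a point of the level set outside all the balls. *)
Lemma htop_level_ge (alpha h : R) :
  (forall e : R, 0 < e -> exists n0, forall n, (n0 <= n)%N ->
    expR (n%:R * (h - e)) <= (size (@near_words R 'I_a (lang Q) (wnorm B) alpha e n))%:R) ->
  (h%:E <= htop omega (level_set B alpha))%E.
Proof.
move=> hcount.
have ipos (i : nat) : 0 < (i.+1%:R^-1 : R) by rewrite invr_gt0 ltr0n.
have [f [finf [j0 hj0]]] := diagonal_parameter (P := fun i n =>
  expR (n%:R * (h - i.+1%:R^-1)) <=
  (size (@near_words R 'I_a (lang Q) (wnorm B) alpha i.+1%:R^-1 n))%:R)
  (fun i => hcount _ (ipos i)).
pose l j := (j0 + j).+1.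
pose eps j : R := (f (l j)).+1%:R^-1.
pose W j := @near_words R 'I_a (lang Q) (wnorm B) alpha (eps j) (l j).
have hW j w : w \in W j -> [/\ size w = l j, lang Q w &
    `|ln (wnorm B w) - (l j)%:R * alpha| <= eps j * (l j)%:R] by exact: near_wordsP.
have uW j : uniq (W j) := uniq_near_words _ _ _.
have cW j : expR ((l j)%:R * (h - eps j)) <= (size (W j))%:R.
  by apply: hj0; rewrite /l; lia.
have eps0 (e : R) : 0 < e -> exists n1, forall n, (n1 <= n)%N -> eps n <= e.
  move=> e0; have [i hi] := nat_above e^-1; have [n1 hn1] := finf i.
  exists n1 => n nn; rewrite /eps -[e]invrK lef_pV2 ?posrE ?invr_gt0 ?ltr0n//.
  apply: le_trans hi _; rewrite ler_nat; apply: leqW; apply: hn1; rewrite /l; lia.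
have [step stepP] := join_step HS.
(* At a scale below [1], a ball of length [n] fixes the letters at times [0] to [n - 1]. *)
have e01 : 0 < (2^-1 : R) < 1 by apply/andP; split; lra.
apply: (htop_ge e01) => s sh.
have [M hM] := block_mass_le (K := K) cW eps0 sh.
exists 0%N, (expR (- M)); split; first exact: expR_gt0.
move=> X n x [_ cov]; rewrite leNgt; apply/negP => hlt.
(* Each ball is replaced by the prefix of its centre up to the last block boundary not after [n i],
   which the ball determines. *)
have [lev hlev] := choice (block_level (K := K) j0).
pose p i := word_of (x i) (block_time (K := K) j0 (lev (n i))).
have [|||U [U0 hU]] := avoiding_path HS hW uW cW stepP (X := X)
  (wt := fun i => expR (- s * (n i)%:R)) (lv := fun i => lev (n i)) (t := p) _ _ hlt _.
- by move=> i; exact: expR_ge0.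
- by move=> i; exact: size_word_of.
- move=> i _; have bm := block_mass_gt0 cW (lev (n i)) (K := K).
  rewrite ler_pdivlMr// -[block_mass _ _]lnK ?posrE// -expRD ler_expR.
  have := hM _ _ (hlev (n i)); rewrite mulNr => h1; clear -h1; lra.
have LU j : lang Q (U j) by have [] := hU j.
have [|z hz] := limit_of_words LU.
  move=> j; have [Lj _ [v vW ->] _] := hU j.
  have [_ Lv _] := hW _ _ vW; have [q [r [_ _ -> _ _]]] := stepP _ _ Lj Lv.
  by exists (q ++ v ++ r).
have hzl : level_set B alpha z.
  apply/cvgrPdist_le => d d0; have d20 : 0 < d / 2 by rewrite divr_gt0.
  have [M' hM'] := path_deviation_word HS hW eps0 stepP U0
    (fun j => let: And4 h1 h2 h3 _ := hU j in And3 h1 h2 h3) d20.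
  have [n0 hn0] := nat_above ((M' + `|ln kappa|) / (d / 2)).
  exists n0.+1 => // m /= mn; have m0 : 0 < m%:R :> R by rewrite ltr0n (leq_trans _ mn).
  rewrite -(ler_pM2l m0) -{1}(gtr0_norm m0) -normrM mulrBr mulVKf ?gt_eqF// distrC.
  have [j /andP[j1 j2]] := block_level (K := K) j0 m.
  have [_ sj _ _] := hU j.
  have ew : word_of z m = U j ++ word_of (shiftz (size (U j))%:Z z) (m - size (U j)).
    by rewrite -[in RHS](hz j) size_word_of -word_of_cat sj subnKC.
  have Lw := lang_word_of z m; rewrite ew in Lw.
  have := hM' j _ Lw; rewrite size_word_of sj => /(_ _).
  rewrite leq_subLR -block_timeS (ltnW j2) => /(_ isT).
  rewrite -sj -ew size_word_of => h1.
  have h2 := gc_ln GB z m.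
  have h3 : M' + `|ln kappa| <= d / 2 * m%:R.
    rewrite -ler_pdivrMl// mulrC; apply: le_trans hn0 _.
    by rewrite ler_nat ltnW.
  have h4 := ler_normD (ln (opnorm (cocycle_pos B m z)) - ln (wnorm B (word_of z m)))
    (ln (wnorm B (word_of z m)) - m%:R * alpha).
  rewrite addrA subrK in h4; apply: (le_trans h4).
  have h5 : m%:R * d = d / 2 * m%:R + d / 2 * m%:R by field.
  by move: h1 h2 h3 h5; clear => h1 h2 h3 h5; lra.
have [i Xi hi] := cov z hzl.
have := bowen_dist_word om (lt_trans hi (ltac:(lra) : (2^-1 : R) < 1)) => hw.
have [_ _ _ hav] := hU 0%N; have := hav i Xi; apply/negP; rewrite negbK /p.
have [_ sU _ _] := hU (lev (n i)); rewrite -(hz (lev (n i))) sU.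
by apply/eqP; apply: word_of_le hw; have /andP[] := hlev (n i).
Qed.

End EntropyLower.

Lemma le_inf_EFin (R : realType) (x : \bar R) (S : set R) : S !=set0 -> has_lbound S ->
  (forall y, S y -> (x <= y%:E)%E) -> (x <= (inf S)%:E)%E.
Proof.
move=> S0 lS h; apply/lee_addgt0Pr => e e0.
have [y Sy ye] := inf_adherent e0 (conj S0 lS).
by apply: le_trans (h y Sy) _; rewrite -EFinD lee_fin ltW.
Qed.

Lemma dist_squeeze (R : realType) (x u v y e1 e2 : R) :
  `|u - v| <= e1 -> `|v - y| <= e2 -> u <= x -> x <= v -> `|x - y| <= e1 + e2.
Proof.
by rewrite !ler_norml => /andP[? ?] /andP[? ?] ? ?; apply/andP; split; lra.
Qed.

Lemma dist_half (R : realType) (x y z e : R) :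
  `|x - y| <= e / 2 -> `|y - z| <= e / 2 -> `|x - z| <= e.
Proof.
by rewrite !ler_norml => /andP[? ?] /andP[? ?]; apply/andP; split; lra.
Qed.

(** * Entropy spectrum *)

Section Spectrum.
Context {a : nat} {Q : 'M[bool]_a} {R : realType} {k : nat} {omega : R}.
Hypothesis om : 0 < omega < 1.
Local Notation Sigma := (subshift Q).
Implicit Types (x y z : Sigma).
Variables (D c kappa : R) (K : nat) (B : Sigma -> 'M[R]_k).
Hypothesis GB : good_cocycle D c kappa K B.
Let HS := gc_qm GB.
Local Notation P := (@qpressure R 'I_a (lang Q) (wnorm B) D c K).
Local Notation beta := (@growth R 'I_a (lang Q) (wnorm B) D c K).
Local Notation slope := (dpressure omega B).

Lemma dpressure_slope (t : R) : 0 < t ->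
  slope_at P t (slope t) /\ support_at P t (slope t).
Proof.
move=> t0; have [|||d [h1 h2]] := convex_slope (P := P) (D := D) t0.
- by move=> u v w; exact: (qpressure_convex HS).
- by move=> u v; exact: (qpressure_lipschitz HS).
- by move=> u v; exact: (qpressure_no_corner HS t0).
rewrite /dpressure (derive1_slope (P := P) t0 _ h1 h2)// => q q0.
by rewrite (pressureE om GB)// ltW.
Qed.

Lemma htop_level_dpressure (t : R) : 0 < t ->
  htop omega (level_set B (slope t)) = (P t - t * slope t)%:E.
Proof.
move=> t0; have [h1 _] := dpressure_slope t0.
apply/eqP; rewrite eq_le (htop_level_le om GB)//=.
by apply: (htop_level_ge om GB); exact: count_near_words.
Qed.

Let C : R := ln #|'I_a|%:R.
Let C0 : 0 <= C := ln_natS_ge0 (card_alphabet_gt0 HS).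
Let hsup t (t0 : 0 < t) : support_at P t (slope t) := (dpressure_slope t0).2.
Let hlow q (q0 : 0 <= q) : q * beta <= P q := growth_le_qpressure HS q0.
Let hupp q (q0 : 0 <= q) : P q <= q * beta + C := qpressure_le_growth HS q0.

(** The upper bound holds at every [q], hence at the infimum. For the lower bound, some [t] has
    slope close to [beta]; words near that slope are near [beta], and their exponential rate is, up
    to [e], at least the gap. *)
Lemma htop_level_growth : htop omega (level_set B beta) = (asymptote_gap P beta)%:E.
Proof.
apply/eqP; rewrite eq_le; apply/andP; split.
  have [S0 lS] := asymptote_has_inf hlow.
  by apply: le_inf_EFin => // _ [q /= q0 <-]; exact: (htop_level_le om GB).
apply: (htop_level_ge om GB) => e e0; have e20 : 0 < e / 2 by rewrite divr_gt0.
have [t t0 ht] := support_near_asymptote hsup hlow hupp e20 C0.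
have tb := support_le_asymptote hsup hupp t0.
have gt := asymptote_gap_le_support hsup hlow hupp t0.
have [n0 hn0] := count_near_words HS t0 (dpressure_slope t0).1 e20.
exists n0 => n nn; apply: le_trans (le_trans _ (hn0 n nn)) _.
  rewrite ler_expR ler_wpM2l// lerB// ler_piMr ?(ltW e0)//.
  by rewrite invf_le1// ler1n.
rewrite ler_nat; apply: uniq_leq_size; first exact: uniq_near_words.
move=> w; rewrite !mem_filter => /andP[/andP[-> hw] ->]; rewrite andbT /=.
have h1 : `|n%:R * slope t - n%:R * beta| <= e * n%:R / 2.
  rewrite -mulrBr normrM normr_nat mulrAC [leRHS]mulrC ler_wpM2l// ler_norml.
  rewrite lerBrDr addrC ht; apply: le_trans (ltW e20); by rewrite subr_le0.
by apply: dist_half h1; rewrite mulrAC.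
Qed.

(** The supremum over points and the weight of a maximal word differ by at most the factor
    [kappa]. *)
Lemma max_exponentE : max_exponent B = beta.
Proof.
apply: cvg_lim => //.
apply: (@cvg_div_nat R (fun n => ln (sup [set opnorm (cocycle B n%:Z x) | x in [set: Sigma]]))
  _ (`|ln kappa| + 2 * (2 * (D * K%:R) + `|ln c|))) => n.
set S := [set _ | _ in _].
have [x0 hx0] := langP (L_max_word HS n); rewrite (size_max_word HS) in hx0.
have w0 := qm_gt0 HS (L_max_word HS n).
have lew x : opnorm (cocycle B n%:Z x) <= wnorm B (@max_word R 'I_a (lang Q) (wnorm B) n).
  apply: le_trans (gc_ge GB x n) _.
  have := N_le_max_word HS (lang_word_of x n); rewrite size_word_of ler_ln ?posrE//.
  exact: (qm_gt0 HS (lang_word_of x n)).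
have S0 : S !=set0 by exists (opnorm (cocycle B n%:Z x0)); exists x0.
have uS : ubound S (wnorm B (@max_word R 'I_a (lang Q) (wnorm B) n)).
  by move=> _ [x _ <-].
have Sw : sup S <= wnorm B (@max_word R 'I_a (lang Q) (wnorm B) n) by apply: ge_sup.
have oS : opnorm (cocycle_pos B n x0) <= sup S.
  by apply: ub_le_sup; [exists (wnorm B (@max_word R 'I_a (lang Q) (wnorm B) n))|exists x0].
have o0 := gc_gt0 GB x0 n; have s0 := lt_le_trans o0 oS.
have h1 := gc_ln GB x0 n; rewrite hx0 in h1.
have h2 := growthP HS n.
have h3 : ln (opnorm (cocycle_pos B n x0)) <= ln (sup S) by rewrite ler_ln ?posrE.
have h4 : ln (sup S) <= ln (wnorm B (@max_word R 'I_a (lang Q) (wnorm B) n)).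
  by rewrite ler_ln ?posrE.
exact: dist_squeeze h1 h2 h3 h4.
Qed.

Lemma htop_level_cvg_max_exponent :
  htop omega (level_set B (slope s)) @[s --> +oo] -->
  htop omega (level_set B (max_exponent B)).
Proof.
rewrite max_exponentE htop_level_growth.
have h := support_gap_cvg hsup hlow hupp.
have e : \forall s \near +oo, (P s - s * slope s)%:E = htop omega (level_set B (slope s)).
  by near=> s; rewrite htop_level_dpressure//; near: s; exact: nbhs_pinfty_gt.
apply: cvg_trans (near_eq_cvg e) _.
by apply: cvg_EFin; [exact: nearW|exact: h].
Unshelve. all: by end_near.
Qed.

End Spectrum.

Theorem theoremC (R : realType) (a : nat) (Q : 'M[bool]_a) (k : nat)
    (omega r : R) (A_ : nat -> subshift Q -> 'M[R]_k) (A : subshift Q -> 'M[R]_k)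
    (t_ : nat -> R) (t : R) :
  (0 < k)%N ->
  0 < omega < 1 -> 0 < r ->
  @topologically_mixing a Q R omega ->
  (forall l, typical omega r (A_ l)) -> typical omega r A ->
  Dr omega r (A_ l) A @[l --> \oo] --> 0 ->
  (forall l, 0 < t_ l) -> 0 < t -> t_ l @[l --> \oo] --> t ->
  (htop omega (level_set (A_ l) (dpressure omega (A_ l) (t_ l))) @[l --> \oo]
    --> htop omega (level_set A (dpressure omega A t))) /\
  (htop omega (level_set A (dpressure omega A s)) @[s --> +oo]
    --> htop omega (level_set A (max_exponent A))).
Proof.
move=> k0 om rp mix tyA_ tyA hD t_0 t0 ht.
have fb_ l : fiber_bunched omega r (A_ l) by case: (tyA_ l).
have [D [c [kappa [K [GA GA_ hN]]]]] := good_family k0 om rp mix tyA fb_ hD.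
split; last exact: (htop_level_cvg_max_exponent om GA).
have HS_ : \forall l \near \oo, qm_system (lang Q) (wnorm (A_ l)) D c K.
  by apply: filterS GA_ => l; exact: gc_qm.
suff h x : x = (@qpressure R 'I_a (lang Q) (wnorm A) D c K t - t * dpressure omega A t)%:E ->
    htop omega (level_set (A_ l) (dpressure omega (A_ l) (t_ l))) @[l --> \oo] --> x.
  exact: (h _ (htop_level_dpressure om GA t0)).
move=> ->.
have [slA _] := dpressure_slope om GA t0.
(* Near [A] the constants [D], [c] and [K] are common, so from some [l] on all the pressures share
   the Lipschitz constant [D] and the error bound. *)
have lim := support_limit (P_ := fun l => @qpressure R 'I_a (lang Q) (wnorm (A_ l)) D c K)
  (d_ := fun l => dpressure omega (A_ l) (t_ l)) (D := D) t0 ht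
  (fun q q0 => qpressure_cvg HS_ (gc_qm GA) hN (ltW q0)) _ slA.
have e : \forall l \near \oo,
    (@qpressure R 'I_a (lang Q) (wnorm (A_ l)) D c K (t_ l) -
     t_ l * dpressure omega (A_ l) (t_ l))%:E =
    htop omega (level_set (A_ l) (dpressure omega (A_ l) (t_ l))).
  by apply: filterS GA_ => l Gl; rewrite (htop_level_dpressure om Gl).
apply: cvg_trans (near_eq_cvg e) _.
apply: cvg_EFin; first exact: nearW.
apply: lim; apply: filterS GA_ => l Gl; split=> //; split; first exact: (dpressure_slope om Gl (t_0 l)).2.
by move=> u v; exact: (qpressure_lipschitz (gc_qm Gl)).
Qed.
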